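(* Let $d\ge2$ be an integer. There exist a function $g=g(x)\in C_c(\mathbb{R}^d)$, independent of $v$, and a bounded distributional stationary solution $f=f(x,v)$ of $$(\partial_t+v\cdot\nabla_x)f=\Delta_v f+g\qquad\text{in }\mathbb{R}_t\times\mathbb{R}_x^d\times\mathbb{R}_v^d,$$ such that $D_v^2f\notin L^\infty_{\mathrm{loc}}(\mathbb{R}^d\times\mathbb{R}^d)$. Moreover, there are constants $C,c>0$, independent of $\varepsilon$, such that for all sufficiently small $\varepsilon>0$ there exist a smooth compactly supported forcing $g_\varepsilon=g_\varepsilon(x)$, independent of $v$, with $\|g_\varepsilon\|_{L^\infty(\mathbb{R}^d)}\le C$, and a smooth bounded stationary solution $f_\varepsilon=f_\varepsilon(x,v)$ of $$(\partial_t+v\cdot\nabla_x)f_\varepsilon=\Delta_v f_\varepsilon+g_\varepsilon\qquad\text{in }\mathbb{R}_t\times\mathbb{R}_x^d\times\mathbb{R}_v^d,$$ such that $$\|f_\varepsilon\|_{L^\infty(\mathbb{R}^d\times\mathbb{R}^d)}\le C,\qquad \|D_v^2f_\varepsilon\|_{L^\infty(\mathbb{R}^d\times\mathbb{R}^d)}\ge c\left(\log\frac1\varepsilon\right)^{1/2}.$$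
   Context: Points are written $(t,x,v)\in\mathbb{R}\times\mathbb{R}^d\times\mathbb{R}^d$. $C_c(\mathbb{R}^d)$ is the space of continuous compactly supported functions. A stationary solution is one that does not depend on $t$; a distributional solution satisfies the equation in the sense of distributions. $D_v^2 f$ is the $d\times d$ (distributional) Hessian matrix of $f$ in $v$, measured in the Frobenius norm $|M|=(\sum_{i,j}|M_{ij}|^2)^{1/2}$, and $\Delta_v$ is the Laplacian in $v$. *)

(* Defs.v *)
From HB Require Import structures.
From mathcomp Require Import all_boot all_order all_algebra.
From mathcomp Require Import all_classical all_reals all_analysis.

Set Implicit Arguments.
Unset Strict Implicit.
Unset Printing Implicit Defensive.
Import Order.TTheory GRing.Theory Num.Theory.
Import numFieldNormedType.Exports.
Local Open Scope classical_set_scope.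
Local Open Scope ring_scope.

(* Matrices carry the sigma-algebra generated by their entries (the Borel one
   when the entries are real), like the library's tuples. *)
Definition measure_matrix_display : measure_display -> measure_display.
Proof. exact. Qed.

Section measurable_matrix.
Context {d} {T : sigmaRingType d} (m n : nat).

Definition matrix_salgebra : set (set 'M[T]_(m, n)) :=
  <<s \bigcup_(ij in [set: 'I_m * 'I_n])
        preimage_set_system setT (fun M : 'M[T]_(m, n) => M ij.1 ij.2) measurable >>.

Let matrix_set0 : matrix_salgebra set0.
Proof. exact: sigma_algebra0. Qed.

Let matrix_setC A : matrix_salgebra A -> matrix_salgebra (~` A).
Proof. exact: sigma_algebraC. Qed.

Let matrix_bigcup (F : _^nat) : (forall i, matrix_salgebra (F i)) ->
  matrix_salgebra (\bigcup_i (F i)).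
Proof. exact: sigma_algebra_bigcup. Qed.

HB.instance Definition _ := @isMeasurable.Build (measure_matrix_display d)
  'M[T]_(m, n) matrix_salgebra matrix_set0 matrix_setC matrix_bigcup.

End measurable_matrix.


Lemma measurable_fun_matrixP d d' (S : measurableType d) (T : measurableType d')
    m n (f : S -> 'M[T]_(m, n)) :
  measurable_fun setT f <-> forall i j, measurable_fun setT (fun x => f x i j).
Proof.
split=> [mf i j|mf].
  apply: (@measurableT_comp _ _ _ _ _ _ (fun M : 'M[T]_(m, n) => M i j)) => //.
  move=> _ Y mY; apply: sub_sigma_algebra.
  by exists (i, j) => //; exists Y.
apply: measurability => // _ [_ [[i j] _ [Y mY <-]] <-].
by rewrite !setTI; have := mf i j measurableT _ mY; rewrite setTI.
Qed.

(* The library's canonical structures make [m1 \x m2] sigma-finite only when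
   both factors are sub-probabilities; this alias carries the general case. *)
Section product_measure_sigma_finite.
Context d1 d2 (T1 : measurableType d1) (T2 : measurableType d2) (R : realType).
Variable m1 : {sigma_finite_measure set T1 -> \bar R}.
Variable m2 : {sigma_finite_measure set T2 -> \bar R}.

Definition sigma_prod : set (T1 * T2) -> \bar R := (m1 \x m2)%E.

HB.instance Definition _ := Measure.on sigma_prod.

Let sigma_prod_sigma_finite : sigma_finite setT sigma_prod.
Proof.
have /sigma_finiteP[F [TF ndF Foo]] := sigma_finiteT m1.
have /sigma_finiteP[G [TG ndG Goo]] := sigma_finiteT m2.
exists (fun n => F n `*` G n).
 rewrite -setXTT TF TG predeqE => -[x y]; split.
    move=> [/= [n _ Fnx] [k _ Gky]]; exists (maxn n k) => //; split.
    - by move: x Fnx; exact/subsetPset/ndF/leq_maxl.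
    - by move: y Gky; exact/subsetPset/ndG/leq_maxr.
  by move=> [n _ []/= ? ?]; split; exists n.
move=> k; have [? ?] := Foo k; have [? ?] := Goo k.
split; first exact: measurableX.
by rewrite /sigma_prod product_measure1E// lte_mul_pinfty// ge0_fin_numE.
Qed.

HB.instance Definition _ := Measure_isSigmaFinite.Build _ _ _ sigma_prod
  sigma_prod_sigma_finite.

End product_measure_sigma_finite.

Section lebesgue_rV.
Variable R : realType.

Definition cons_rV n (p : measurableTypeR R * 'rV[R]_n) : 'rV[R]_n.+1 :=
  row_mx (p.1)%:M p.2.

Definition uncons_rV n (x : 'rV[R]_n.+1) : measurableTypeR R * 'rV[R]_n :=
  (x 0 0, \row_j x 0 (lift ord0 j)).

Lemma cons_rVK n : cancel (@cons_rV n) (@uncons_rV n).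
Proof.
move=> [t x]; rewrite /uncons_rV /cons_rV /=; congr pair.
  have -> : (0 : 'I_n.+1) = lshift n (0 : 'I_1) by exact: val_inj.
  by rewrite (@row_mxEl _ 1 1 n) mxE.
apply/rowP => j; rewrite mxE.
have -> : lift ord0 j = rshift 1 j by exact: val_inj.
exact: (@row_mxEr _ 1 1 n).
Qed.

Lemma measurable_cons_rV n : measurable_fun setT (@cons_rV n).
Proof.
apply/measurable_fun_matrixP => i j; rewrite (ord1 i) /cons_rV.
have [k ->|k ->] := split_ordP (j : 'I_(1 + n)).
- apply: (eq_measurable_fun fst) => // p _.
  by rewrite (@row_mxEl _ 1 1 n) (ord1 k) mxE.
- apply: (eq_measurable_fun (fun p : measurableTypeR R * 'rV[R]_n => p.2 0 k)).
    by move=> p _; rewrite (@row_mxEr _ 1 1 n).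
  have /measurable_fun_matrixP := @measurable_snd _ _ (measurableTypeR R) 'rV[R]_n.
  exact.
Qed.

Lemma measurable_uncons_rV n : measurable_fun setT (@uncons_rV n).
Proof.
have mE i : measurable_fun setT (fun x : 'rV[R]_n.+1 => x 0 i).
  have /measurable_fun_matrixP := @measurable_id _ 'rV[R]_n.+1 setT.
  exact.
have m2 : measurable_fun setT
    (fun x : 'rV[R]_n.+1 => \row_j x 0 (lift ord0 j) : 'rV[R]_n).
  apply/measurable_fun_matrixP => i j.
  apply: (eq_measurable_fun (fun x : 'rV[R]_n.+1 => x 0 (lift ord0 j))) => //.
  by move=> x _; rewrite mxE.
exact: (measurable_fun_pair (mE 0) m2).
Qed.

Section lebesgue_rVS.
Variables (n : nat) (mu : {sigma_finite_measure set 'rV[R]_n -> \bar R}).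

Definition lebesgue_rVS : set 'rV[R]_n.+1 -> \bar R :=
  pushforward (sigma_prod (@lebesgue_measure R) mu) (@cons_rV n).

(* Named explicitly because the instance depends on a measurability proof. *)
Let image := measure_function_pushforward__canonical__measure_function_Measure
  (sigma_prod (@lebesgue_measure R) mu) (@measurable_cons_rV n).

HB.instance Definition _ := isMeasure.Build _ _ _ lebesgue_rVS
  (@measure0 _ _ _ image) (@measure_ge0 _ _ _ image)
  (@measure_semi_sigma_additive _ _ _ image).

Let lebesgue_rVS_sigma_finite : sigma_finite setT lebesgue_rVS.
Proof.
have [F FT mF] := sigma_finiteT (sigma_prod (@lebesgue_measure R) mu).
exists (fun k => @uncons_rV n @^-1` F k).
  by rewrite -preimage_bigcup -FT preimage_setT.
move=> k; have [mFk Fk] := mF k; split.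
  by rewrite -[X in measurable X]setTI; exact: measurable_uncons_rV.
rewrite /lebesgue_rVS /pushforward -comp_preimage.
by rewrite (_ : _ \o _ = id) ?preimage_id//; apply/funext => p /=; rewrite cons_rVK.
Qed.

HB.instance Definition _ :=
  Measure_isSigmaFinite.Build _ _ _ lebesgue_rVS lebesgue_rVS_sigma_finite.

End lebesgue_rVS.

(* n-dimensional Lebesgue measure: the product of n copies of the Lebesgue
   measure on the line, the row x being identified with the pair (x_0, rest). *)
Fixpoint lebesgue_rV n : {sigma_finite_measure set 'rV[R]_n -> \bar R} :=
  if n is k.+1 then lebesgue_rVS (lebesgue_rV k) else dirac (0 : 'rV[R]_0).

End lebesgue_rV.

Section calculus.
Variables (R : realType) (V : normedModType R).
Implicit Types f : V -> R.

Definition iter_derive (s : seq V) f : V -> R :=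
  foldr (fun u h => fun x => 'D_u h x) f s.

(* On a finite-dimensional V this is the usual C^oo: differentiability of every
   iterated directional derivative also makes each of them continuous. *)
Definition smooth f := forall (s : seq V) x, differentiable (iter_derive s f) x.

Definition compact_support f := compact (closure [set x | f x != 0]).

Definition test_function f := smooth f /\ compact_support f.

End calculus.

Section kinetic.
Variables (R : realType) (d : nat).

Local Notation position := 'rV[R]_d.
Local Notation phase := ('rV[R]_d * 'rV[R]_d)%type.
Local Notation event := (R * phase)%type.

Definition lebesgue_xv : {sigma_finite_measure set phase -> \bar R} :=
  sigma_prod (lebesgue_rV R d) (lebesgue_rV R d).

Definition lebesgue_txv :
    {sigma_finite_measure set (measurableTypeR R * phase)%type -> \bar R} :=
  sigma_prod (@lebesgue_measure R) lebesgue_xv.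

Definition basis (i : 'I_d) : position := delta_mx 0 i.

Definition d_t (F : event -> R) (z : event) : R :=
  'D_((1, (0, 0)) : event) F z.

Definition d_x (i : 'I_d) (F : event -> R) (z : event) : R :=
  'D_((0, (basis i, 0)) : event) F z.

Definition d_v (i : 'I_d) (F : event -> R) (z : event) : R :=
  'D_((0, (0, basis i)) : event) F z.

Definition kinetic_transport (F : event -> R) (z : event) : R :=
  d_t F z + \sum_(i < d) z.2.2 0 i * d_x i F z.

Definition laplacian_v (F : event -> R) (z : event) : R :=
  \sum_(i < d) d_v i (d_v i F) z.

Definition classical_solution (F G : event -> R) :=
  forall z, kinetic_transport F z = laplacian_v F z + G z.

(* The transport operator is skew-adjoint because v does not depend on x. *)
Definition distributional_solution (F G : event -> R) :=
  forall phi : event -> R, test_function phi ->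
    \int[lebesgue_txv]_z (F z * - kinetic_transport phi z) =
    \int[lebesgue_txv]_z (F z * laplacian_v phi z + G z * phi z).

Definition frobenius (M : 'M[R]_d) : R :=
  Num.sqrt (\sum_(i < d) \sum_(j < d) `|M i j| ^+ 2).

Definition hessian_v (f : phase -> R) (p : phase) : 'M[R]_d :=
  \matrix_(i, j) 'D_((0, basis i) : phase)
    (fun q => 'D_((0, basis j) : phase) f q) p.

Definition distributional_hessian_v (f : phase -> R) (H : phase -> 'M[R]_d) :=
  forall phi : phase -> R, test_function phi -> forall i j,
    \int[lebesgue_xv]_p (f p * hessian_v phi p i j) =
    \int[lebesgue_xv]_p (H p i j * phi p).

Definition Linfty_loc (H : phase -> 'M[R]_d) :=
  measurable_fun setT H /\
  forall K : set phase, compact K ->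
    ('N[lebesgue_xv]_+oo[EFin \o ((frobenius \o H) \_ K)] < +oo)%E.

(* A distribution belongs to L^oo_loc when it is represented by such a
   function. *)
Definition hessian_v_Linfty_loc (f : phase -> R) :=
  exists H : phase -> 'M[R]_d, Linfty_loc H /\ distributional_hessian_v f H.

End kinetic.

(* Main.v *)
(** If [u] solves the heat equation with initial datum [phi], then
    [F (x, v) = \int_0^oo u (t^3 / 3, x - t v) dt] satisfies
    [v . grad_x F = Delta_v F + phi], because
    [d/dt u (t^3 / 3, x - t v) = t^2 Delta u - v . grad u]. For [phi] a bump that
    is odd in [x_0] and in [x_1], [phi 0 = 0] but [d_v0 d_v1 F] is positive at the
    origin.

    The equation is preserved by [(x, v) |-> (8^k x, 2^k v)] up to the factor
    [4^k], hence [f_n = \sum_(k < n) a_k 4^-k F (8^k x, 2^k v)] solves it with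
    forcing [g_n = \sum_(k < n) a_k phi (8^k x)], where [a_k = 1 / (k + 1)]. As
    [phi] vanishes at the origin and outside the unit cube, [g_n] converges
    uniformly, and so does [f_n], while [d_v0 d_v1 f_n] at the origin is a multiple
    of the harmonic sum. The Hessian of the limit is seen to be locally unbounded
    by testing it against bumps at scale [(8^-n, 2^-n)], on which
    [d_v0 d_v1 f_n] differs from its value at the origin by a bounded amount. *)
Require Import Defs.
From HB Require Import structures.
From mathcomp Require Import all_boot all_order all_algebra.
From mathcomp Require Import all_classical all_reals all_analysis.
From mathcomp Require Import measurable_realfun ess_sup_inf.
From mathcomp Require Import ring lra zify.

Set Implicit Arguments.
Unset Strict Implicit.
Unset Printing Implicit Defensive.
Import Order.TTheory GRing.Theory Num.Theory.
Import numFieldNormedType.Exports.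
Local Open Scope classical_set_scope.
Local Open Scope ring_scope.

(** * Smooth functions *)

(** The elapsed time is reparametrised: with s = 3 t^2 the spread of the position, of order s^(3/2),
    becomes the polynomial 12 t^3, so everything is differentiable across t = 0. The heat solution
    is written as an average of the datum at a + b y against one fixed Gaussian weight in y, which
    avoids a kernel that is singular at time 0. F belongs to a family indexed by a power m of s and
    a multi-index of derivatives of the datum. A position derivative raises the multi-index, a
    velocity derivative raises both, so the family is closed under differentiation and uniform
    bounds on its members give smoothness at once. Decay in t comes from the compact support of the
    datum and integration by parts in y. The sign of the mixed derivative comes from a symmetry: at
    the origin the two odd factors contribute equal averages, hence a square. In the final test
    against bumps the scales balance: two velocity derivatives of a bump at scale (8^-n, 2^-n) cost
    4^n, which the 4^-n bound on f - f_n absorbs. *)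

Lemma continuous_sum (R : realType) (T : topologicalType) (I : Type) (s : seq I)
    (F : I -> T -> R) :
  (forall i, continuous (F i)) -> continuous (fun x => \sum_(i <- s) F i x).
Proof.
move=> cF; elim: s => [|i s IH] x.
  by under eq_fun do rewrite big_nil; exact: cvg_cst.
under eq_fun do rewrite big_cons.
by apply: continuousD; [exact: cF|exact: IH].
Qed.

Lemma is_derive_continuous (R : realType) (f df : R -> R) :
  (forall x, is_derive x (1 : R) f (df x)) -> continuous f.
Proof.
by move=> fd x; apply/differentiable_continuous/derivable1_diffP; case: (fd x).
Qed.

Section line_derivative.
Variables (R : realType) (V : normedModType R).
Implicit Types (f : V -> R) (x h u : V).

Lemma is_derive_line f x h (t df : R) :
  is_derive (t *: h + x) h f df <->
  is_derive t (1 : R) (fun s => f (s *: h + x)) df.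
Proof.
have E : (fun s : R => s^-1 *: ((f \o shift (t *: h + x)) (s *: h) -
                       f (t *: h + x))) =
    (fun s : R => s^-1 *: (((fun s0 : R => f (s0 *: h + x)) \o shift t) (s *: (1 : R)) -
                  f (t *: h + x))).
  apply/funext => s /=; congr (_ *: (f _ - _)).
  by rewrite [_ *: (1 : R)]mulr1 scalerDl addrA.
split=> -[d1 d2].
  by split; [rewrite /derivable -E|rewrite -d2 /derive -E].
by split; [rewrite /derivable E|rewrite -d2 /derive E].
Qed.

Lemma mvt_line f (df : V -> R) x h :
  (forall y, is_derive y h f (df y)) ->
  exists2 t : R, 0 <= t <= 1 & f (h + x) - f x = df (t *: h + x).
Proof.
move=> dfE; have dl (t : R) : is_derive t 1 (fun s => f (s *: h + x)) (df (t *: h + x)).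
  exact/is_derive_line.
have [|t t01] := @MVT_segment R (fun s => f (s *: h + x))
    (fun t => df (t *: h + x)) 0 1 ler01 (fun t _ => dl t).
  by apply: derivable_within_continuous => t _; have [] := dl t.
rewrite scale1r scale0r add0r subr0 mulr1 => E; exists t => //.
Qed.

(** A quadratic remainder is o(h). This is the only route by which differentials are produced from
    scratch below, once for the families of integrals and once for the flat exponential at 0. *)
Lemma is_diff_quadratic f x (L : {linear V -> R}) (C : R) :
  continuous L -> (forall h, `|f (h + x) - f x - L h| <= C * `|h| ^+ 2) ->
  is_diff x f L.
Proof.
move=> cL fL.
have E : f \o shift x = cst (f x) + L +o_ 0 id.
  apply/eqaddoP => _ /posnumP[e].
  have d0 : 0 < e%:num / (`|C| + 1) by rewrite divr_gt0.
  apply/nbhs_normP; exists (e%:num / (`|C| + 1)) => // h /=.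
  rewrite distrC subr0 => /ltW he.
  rewrite !fctE /= opprD addrA.
  apply: (le_trans (fL h)); rewrite expr2 mulrA ler_wpM2r//.
  have CC : C <= `|C| + 1 by rewrite (le_trans (ler_norm C))// lerDl.
  apply: (le_trans (ler_wpM2r (normr_ge0 h) CC)).
  by rewrite mulrC -ler_pdivlMr.
have dE := diff_unique cL E.
by split => //; apply/diff_locallyP; rewrite dE.
Qed.

End line_derivative.

Section smooth_theory.
Variables (R : realType) (V : normedModType R).
Implicit Types (f g : V -> R) (x u : V).

(** A coinduction principle: an invariant that implies differentiability and survives every
    directional derivative implies smoothness. The induction peels the list from its end because
    [foldr] applies the last direction first. *)
Lemma smooth_coind (P : (V -> R) -> Prop) :
  (forall f, P f -> (forall x, differentiable f x) /\
                    forall u, P (fun x => 'D_u f x)) ->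
  forall f, P f -> smooth f.
Proof.
move=> Pstep f Pf s; elim/last_ind: s f Pf => [|s u IH] f Pf x.
  exact: (Pstep f Pf).1.
rewrite /iter_derive foldr_rcons; apply: (IH (fun x => 'D_u f x)).
exact: (Pstep f Pf).2.
Qed.

Lemma smooth_differentiable f x : smooth f -> differentiable f x.
Proof. by move/(_ [::]); exact. Qed.

Lemma smooth_is_derive f x u : smooth f -> is_derive x u f ('D_u f x).
Proof. by move=> sf; apply/derivableP/diff_derivable/smooth_differentiable. Qed.

Lemma smooth_derive f u : smooth f -> smooth (fun x => 'D_u f x).
Proof.
move=> sf s x; have := sf (rcons s u) x.
by rewrite /iter_derive foldr_rcons.
Qed.

Lemma smooth_continuous f : smooth f -> continuous f.
Proof.
by move=> sf x; apply/differentiable_continuous/smooth_differentiable.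
Qed.

(** Smoothness from bounds alone, for a family whose derivatives are combinations of its members.
    The bounds make each member Lipschitz by the mean value theorem; the Lipschitz bounds of the
    next members then give a quadratic Taylor remainder, hence a genuine differential rather than
    mere directional derivatives. *)
Lemma smooth_family (I : Type) (J : finType) (P : I -> Prop) (W : I -> V -> R)
    (next : I -> J -> I) (B : I -> R) (l : J -> {linear V -> R}) :
  (forall j, continuous (l j)) ->
  (forall i j, P i -> P (next i j)) ->
  (forall i x, P i -> `|W i x| <= B i) ->
  (forall i u x, P i -> is_derive x u (W i) (\sum_j l j u * W (next i j) x)) ->
  forall i, P i -> smooth (W i).
Proof.
move=> cl Pn WB dW.
have /choice[k kP] : forall j, exists k, 0 < k /\ forall x, `|l j x| <= k * `|x|.
  by move=> j; have [k k0 kP] := linear_lipschitz (cl j); exists k.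
have WL i : P i -> exists2 C, 0 <= C & forall h x, `|W i (h + x) - W i x| <= C * `|h|.
  move=> Pi; exists (\sum_j k j * `|B (next i j)|).
    by apply: sumr_ge0 => j _; rewrite mulr_ge0// ltW//; case: (kP j).
  move=> h x; have [t _ ->] := mvt_line x (fun y => dW i h y Pi).
  apply: (le_trans (ler_norm_sum _ _ _)); rewrite mulr_suml ler_sum// => j _.
  rewrite normrM mulrAC ler_pM//; first by case: (kP j).
  by rewrite (le_trans (WB _ _ (Pn _ _ Pi)))// ler_norm.
have dfW i x : P i -> differentiable (W i) x.
  move=> Pi.
  have /choice[C CP] : forall j, exists C, 0 <= C /\
      forall h y, `|W (next i j) (h + y) - W (next i j) y| <= C * `|h|.
    by move=> j; have [C] := WL _ (Pn _ j Pi); exists C.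
  pose d u := \sum_j l j u * W (next i j) x.
  have lin_d : linear d.
    move=> a u v; rewrite /d scaler_sumr -big_split; apply: eq_bigr => j _ /=.
    by rewrite linearP mulrDl scalerAl.
  pose dM := GRing.isLinear.Build _ _ _ _ _ lin_d.
  pose D : {linear V -> R} := HB.pack d dM.
  suff H : is_diff x (W i) D by exact: ex_diff.
  apply: (@is_diff_quadratic _ _ _ _ D (\sum_j k j * C j)).
    apply: continuous_sum => j u.
    by apply: continuousM; [exact: cl|exact: cvg_cst].
  move=> h; have [t t01 ->] := mvt_line x (fun y => dW i h y Pi).
  rewrite /= /d -sumrB mulr_suml; apply: (le_trans (ler_norm_sum _ _ _)).
  rewrite ler_sum// => j _; rewrite -mulrBr normrM.
  have [kj kjP] := kP j; have [Cj CjP] := CP j.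
  rewrite expr2 mulrACA ler_pM//.
  apply: (le_trans (CjP _ _)); rewrite ler_wpM2l// normrZ ler_piMl//.
  by rewrite ger0_norm; case/andP: t01.
(* The members alone are not stable under differentiation, their linear span is; it serves as the
   coinductive invariant. Recording the number of summands makes it accessible to induction. *)
pose span := fix span (n : nat) f := if n is n'.+1 then
  (exists a i g, [/\ P i, span n' g & f = fun x => a * W i x + g x]) else f = cst 0.
move=> i Pi; apply: (@smooth_coind (fun f => exists n, span n f)); last first.
  exists 1%N; exists 1, i, (cst 0); split => //.
  by apply/funext => x; rewrite mul1r /cst addr0.
have span_add n f m g : span n f -> span m g -> span (n + m)%N (fun x => f x + g x).
  elim: n f => [|n IH] f /=.
    by move=> -> gm; rewrite add0n (_ : (fun x => _) = g)//;
      apply/funext => x; rewrite add0r.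
  move=> [a [i' [f' [Pi' sf' ->]]]] gm; exists a, i', (fun x => f' x + g x).
  by split => //; [exact: IH|apply/funext => x; rewrite addrA].
have span_sum (s : seq J) (c : J -> R) i' : P i' ->
    span (size s) (fun x => \sum_(j <- s) c j * W (next i' j) x).
  move=> Pi'; elim: s => [|j s IH] /=.
    by apply/funext => x; rewrite big_nil.
  exists (c j), (next i' j), (fun x => \sum_(j <- s) c j * W (next i' j) x).
  by split; [exact: Pn|exact: IH|apply/funext => x; rewrite big_cons].
have span_ok n f : span n f -> (forall x, differentiable f x) /\
    forall u, exists m, span m (fun x => 'D_u f x).
  elim: n f => [|n IH] f /=.
    move=> ->; split; first by move=> x; exact: differentiable_cst.
    by move=> u; exists 0%N => /=; apply/funext => x; rewrite derive_cst.
  move=> [a [i' [g [Pi' sg ->]]]]; have [dg Dg] := IH _ sg; split.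
    move=> x; apply: differentiableD => //.
    by apply: differentiableZ; exact: dfW.
  move=> u; have [m sm] := Dg u.
  exists (size (index_enum J) + m)%N.
  rewrite (_ : (fun x => _) = fun x =>
    \sum_j (a * l j u) * W (next i' j) x + 'D_u g x).
    by apply: span_add => //; exact: span_sum.
  apply/funext => x; have dWx := dW i' u x Pi'.
  rewrite [LHS](_ : _ = 'D_u ((a \*: W i') + g) x)// deriveD.
  - rewrite deriveZ; last by case: dWx.
    rewrite derive_val scaler_sumr; congr (_ + _).
    by apply: eq_bigr => j _; rewrite -mulrA.
  - by apply: derivableZ; case: dWx.
  - exact: diff_derivable.
move=> f [n sf]; exact: span_ok sf.
Qed.

Lemma derive_lin_dir f (a : R) u v x : differentiable f x ->
  'D_(a *: u + v) f x = a * 'D_u f x + 'D_v f x.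
Proof. by move=> df; rewrite !deriveE// linearP. Qed.

(** The product rule mixes sums and products, so the invariant for [smooth_coind] has to be closed
    under both operations simultaneously. *)
Inductive smooth_gen : (V -> R) -> Prop :=
| smooth_gen_base f of smooth f : smooth_gen f
| smooth_gen_add f g of smooth_gen f & smooth_gen g :
    smooth_gen (fun x => f x + g x)
| smooth_gen_mul f g of smooth_gen f & smooth_gen g :
    smooth_gen (fun x => f x * g x).

Lemma smooth_genP f : smooth_gen f -> smooth f.
Proof.
apply: smooth_coind => {}f.
elim=> [{}f sf|{}f g _ [df Df] _ [dg Dg]|{}f g gf [df Df] gg [dg Dg]].
- split=> [x|u]; first exact: smooth_differentiable.
  exact/smooth_gen_base/smooth_derive.
- split=> [x|u]; first exact: differentiableD.
  rewrite (_ : (fun x => _) = fun x => 'D_u f x + 'D_u g x).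
    exact: smooth_gen_add.
  by apply/funext => x; rewrite [LHS](_ : _ = 'D_u (f + g) x)// deriveD//;
    exact: diff_derivable.
- split=> [x|u]; first exact: differentiableM.
  rewrite (_ : (fun x => _) = fun x => f x * 'D_u g x + g x * 'D_u f x).
    by apply: smooth_gen_add; exact: smooth_gen_mul.
  by apply/funext => x; rewrite [LHS](_ : _ = 'D_u (f * g) x)// deriveM//;
    exact: diff_derivable.
Qed.

Lemma smoothD f g : smooth f -> smooth g -> smooth (fun x => f x + g x).
Proof.
by move=> sf sg; apply/smooth_genP/smooth_gen_add; exact: smooth_gen_base.
Qed.

Lemma smoothM f g : smooth f -> smooth g -> smooth (fun x => f x * g x).
Proof.
by move=> sf sg; apply/smooth_genP/smooth_gen_mul; exact: smooth_gen_base.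
Qed.

Lemma smooth_cst (a : R) : smooth (fun _ : V => a).
Proof.
apply: (@smooth_coind (fun f => exists a, f = cst a)); last by exists a.
move=> _ [b ->]; split=> [x|u]; first exact: differentiable_cst.
by exists 0; apply/funext => x; rewrite derive_cst.
Qed.

Lemma smoothZ a f : smooth f -> smooth (fun x => a * f x).
Proof. by apply: smoothM; exact: smooth_cst. Qed.

Lemma smoothN f : smooth f -> smooth (fun x => - f x).
Proof.
by move=> sf; under eq_fun do rewrite -mulN1r; exact: smoothZ.
Qed.

Lemma smoothB f g : smooth f -> smooth g -> smooth (fun x => f x - g x).
Proof. by move=> sf sg; apply: smoothD => //; exact: smoothN. Qed.

Lemma smooth_sum (I : Type) (s : seq I) (F : I -> V -> R) :
  (forall i, smooth (F i)) -> smooth (fun x => \sum_(i <- s) F i x).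
Proof.
move=> sF; elim: s => [|i s IH].
  by under eq_fun do rewrite big_nil; exact: smooth_cst.
by under eq_fun do rewrite big_cons; exact: smoothD.
Qed.

Lemma smooth_prod (I : Type) (s : seq I) (F : I -> V -> R) :
  (forall i, smooth (F i)) -> smooth (fun x => \prod_(i <- s) F i x).
Proof.
move=> sF; elim: s => [|i s IH].
  by under eq_fun do rewrite big_nil; exact: smooth_cst.
by under eq_fun do rewrite big_cons; exact: smoothM.
Qed.

Lemma deriveD_smooth f g u x : smooth f -> smooth g ->
  'D_u (fun y => f y + g y) x = 'D_u f x + 'D_u g x.
Proof.
move=> sf sg; rewrite [LHS](_ : _ = 'D_u (f + g) x)// deriveD//.
  by case: (smooth_is_derive x u sf).
by case: (smooth_is_derive x u sg).
Qed.

Lemma deriveM_smooth f g u x : smooth f -> smooth g ->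
  'D_u (fun y => f y * g y) x = f x * 'D_u g x + 'D_u f x * g x.
Proof.
move=> sf sg; rewrite [LHS](_ : _ = 'D_u (f * g) x)// deriveM//.
- by rewrite -!/(_ * _) [in RHS](mulrC _ (g x)).
- by case: (smooth_is_derive x u sf).
- by case: (smooth_is_derive x u sg).
Qed.

Lemma deriveZ_smooth a f u x : smooth f ->
  'D_u (fun y => a * f y) x = a * 'D_u f x.
Proof.
move=> sf; rewrite [LHS](_ : _ = 'D_u (a \*: f) x)// deriveZ//.
by case: (smooth_is_derive x u sf).
Qed.

Lemma derive_sum_smooth (I : Type) (s : seq I) (F : I -> V -> R) u x :
  (forall i, smooth (F i)) ->
  'D_u (fun y => \sum_(i <- s) F i y) x = \sum_(i <- s) 'D_u (F i) x.
Proof.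
move=> sF; elim: s => [|i s IH].
  by under eq_fun do rewrite big_nil; rewrite derive_cst big_nil.
rewrite big_cons -IH -deriveD_smooth//; last exact: smooth_sum.
by under eq_fun do rewrite big_cons.
Qed.

End smooth_theory.

Section smooth_composition.
Variables (R : realType) (V W : normedModType R).

Section affine.
Variables (L : {linear V -> W}) (c : W).
Hypothesis cL : continuous L.

Lemma derive_comp_affine (f : W -> R) u x :
  'D_u (fun y => f (L y + c)) x = 'D_(L u) f (L x + c).
Proof.
have E : (fun h : R => h^-1 *: (((fun y => f (L y + c)) \o shift x) (h *: u) -
      f (L x + c))) =
    (fun h : R => h^-1 *: ((f \o shift (L x + c)) (h *: L u) - f (L x + c))).
  by apply/funext => h /=; rewrite (linearD L) linearZZ addrA.
by rewrite /derive E.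
Qed.

Lemma smooth_comp_affine (f : W -> R) : smooth f -> smooth (fun y => f (L y + c)).
Proof.
move=> sf; apply: (@smooth_coind _ _ (fun g =>
  exists2 f : W -> R, smooth f & g = fun y => f (L y + c))); last by exists f.
move=> _ [g sg ->]; split=> [x|u].
  apply: (@differentiable_comp _ _ _ _ (fun y => L y + c) g).
    apply: differentiableD; last exact: differentiable_cst.
    exact: linear_differentiable.
  exact: smooth_differentiable.
exists (fun x => 'D_(L u) g x); first exact: smooth_derive.
by apply/funext => x; rewrite derive_comp_affine.
Qed.

End affine.

Lemma smooth_comp_linear (L : {linear V -> W}) (f : W -> R) :
  continuous L -> smooth f -> smooth (f \o L).
Proof.
move=> cL /(smooth_comp_affine 0 cL).
by rewrite (_ : (fun y => _) = f \o L)//; apply/funext => y; rewrite addr0.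
Qed.

Lemma derive_comp_linear (L : {linear V -> W}) (f : W -> R) u x :
  'D_u (f \o L) x = 'D_(L u) f (L x).
Proof.
have := derive_comp_affine L 0 f u x; rewrite addr0 => <-.
by congr ('D_u _ x); apply/funext => y; rewrite addr0.
Qed.

End smooth_composition.

Lemma smooth_linear (R : realType) (V : normedModType R) (L : {linear V -> R}) :
  continuous L -> smooth L.
Proof.
move=> cL; apply: (@smooth_coind _ _ (fun f => f = L \/ exists a, f = cst a)).
  move=> _ [->|[a ->]].
    split=> [x|u]; first exact: linear_differentiable.
    right; exists (L u); apply/funext => x; rewrite deriveE ?diff_lin//.
    exact: linear_differentiable.
  split=> [x|u]; first exact: differentiable_cst.
  by right; exists 0; apply/funext => x; rewrite derive_cst.
by left.
Qed.

(** * A smooth bump on the line *)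

Section exponential_bounds.
Variable R : realType.
Implicit Types (x y : R) (p : {poly R}).

Lemma expr_le_expR n y : 0 <= y -> y ^+ n <= n`!%:R * expR y.
Proof.
case: n => [|n] y0; first by rewrite expr0 fact0 mul1r -expR0 ler_expR.
rewrite mulrC -ler_pdivrMr ?ltr0n ?fact_gt0//.
by apply: le_trans (expR_ge1Dxn n y0); rewrite lerDr.
Qed.

Lemma horner_le_expR p : exists2 C, 0 < C & forall y, `|p.[y]| <= C * expR `|y|.
Proof.
exists (1 + \sum_(i < size p) `|p`_i| * i`!%:R).
  by rewrite ltr_wpDr// sumr_ge0// => i _; rewrite mulr_ge0.
move=> y; rewrite horner_coef mulrDl mul1r.
apply: (le_trans (ler_norm_sum _ _ _)).
rewrite -[leLHS]add0r lerD ?expR_ge0// mulr_suml ler_sum// => i _.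
by rewrite normrM normrX -mulrA ler_wpM2l// expr_le_expR.
Qed.

End exponential_bounds.

Section flat_exponential.
Variable R : realType.
Implicit Types (x y : R) (p : {poly R}).

(** The polynomial in 1/x makes the family stable: the derivative of p(1/x) exp(-1/x) is q(1/x)
    exp(-1/x) with q = X^2 (p - p'). *)
Definition flat_exp p x : R := if 0 < x then p.[x^-1] * expR (- x^-1) else 0.

(** Applying the exponential bound to X^2 p instead of p yields the additional factor t^2. The zeros
    in the statement match [is_diff_quadratic] at the point 0 with the zero differential. *)
Let flat_exp_quadratic p :
  exists C, forall t, `|flat_exp p (t + 0) - flat_exp p 0 - 0| <= C * `|t| ^+ 2.
Proof.
have [C C0 CP] := horner_le_expR ('X^2 * p).
exists C => t; rewrite addr0 subr0 {2}/flat_exp ltxx subr0 /flat_exp.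
have [t0|t0] := ltrP 0 t; last by rewrite normr0 mulr_ge0// ltW.
have t1 : `|t^-1| = t^-1 by rewrite gtr0_norm// invr_gt0.
have := CP t^-1; rewrite hornerM hornerXn normrM normrX t1 exprVn => CPt.
rewrite (gtr0_norm t0) normrM (ger0_norm (expR_ge0 _)) expRN.
rewrite ler_pdivrMr ?expR_gt0// mulrAC -ler_pdivrMr ?exprn_gt0//.
by rewrite mulrC.
Qed.

Lemma is_derive_flat_exp p x :
  is_derive x (1 : R) (flat_exp p) (flat_exp ('X^2 * (p - p^`())) x).
Proof.
have [x0|x0|<-] := ltrgtP 0 x.
- have xn0 : x != 0 by rewrite gt_eqF.
  apply: (@near_eq_is_derive _ _ _ (fun y => p.[y^-1] * expR (- y^-1))).
    by near=> y; rewrite /flat_exp ifT//; near: y; exact: lt_nbhsr.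
  have dV : is_derive x (1 : R) (fun y : R => y^-1) (- x ^- 2).
    have := @is_deriveV R id x 1 1 xn0 (is_derive_id _ _).
    by rewrite /GRing.scale /= mulr1.
  have dp : is_derive x (1 : R) (fun y => p.[y^-1]) (p^`().[x^-1] * - x ^- 2).
    exact: (@is_derive1_comp R (horner p) (fun y => y^-1)).
  have dE : is_derive x (1 : R) (fun y => expR (- y^-1)) (expR (- x^-1) * x ^- 2).
    have dN : is_derive x (1 : R) (fun y : R => - y^-1) (x ^- 2).
      by have := is_deriveN dV; rewrite opprK.
    exact: (@is_derive1_comp R expR (fun y => - y^-1)).
  apply: is_derive_eq (is_deriveM dp dE) _.
  rewrite /flat_exp x0 hornerM hornerXn hornerD hornerN /GRing.scale /=.
  by rewrite exprVn; ring.
- have -> : flat_exp ('X^2 * (p - p^`())) x = 0 by rewrite /flat_exp ltNge ltW.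
  apply: (@near_eq_is_derive _ _ _ (cst 0)).
    by near=> y; rewrite /flat_exp ifF//; apply/negbTE; rewrite -leNgt ltW//;
      near: y; exact: lt_nbhsl.
- have [C CP] := flat_exp_quadratic p.
  have -> : flat_exp ('X^2 * (p - p^`())) 0 = 0 by rewrite /flat_exp ltxx.
  pose L : {linear R -> R} := (\0 : R -> R).
  have cL : continuous L by move=> y; exact: cvg_cst.
  have dL := is_diff_quadratic cL CP.
  apply: DeriveDef; first exact/derivable1_diffP/ex_diff.
  by rewrite deriveE// diff_val.
Unshelve. all: by end_near. Qed.

End flat_exponential.

Section bump.
Variable R : realType.

Lemma smooth_flat_exp (p : {poly R}) : smooth (flat_exp p).
Proof.
apply: (@smooth_coind _ _ (fun f => exists p, f = flat_exp p)); last by exists p.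
move=> _ [q ->]; have dq x := is_derive_flat_exp q x.
have dfq x : differentiable (flat_exp q) x.
  by apply/derivable1_diffP; case: (dq x).
split=> // u; exists (u *: ('X^2 * (q - q^`()))); apply/funext => x.
rewrite -[u in LHS]mulr1 -[u * 1]/(u *: (1 : R)) -[_ *: _]addr0.
rewrite derive_lin_dir// derive0 addr0 derive_val.
by rewrite /flat_exp; case: ifP => _; rewrite ?mulr0// hornerZ mulrA.
Qed.

Lemma exists_bump : exists eta : R -> R, [/\ smooth eta,
  forall x, 0 <= eta x, forall x, 1 <= `|x| -> eta x = 0 &
  forall x, `|x| < 1 -> 0 < eta x].
Proof.
pose h : R -> R := flat_exp 1.
have h0 x : x <= 0 -> h x = 0 by move=> x0; rewrite /h /flat_exp ltNge x0.
have h1 x : 0 < x -> 0 < h x.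
  by move=> x0; rewrite /h /flat_exp x0 hornerC mul1r expR_gt0.
have hge0 x : 0 <= h x.
  by have [x0|x0] := ltrP 0 x; [exact/ltW/h1|rewrite h0].
have sh : smooth h by exact: smooth_flat_exp.
exists (fun x => h (x + 1) * h (- x + 1)); split.
- apply: smoothM.
    exact: (@smooth_comp_affine R R R idfun 1 (fun=> cvg_id) h sh).
  have cN : continuous (-%R : R -> R) by move=> y; exact: opp_continuous.
  exact: (@smooth_comp_affine R R R -%R 1 cN h sh).
- by move=> x; rewrite mulr_ge0.
- move=> x; rewrite ler_normr => /orP[x1|x1].
    by rewrite mulrC h0 ?mul0r//; lra.
  by rewrite h0 ?mul0r//; lra.
- by move=> x; rewrite ltr_norml => /andP[x1 x2]; rewrite mulr_gt0// h1//; lra.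
Qed.

End bump.

(** * Differentiation under the integral sign *)

Section dominated_integrals.
Context d (T : measurableType d) (R : realType).
Variables (mu : {measure set T -> \bar R}) (D : set T).
Hypothesis mD : measurable D.
Implicit Types f g : T -> R.

Lemma dominated_integrable f g : measurable_fun D f ->
  (forall y, D y -> `|f y| <= g y) -> mu.-integrable D (EFin \o g) ->
  mu.-integrable D (EFin \o f).
Proof.
move=> mf fg; apply: le_integrable => //; first exact/measurable_EFinP.
by move=> y Dy; rewrite /= lee_fin (le_trans (fg _ Dy))// ler_norm.
Qed.

Lemma integrable_cmul (k : R) f : mu.-integrable D (EFin \o f) ->
  mu.-integrable D (EFin \o (fun y => k * f y)).
Proof.
move=> fi; rewrite (_ : EFin \o _ = fun y => (k%:E * (EFin \o f) y)%E)//.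
exact: integrableZl.
Qed.

Lemma integrable_sum_fin (I : Type) (s : seq I) (f : I -> T -> R) :
  (forall i, mu.-integrable D (EFin \o f i)) ->
  mu.-integrable D (EFin \o (fun y => \sum_(i <- s) f i y)).
Proof.
move=> fi; elim: s => [|i s IH].
  by under eq_fun do rewrite big_nil; exact: integrable0.
rewrite (_ : EFin \o _ =
  ((EFin \o f i) \+ (EFin \o (fun y => (\sum_(i <- s) f i y)%R)))%E).
  exact: integrableD.
by apply/funext => y /=; rewrite big_cons.
Qed.

Lemma Rintegral_sum (I : Type) (s : seq I) (f : I -> T -> R) :
  (forall i, mu.-integrable D (EFin \o f i)) ->
  \int[mu]_(y in D) (\sum_(i <- s) f i y) = \sum_(i <- s) \int[mu]_(y in D) f i y.
Proof.
move=> fi; elim: s => [|i s IH].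
  by under eq_Rintegral do rewrite big_nil; rewrite Rintegral_cst// mul0r big_nil.
under eq_Rintegral do rewrite big_cons.
by rewrite big_cons RintegralD// ?IH//; exact: integrable_sum_fin.
Qed.

Lemma dominated_Rintegral f g : measurable_fun D f ->
  (forall y, D y -> `|f y| <= g y) -> mu.-integrable D (EFin \o g) ->
  `|\int[mu]_(y in D) f y| <= \int[mu]_(y in D) g y.
Proof.
move=> mf fg ig; have if_ := dominated_integrable mf fg ig.
apply: (le_trans (le_normr_Rintegral mD if_)); apply: le_Rintegral => //.
exact: integrable_norm.
Qed.

Lemma is_derive_integral (f df : R -> T -> R) (g : T -> R) (a e : R) : 0 < e ->
  (forall x, a - e < x < a + e -> mu.-integrable D (EFin \o f x)) ->
  (forall x y, a - e < x < a + e -> D y -> is_derive x 1 (f ^~ y) (df x y)) ->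
  (forall x y, a - e < x < a + e -> D y -> `|df x y| <= g y) ->
  mu.-integrable D (EFin \o g) ->
  is_derive a 1 (fun x => \int[mu]_(y in D) f x y) (\int[mu]_(y in D) df a y).
Proof.
move=> e0 fi fd dfg gi.
have ae : a - e < a < a + e by rewrite ltrDl e0 gtrBl e0.
have Ia : [set` `]a - e, a + e[] a by rewrite /= in_itv.
have fi' x : `]a - e, a + e[%classic x -> mu.-integrable D (EFin \o f x).
  by rewrite /= in_itv => /fi.
have fd' x y : `]a - e, a + e[%classic x -> D y -> derivable (f ^~ y) x 1.
  by rewrite /= in_itv => xe Dy; case: (fd x y xe Dy).
have dE x y : a - e < x < a + e -> D y -> partial1of2 f x y = df x y.
  by move=> xe Dy; rewrite partial1of2E; have /@derive_val := fd x y xe Dy.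
have g0 y : 0 <= `|g y| by [].
have gi' : mu.-integrable D (EFin \o (fun y => `|g y|)) by exact: integrable_norm.
have dg x y : `]a - e, a + e[%classic x -> D y -> `|partial1of2 f x y| <= `|g y|.
  rewrite /= in_itv => xe Dy.
  by rewrite dE// (le_trans (dfg _ _ xe Dy))// ler_norm.
apply: DeriveDef.
  exact: (derivable_under_integral mD Ia fi' fd' g0 gi' dg).
rewrite -derive1E (differentiation_under_integral mD Ia fi' fd' g0 gi' dg).
by apply: eq_Rintegral => y /set_mem Dy; rewrite -[LHS]/(partial1of2 f a y) dE.
Qed.

End dominated_integrals.

(* The integral along the flow is constant in time; its time derivative at 0 is
   the left-hand side below. *)
Lemma integral_flow_derivative d (T : measurableType d) (R : realType)
    (mu : {measure set T -> \bar R}) (tau : R -> T -> T) (f df g : T -> R) :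
  (forall s, measurable_fun setT (tau s)) ->
  (forall s A, measurable A -> mu (tau s @^-1` A) = mu A) ->
  (forall y, tau 0 y = y) ->
  mu.-integrable setT (EFin \o f) ->
  (forall y s, is_derive s (1 : R) (fun s => f (tau s y)) (df (tau s y))) ->
  (forall y s, `|s| < 1 -> `|df (tau s y)| <= g y) ->
  mu.-integrable setT (EFin \o g) ->
  \int[mu]_y df y = 0.
Proof.
move=> mtau mutau tau0 fi fd dfg gi.
have mf : measurable_fun setT (EFin \o f) by case/integrableP : fi.
have ftau s : mu.-integrable setT (EFin \o (f \o tau s)) /\
    \int[mu]_y f (tau s y) = \int[mu]_y f y.
  have mft : measurable_fun setT (EFin \o f \o tau s) by exact: measurableT_comp.
  pose nu := measure_function_pushforward__canonical__measure_function_Measure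
    mu (mtau s).
  have nuE A : measurable A -> nu A = mu A by exact: mutau.
  (* The nonnegative change of variables comes first, because the general one already asks for the
     integrability of [f] along the flow. *)
  have nui h : measurable_fun setT h -> (forall y, (0 <= h y)%E) ->
      (\int[mu]_y h (tau s y) = \int[mu]_y h y)%E.
    move=> mh h0; rewrite -[RHS](@eq_measure_integral _ _ _ _ mu nu); last first.
      by move=> A mA _; rewrite nuE.
    have := @ge0_integral_pushforward _ _ _ _ _ _ (mtau s) mu setT h measurableT mh
      (fun y _ => h0 y).
    by rewrite preimage_setT => ->.
  have fti : mu.-integrable setT (EFin \o (f \o tau s)).
    apply/integrableP; split; first exact: mft.
    rewrite (nui (fun y => `|(EFin \o f) y|%E))//; first by case/integrableP : fi.
    exact: measurableT_comp.
  split=> //; rewrite /Rintegral; congr fine.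
  rewrite -[RHS](@eq_measure_integral _ _ _ _ mu nu); last first.
    by move=> A mA _; rewrite nuE.
  have := @integral_pushforward _ _ _ _ _ _ (mtau s) mu setT (EFin \o f) mf fti measurableT.
  by rewrite preimage_setT => ->.
have := @is_derive_integral _ _ _ mu setT measurableT
  (fun s y => f (tau s y)) (fun s y => df (tau s y)) g 0 1 ltr01.
move=> /(_ (fun s _ => (ftau s).1) (fun s y _ _ => fd y s)).
have Hg : forall x y, 0 - 1 < x < 0 + 1 -> setT y -> `|df (tau x y)| <= g y.
  by move=> x y x1 _; apply: dfg; rewrite ltr_norml; move: x1; rewrite sub0r add0r.
move=> /(_ Hg gi) H.
have E : (fun s => \int[mu]_y f (tau s y)) = cst (\int[mu]_y f y).
  by apply/funext => s; rewrite (ftau s).2.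
move: H; rewrite E => /@derive_val; rewrite derive_cst => ->.
by apply: eq_Rintegral => y _; rewrite tau0.
Qed.

Lemma lebesgue_measure_shift (R : realType) (s : R) (A : set (measurableTypeR R)) :
  measurable A ->
  lebesgue_measure ((fun y : measurableTypeR R => y + s) @^-1` A) = lebesgue_measure A.
Proof.
move=> mA; pose tau (y : measurableTypeR R) : measurableTypeR R := y + s.
have mtau : measurable_fun setT tau by exact: measurable_funD.
pose nu := measure_function_pushforward__canonical__measure_function_Measure
  (@lebesgue_measure R) mtau.
rewrite -[LHS]/(nu A); symmetry.
apply: lebesgue_measure_unique mA => _ [[a b] _ <-] /=.
rewrite /pushforward.
rewrite (_ : _ @^-1` _ = `]a - s, b - s]%classic); last first.
  by apply/seteqP; split=> y /=; rewrite !in_itv/= ltrBlDr lerBrDr.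
by rewrite !lebesgue_measure_itv/= !lte_fin ltrD2r -!EFinD opprB subrKA.
Qed.

(** * Gaussian averages *)

Lemma is_derive_affine (R : realType) (a b y : R) :
  is_derive y (1 : R) (fun y => a + b * y) b.
Proof.
have := is_deriveD (is_derive_cst a y (1 : R)) (is_deriveZ b (is_derive_id y (1 : R))).
by rewrite add0r /GRing.scale /= mulr1.
Qed.

Section gaussian_pairing.
Variable R : realType.
Local Notation mu := (@lebesgue_measure R).
Implicit Types (x y a b : R) (p : {poly R}) (w : R -> R).

(** The polynomial factor keeps the weights stable under differentiation and under multiplication by
    y. The rate 4, against the rate 1 of the dominating [gauss_fun], leaves room to absorb
    polynomials and unit shifts. *)
Definition gauss_weight p y : R := p.[y] * expR (- (4 * y ^+ 2)).

Definition gauss_pairing w p a b : R :=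
  \int[mu]_y (w (a + b * y) * gauss_weight p y).

Lemma gauss_weight_shift_le p : exists2 C, 0 < C &
  forall y s, `|s| <= 1 -> `|gauss_weight p (y + s)| <= C * gauss_fun y.
Proof.
have [C C0 Cp] := horner_le_expR p.
exists (C * expR (3 : R)); first by rewrite mulr_gt0// expR_gt0.
move=> y s; rewrite ler_norml => /andP[s1 s2].
rewrite /gauss_weight normrM (ger0_norm (expR_ge0 _)) /gauss_fun.
apply: (le_trans (ler_wpM2r (expR_ge0 _) (Cp _))).
rewrite -!mulrA ler_wpM2l ?(ltW C0)// -!expRD ler_expR.
(* What remains is |y + s| - 4 (y + s)^2 <= 3 - y^2 for |s| <= 1, a quadratic inequality on each
   side of y + s = 0. *)
have [ys|ys] := lerP 0 (y + s).
  by rewrite (ger0_norm ys); have q2 := sqr_ge0 (y + s - 1); nra.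
by rewrite (ltr0_norm ys); have q2 := sqr_ge0 (y + s + 1); nra.
Qed.

Lemma gauss_weight_le p : exists2 C, 0 < C &
  forall y, `|gauss_weight p y| <= C * gauss_fun y.
Proof.
have [C C0 Cp] := gauss_weight_shift_le p; exists C => // y.
by have := Cp y 0; rewrite addr0 normr0; apply.
Qed.

Lemma is_derive_gauss_weight p y :
  is_derive y (1 : R) (gauss_weight p) (gauss_weight (p^`() - (8 *: 'X) * p) y).
Proof.
have dE : is_derive y (1 : R) (fun y => expR (- (4 * y ^+ 2)))
    (expR (- (4 * y ^+ 2)) * - (4 * (2 * y))).
  have dN : is_derive y (1 : R) (fun y : R => - (4 * y ^+ 2)) (- (4 * (2 * y))).
    have := is_deriveN (is_deriveZ (4 : R) (is_deriveX 2 (is_derive_id y (1 : R)))).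
    by rewrite /GRing.scale /= mulr1 expr1.
  exact: (@is_derive1_comp R expR (fun y => - (4 * y ^+ 2))).
apply: is_derive_eq (is_deriveM (is_derive_poly p y) dE) _.
by rewrite /gauss_weight /GRing.scale /= hornerD hornerN hornerM hornerZ hornerX; ring.
Qed.

Lemma continuous_gauss_weight p : continuous (gauss_weight p).
Proof.
move=> y; apply/differentiable_continuous/derivable1_diffP.
by case: (is_derive_gauss_weight p y).
Qed.

Lemma continuous_gauss_integrand w p a b : continuous w ->
  continuous (fun y => w (a + b * y) * gauss_weight p y).
Proof.
move=> cw y; apply: continuousM; last exact: continuous_gauss_weight.
apply: (@continuous_comp _ _ _ (fun y => a + b * y) w); last exact: cw.
by apply: continuousD; [exact: cvg_cst|exact: mulrl_continuous].
Qed.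

Lemma measurable_gauss_integrand w p a b : continuous w ->
  measurable_fun setT (fun y => w (a + b * y) * gauss_weight p y).
Proof.
by move=> cw; apply: continuous_measurable_fun; exact: continuous_gauss_integrand.
Qed.

Lemma integrable_gaussZ C : mu.-integrable setT (EFin \o (fun y => C * gauss_fun y)).
Proof.
exact/integrable_cmul/integrableT_gauss.
Qed.

Lemma gauss_integrand_integrable w p a b M : continuous w ->
  (forall x, `|w x| <= M) ->
  mu.-integrable setT (EFin \o (fun y => w (a + b * y) * gauss_weight p y)).
Proof.
move=> cw wM; have [C C0 CP] := gauss_weight_le p.
apply: (dominated_integrable _ _ _ (integrable_gaussZ (M * C))) => //.
  exact: measurable_gauss_integrand.
by move=> y _; rewrite normrM -mulrA ler_pM.
Qed.

Lemma gauss_pairingZ (c : R) p w M a b : continuous w ->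
  (forall x, `|w x| <= M) ->
  gauss_pairing w (c *: p) a b = c * gauss_pairing w p a b.
Proof.
move=> cw wM; rewrite /gauss_pairing -RintegralZl//.
  by apply: eq_Rintegral => y _; rewrite /gauss_weight hornerZ; ring.
exact: gauss_integrand_integrable cw wM.
Qed.

Lemma gauss_pairing_bounded p : exists2 C, 0 < C & forall w M a b,
  continuous w -> (forall x, `|w x| <= M) -> `|gauss_pairing w p a b| <= M * C.
Proof.
have [C C0 CP] := gauss_weight_le p.
exists (C * (\int[mu]_y gauss_fun y + 1)).
  by rewrite mulr_gt0// ltr_wpDl// Rintegral_ge0// => y _; exact: gauss_fun_ge0.
move=> w M a b cw wM; have M0 : 0 <= M by rewrite (le_trans _ (wM 0)).
apply: (le_trans (dominated_Rintegral measurableT _ _ (integrable_gaussZ (M * C)))).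
- exact: measurable_gauss_integrand.
- by move=> y _; rewrite normrM -mulrA ler_pM.
rewrite RintegralZl//; last exact: integrableT_gauss.
by rewrite -mulrA !ler_wpM2l ?(ltW C0)// lerDl.
Qed.

Lemma gauss_pairing0 w p a : gauss_pairing w p a 0 =
  w a * \int[mu]_y gauss_weight p y.
Proof.
rewrite /gauss_pairing.
under eq_Rintegral do rewrite mul0r addr0.
rewrite RintegralZl//.
have [C C0 CP] := gauss_weight_le p.
apply: (dominated_integrable _ _ _ (integrable_gaussZ C)) => //.
by apply: continuous_measurable_fun; exact: continuous_gauss_weight.
Qed.

Section derivative.
Variables (w dw : R -> R) (M dM : R).
Hypotheses (wM : forall x, `|w x| <= M) (dwM : forall x, `|dw x| <= dM).
Hypotheses (cdw : continuous dw) (wdw : forall x, is_derive x (1 : R) w (dw x)).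

Let cw : continuous w.
Proof.
by move=> x; apply/differentiable_continuous/derivable1_diffP; case: (wdw x).
Qed.

Let M0 : 0 <= M. Proof. exact: le_trans (normr_ge0 _) (wM 0). Qed.

(** The y-derivative of the integrand integrates to zero because Lebesgue measure is invariant under
    shifts. The identity serves twice: it trades a derivative of the datum for a factor 1/b, which
    gives decay, and it turns the weight y into a further derivative, which gives the heat
    equation. *)
Lemma gauss_pairing_by_parts p a b :
  b * gauss_pairing dw p a b = - gauss_pairing w (p^`() - (8 *: 'X) * p) a b.
Proof.
set q := p^`() - _.
have [C C0 CP] := gauss_weight_shift_le p.
have [D D0 DP] := gauss_weight_shift_le q.
pose f y := w (a + b * y) * gauss_weight p y.
pose df y := b * (dw (a + b * y) * gauss_weight p y)
             + w (a + b * y) * gauss_weight q y.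
have fd y : is_derive y (1 : R) f (df y).
  have dl := is_derive_affine a b y.
  have dwl : is_derive y (1 : R) (fun y => w (a + b * y)) (dw (a + b * y) * b).
    exact: (@is_derive1_comp R w (fun y => a + b * y)).
  apply: is_derive_eq (is_deriveM dwl (is_derive_gauss_weight p y)) _.
  by rewrite /df /GRing.scale /= -/q; ring.
have := @integral_flow_derivative _ _ R mu (fun s (y : measurableTypeR R) => y + s)
  f df (fun y => (`|b| * (dM * C) + M * D) * gauss_fun y).
have i1 := gauss_integrand_integrable p a b cdw dwM.
have i2 := gauss_integrand_integrable q a b cw wM.
rewrite RintegralD//=; last first.
  exact: integrable_cmul.
rewrite RintegralZl// => H.
apply/eqP; rewrite -addr_eq0; apply/eqP/H.
- by move=> s; exact: measurable_funD.
- by move=> s A mA; exact: lebesgue_measure_shift.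
- by move=> y; rewrite addr0.
- exact: gauss_integrand_integrable cw wM.
- move=> y s.
  have ds : is_derive s (1 : R) (fun s => y + s) 1.
    by have := is_derive_affine y 1 s; under eq_fun do rewrite mul1r.
  have := @is_derive1_comp R f (fun s => y + s) s _ _ (fd _) ds.
  by rewrite mulr1.
- move=> y s /ltW s1; rewrite mulrDl; apply: (le_trans (ler_normD _ _)).
  apply: lerD.
    by rewrite normrM [X in _ * X]normrM -!mulrA ler_wpM2l// ler_pM// CP.
  by rewrite normrM -mulrA ler_pM// DP.
- exact: integrable_gaussZ.
Qed.

Lemma is_derive_gauss_pairing p (a b da db : R -> R) (t : R) :
  (forall s, is_derive s (1 : R) a (da s)) ->
  (forall s, is_derive s (1 : R) b (db s)) ->
  continuous da -> continuous db ->
  is_derive t (1 : R) (fun s => gauss_pairing w p (a s) (b s))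
    (da t * gauss_pairing dw p (a t) (b t) +
     db t * gauss_pairing dw ('X * p) (a t) (b t)).
Proof.
move=> ad bd cda cdb.
have [C C0 CP] := gauss_weight_le p.
have [D D0 DP] := gauss_weight_le ('X * p).
(* [da] and [db] are only locally bounded, so domination is arranged on a small interval around t,
   where each exceeds its value at t by at most 1 in modulus. *)
have [e e0 He] : exists2 e, 0 < e & forall s, t - e < s < t + e ->
    (`|da s| <= `|da t| + 1) /\ (`|db s| <= `|db t| + 1).
  have near1 (h : R -> R) : continuous h -> \forall s \near t, `|h s| <= `|h t| + 1.
    move=> ch; have /cvgrPdist_lt/(_ 1 ltr01) := ch t.
    apply: filterS => s hs; rewrite -lerBlDl.
    by rewrite (le_trans (lerB_dist _ _))// distrC ltW.
  have : \forall s \near t, `|da s| <= `|da t| + 1 /\ `|db s| <= `|db t| + 1.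
    by apply: filterS2 (near1 _ cda) (near1 _ cdb) => s; split.
  move=> /nbhs_ballP[e /= e0 He]; exists e => // s se; apply: He.
  by rewrite /ball /= ltr_distlC.
pose A := `|da t| + 1; pose B := `|db t| + 1.
pose df (s y : R) := dw (a s + b s * y) * (da s + db s * y) * gauss_weight p y.
have XpE y : gauss_weight ('X * p) y = y * gauss_weight p y.
  by rewrite /gauss_weight hornerM hornerX -mulrA.
have -> : da t * gauss_pairing dw p (a t) (b t) +
    db t * gauss_pairing dw ('X * p) (a t) (b t) = \int[mu]_y df t y.
  have i1 := gauss_integrand_integrable p (a t) (b t) cdw dwM.
  have i2 := gauss_integrand_integrable ('X * p) (a t) (b t) cdw dwM.
  rewrite -RintegralZl// -RintegralZl// -RintegralD//; last 2 first.
  - exact: integrable_cmul.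
  - exact: integrable_cmul.
  by apply: eq_Rintegral => y _; rewrite XpE /df; ring.
apply: (is_derive_integral measurableT e0 _ _ _
    (integrable_gaussZ (dM * (A * C + B * D)))).
- by move=> s _; exact: gauss_integrand_integrable cw wM.
- move=> s y _ _.
  have dl : is_derive s (1 : R) (fun s => a s + b s * y) (da s + db s * y).
    have := is_deriveD (ad s) (is_deriveM (bd s) (is_derive_cst y s (1 : R))).
    by rewrite scaler0 add0r /GRing.scale /= [y * _]mulrC.
  have dwl : is_derive s (1 : R) (fun s => w (a s + b s * y))
      (dw (a s + b s * y) * (da s + db s * y)).
    exact: (@is_derive1_comp R w (fun s => a s + b s * y)).
  have := is_deriveM dwl (is_derive_cst (gauss_weight p y) s (1 : R)).
  by rewrite scaler0 add0r /GRing.scale /= [gauss_weight p y * _]mulrC.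
- move=> s y se _; have [As Bs] := He s se.
  rewrite /df -mulrA normrM -mulrA ler_pM//.
  rewrite mulrDl mulrDl -mulrA -XpE.
  apply: (le_trans (ler_normD _ _)).
  apply: lerD.
    by rewrite normrM -mulrA ler_pM// CP.
  by rewrite normrM -mulrA ler_pM// DP.
Qed.

End derivative.

(** For k = 0 the integrand lives on a set of y of length 2/b, since [w 0] is supported in [-1, 1].
    Each further derivative is moved onto the weight at the gain of one more factor 1/b, which is
    why the induction lets [p] vary. *)
Lemma gauss_pairing_decay (w : nat -> R -> R) (k : nat) p :
  (forall k x, is_derive x (1 : R) (w k) (w k.+1 x)) ->
  (forall k, exists M, forall x, `|w k x| <= M) ->
  (forall x, 1 <= `|x| -> w 0%N x = 0) ->
  exists2 C, 0 < C & forall a b, 0 < b ->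
    b ^+ k.+1 * `|gauss_pairing (w k) p a b| <= C.
Proof.
move=> dw wM w0.
have cw j : continuous (w j).
  by move=> x; apply/differentiable_continuous/derivable1_diffP; case: (dw j x).
elim: k p => [|k IH] p.
  have [M MP] := wM 0%N.
  have M0 : 0 <= M by rewrite (le_trans _ (MP 0)).
  have [C C0 CP] := gauss_weight_le p.
  exists (2 * M * C + 1); first by rewrite ltr_wpDl// !mulr_ge0// ltW.
  move=> a b b0; rewrite expr1.
  (* This is the set where |a + b y| <= 1. *)
  pose I := `[(- 1 - a) / b, (1 - a) / b]%classic : set R.
  have mI : measurable I by exact: measurable_itv.
  have I_le : (- 1 - a) / b < (1 - a) / b by rewrite ltr_pM2r ?invr_gt0//; lra.
  have muI : mu I = (2 / b)%:E.
    rewrite /I lebesgue_measure_itv/= lte_fin I_le -EFinD; congr EFin.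
    by rewrite -mulrBl; congr (_ / b); ring.
  have iI : mu.-integrable setT (EFin \o (fun y => M * C * \1_I y)).
    by apply: integrable_cmul => //; exact: integrable_indic_itv.
  have le_I y : setT y -> `|w 0%N (a + b * y) * gauss_weight p y| <= M * C * \1_I y.
    move=> _; rewrite indicE.
    have [yI|yI] := boolP (y \in I).
      rewrite mulr1 normrM ler_pM//; apply: (le_trans (CP y)).
      by rewrite ler_piMr ?gauss_fun_le1// ltW.
    rewrite w0 ?mul0r ?normr0 ?mulr0//.
    rewrite leNgt; apply: contra yI => yI; rewrite inE /I /= in_itv /=.
    move: yI; rewrite ltr_norml ler_pdivrMr// ler_pdivlMr// => /andP[y1 y2].
    by apply/andP; split; nra.
  have H := @dominated_Rintegral _ (measurableTypeR R) R mu setT measurableT _ _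
    (measurable_gauss_integrand p a b (cw 0%N)) le_I iI.
  rewrite RintegralZl// in H; last exact: integrable_indic_itv.
  rewrite /gauss_pairing; rewrite mulrC -ler_pdivlMr//; apply: (le_trans H).
  rewrite (_ : \int[mu]_y \1_I y = 2 / b); last first.
    by rewrite /Rintegral integral_indic// setIT [X in fine X]muI.
  rewrite mulrA ler_pM2r ?invr_gt0//; lra.
have [C C0 CP] := IH (p^`() - (8 *: 'X) * p); exists C => // a b b0.
have [M MP] := wM k; have [dM dMP] := wM k.+1.
have := gauss_pairing_by_parts MP dMP (cw k.+1) (dw k) p a b => H.
rewrite exprSr -mulrA -[X in X * `|_|](gtr0_norm b0) -normrM H normrN.
exact: CP.
Qed.

End gaussian_pairing.

(** * Integrals over the half line *)

Section half_line.
Variable R : realType.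
Local Notation mu := (@lebesgue_measure R).
Local Notation half_line := (`[0, +oo[%classic : set (measurableTypeR R)).

Lemma integrable_oneDsqrV (C : R) :
  mu.-integrable half_line (EFin \o (fun t => C * (oneDsqr t)^-1)).
Proof.
apply: integrable_cmul => //; apply/integrableP; split.
  have mV : measurable_fun setT (fun t : R => (oneDsqr t)^-1).
    by apply: continuous_measurable_fun; exact: continuous_oneDsqrV.
  by apply/measurable_EFinP; exact: measurable_funTS.
rewrite [ltLHS](_ : _ = (pi / 2)%:E) ?ltry// -integral0y_oneDsqr.
by apply: eq_integral => t _; rewrite /= ger0_norm// invr_ge0 (le_trans ler01).
Qed.

Lemma cvg_infty_inv (H : R -> R) (C : R) :
  (forall t, 1 <= t -> `|H t| <= C / t) -> H t @[t --> +oo] --> (0 : R).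
Proof.
move=> HC; apply/cvgrPdist_lt => e e0; near=> t.
have t1 : 1 <= t by near: t; exact: nbhs_pinfty_ge.
rewrite sub0r normrN; apply: (le_lt_trans (HC t t1)).
rewrite ltr_pdivrMr ?(lt_le_trans ltr01)// mulrC -ltr_pdivrMr//.
by near: t; apply: nbhs_pinfty_gt; rewrite num_real.
Unshelve. all: by end_near. Qed.

Lemma Rintegral_gt0 (D : set (measurableTypeR R)) (f : R -> R) (t0 : R) :
  measurable D -> nbhs t0 D -> continuous f -> (forall t, D t -> 0 <= f t) ->
  mu.-integrable D (EFin \o f) -> 0 < f t0 -> 0 < \int[mu]_(t in D) f t.
Proof.
move=> mD Dt0 cf f0 fi ft0.
have : \forall t \near t0, f t0 / 2 < f t.
  by apply: (cvgr_gt (f t0) (cf t0)); rewrite ltr_pdivrMr// ltr_pMr// ltr1n.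
move=> /(filterI Dt0) /nbhs_ballP[e /= e0 eP].
pose I := `[t0 - e / 2, t0 + e / 2]%classic : set (measurableTypeR R).
have ID t : I t -> D t /\ f t0 / 2 < f t.
  move=> It; apply: eP; rewrite /ball /=.
  by move: It; rewrite /I /= in_itv/= ltr_distl => /andP[]; lra.
have mI : measurable I by exact: measurable_itv.
have iI : mu.-integrable D (EFin \o (fun t => f t0 / 2 * \1_I t)).
  apply: integrable_cmul => //.
  by apply: (@integrableS _ _ _ mu setT D) => //; exact: integrable_indic_itv.
apply: (@lt_le_trans _ _ (\int[mu]_(t in D) (f t0 / 2 * \1_I t))); last first.
  apply: le_Rintegral => // t Dt; rewrite indicE.
  have [/set_mem/ID[_ tI]|_] := boolP (t \in I); first by rewrite mulr1 ltW.
  by rewrite mulr0 f0.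
rewrite RintegralZl//; last first.
  by apply: (@integrableS _ _ _ mu setT D) => //; exact: integrable_indic_itv.
rewrite mulr_gt0 ?divr_gt0// /Rintegral integral_indic// (_ : I `&` D = I).
  rewrite [X in fine X](lebesgue_measure_itv `[t0 - e / 2, t0 + e / 2]) /=.
  rewrite lte_fin ifT; last lra.
  by rewrite -EFinD /=; lra.
by apply/seteqP; split=> t => [[]//|It]; split => //; have [] := ID t It.
Qed.

(* Adding a multiple of 1/(1 + t^2), with primitive arctan, makes the integrand
   nonnegative. *)
Lemma integral_half_line_derivative (H h : R -> R) (C : R) :
  (forall t, is_derive t (1 : R) H (h t)) -> continuous h ->
  (forall t, 0 <= t -> `|h t| <= C * (oneDsqr t)^-1) ->
  H t @[t --> +oo] --> (0 : R) ->
  \int[mu]_(t in half_line) h t = - H 0.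
Proof.
move=> dH ch hC H0.
have ih : mu.-integrable half_line (EFin \o h).
  apply: dominated_integrable (integrable_oneDsqrV C) => //.
    by apply: measurable_funTS; exact: continuous_measurable_fun.
  by move=> t /=; rewrite in_itv/= andbT; exact: hC.
pose F t := H t + C * atan t; pose f t := h t + C * (oneDsqr t)^-1.
have dF (t : R) : is_derive t (1 : R) F (f t).
  exact: (is_deriveD (dH t) (is_deriveZ C (is_derive1_atan t))).
have cf : continuous f.
  move=> t; rewrite /f; apply: cvgD; first exact: ch.
  by apply: cvgM; [exact: cvg_cst|exact: continuous_oneDsqrV].
have FTC (G g : R -> R) (l : R) : (forall t, is_derive t (1 : R) G (g t)) ->
    continuous g -> (forall t, 0 <= t -> 0 <= g t) -> G t @[t --> +oo] --> l ->
    \int[mu]_(t in half_line) g t = l - G 0.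
  move=> dG cg g0 Gl; apply: Rintegral_ge0_continuous_FTC2y => //.
  - exact: continuous_subspaceT.
  - apply: cvg_at_right_filter; apply/differentiable_continuous/derivable1_diffP.
    by case: (dG 0).
  - by move=> t _; rewrite derive1E; have /@derive_val := dG t.
have f0 t : 0 <= t -> 0 <= f t.
  by move=> t0; have := hC t t0; rewrite ler_norml /f; lra.
have E1 := FTC F f (0 + C * (pi / 2)) dF cf f0 _.
have E2 : \int[mu]_(t in half_line) (oneDsqr t)^-1 = pi / 2 :> R.
  by rewrite /Rintegral integral0y_oneDsqr.
have : \int[mu]_(t in half_line) (f t - C * (oneDsqr t)^-1) = - H 0.
  rewrite RintegralB//.
  - rewrite E1 /F; last first.
      apply: cvgD => //; apply: cvgM; [exact: cvg_cst|exact: cvgy_atan].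
    rewrite RintegralZl//; last first.
      by apply: eq_integrable (integrable_oneDsqrV 1) => // t _; rewrite /= mul1r.
    by rewrite E2 atan0 mulr0; ring.
  - rewrite (_ : EFin \o f = ((EFin \o h) \+ (EFin \o (fun t => (C * (oneDsqr t)^-1)%R)))%E)//.
    apply: integrableD => //. exact: (integrable_oneDsqrV C).
  - exact: integrable_oneDsqrV.
by move=> <-; apply: eq_Rintegral => t _; rewrite /f addrK.
Qed.

End half_line.

Lemma is_derive_prod (R : realType) (n : nat) (f df : 'I_n -> R -> R) (t : R) :
  (forall i, is_derive t (1 : R) (f i) (df i t)) ->
  is_derive t (1 : R) (fun s => \prod_i f i s)
    (\sum_i \prod_j (if j == i then df j t else f j t)).
Proof.
elim: n f df => [|n IH] f df fd.
  rewrite big_ord0; under eq_fun do rewrite big_ord0; exact: is_derive_cst.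
under eq_fun do rewrite big_ord_recl.
have H := IH (fun i => f (lift ord0 i)) (fun i => df (lift ord0 i))
  (fun i => fd (lift ord0 i)).
apply: is_derive_eq (is_deriveM (fd ord0) H) _.
rewrite big_ord_recl addrC; congr (_ + _).
  by rewrite big_ord_recl eqxx /GRing.scale /= mulrC.
rewrite /GRing.scale /= mulr_sumr; apply: eq_bigr => i _.
by rewrite big_ord_recl /=; congr (_ * _).
Qed.

(** * The cell solution *)

Section kinetic_potentials.
Variables (R : realType) (d : nat).
Hypothesis d_ge2 : (2 <= d)%N.
Local Notation mu := (@lebesgue_measure R).
Local Notation half_line := (`[0, +oo[%classic : set (measurableTypeR R)).
Local Notation phase := ('rV[R]_d * 'rV[R]_d)%type.

Variable psi : 'I_d -> nat -> R -> R.
Hypothesis psiD : forall i k x, is_derive x (1 : R) (psi i k) (psi i k.+1 x).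
Hypothesis psiB : forall i k, exists M, forall x, `|psi i k x| <= M.
Hypothesis psi_supp : forall i x, 1 <= `|x| -> psi i 0%N x = 0.

Implicit Types (m : nat) (kappa : 'I_d -> nat) (t : R) (p h : phase) (i : 'I_d).

(* At time 3 t^2 the Gaussian increment of the position has standard deviation
   proportional to t^3; the constants 3 and 12 match the weight exp(-4 y^2). *)
Definition heat i k t p : R :=
  gauss_pairing (psi i k) 1 (p.1 0 i - 3 * t ^+ 2 * p.2 0 i) (12 * t ^+ 3).

Definition heat_prod kappa t p : R := \prod_i heat i (kappa i) t p.

(** In the variable s = 3 t^2 this is s^m times the derivative of multi-index [kappa] of u(s^3/3, x
    - s v), up to the normalisation of the Gaussian; the factor 6 t is ds/dt. The power m counts
    velocity derivatives, each of which produces one factor s, up to sign. *)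
Definition potential_density m kappa t p : R :=
  6 * t * (3 * t ^+ 2) ^+ m * heat_prod kappa t p.

Definition potential m kappa p : R :=
  \int[mu]_(t in half_line) potential_density m kappa t p.

Definition bump_index kappa i : 'I_d -> nat := fun j => (kappa j + (j == i))%N.

Let psiC i k : continuous (psi i k).
Proof.
by move=> x; apply/differentiable_continuous/derivable1_diffP; case: (psiD i k x).
Qed.

(** The pairing decays like b^-(k+1) with b = 12 t^3, that is like t^-(3k+3). The weaker exponent 2k
    + 2 is kept, as it adds up conveniently over the coordinates; for t <= 1 the plain bound
    suffices. *)
Lemma heat_bound i k : exists2 B, 0 < B & forall t p, 0 <= t ->
  `|heat i k t p| <= B /\ t ^+ (2 * k + 2) * `|heat i k t p| <= B.
Proof.
have [C C0 CP] := @gauss_pairing_bounded R 1.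
have [M MP] := psiB i k; have M0 : 0 <= M by rewrite (le_trans _ (MP 0)).
have [D D0 DP] := gauss_pairing_decay k 1 (psiD i) (psiB i) (psi_supp i).
exists (M * C + D); first by rewrite ltr_wpDl// mulr_ge0// ltW.
move=> t p t0.
have H1 : `|heat i k t p| <= M * C by exact: CP.
split; first by rewrite (le_trans H1)// lerDl ltW.
have [t1|t1] := lerP t 1.
  rewrite -[leRHS]mul1r ler_pM ?exprn_ge0 ?exprn_ile1//.
  by rewrite (le_trans H1)// lerDl ltW.
have b0 : 0 < 12 * t ^+ 3 by rewrite mulr_gt0// exprn_gt0 ?(lt_trans ltr01).
have := DP (p.1 0 i - 3 * t ^+ 2 * p.2 0 i) _ b0; rewrite -/(heat i k t p) => H2.
rewrite -[leLHS]add0r lerD ?mulr_ge0 ?(ltW C0)//; apply: le_trans H2.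
rewrite ler_wpM2r// exprMn -[leLHS]mul1r ler_pM ?exprn_ge0//.
  by rewrite exprn_ege1// ler1n.
by rewrite -exprM ler_weXn2l ?(ltW t1)//; lia.
Qed.

(** The exponents 2 k_i + 2 of the factors add up to 2 |kappa| + 2 d, and d >= 2 turns 2 d into at
    least 4. *)
Lemma heat_prod_bound kappa : exists2 B, 0 < B & forall t p, 0 <= t ->
  `|heat_prod kappa t p| <= B /\
  t ^+ (2 * \sum_i kappa i + 4) * `|heat_prod kappa t p| <= B.
Proof.
have /choice[B BP] : forall i, exists B, 0 < B /\ forall t p, 0 <= t ->
    `|heat i (kappa i) t p| <= B /\
    t ^+ (2 * kappa i + 2) * `|heat i (kappa i) t p| <= B.
  by move=> i; have [B B0 BP] := heat_bound i (kappa i); exists B.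
have B0 : 0 < \prod_i B i by apply: prodr_gt0 => i _; case: (BP i).
exists (\prod_i B i) => // t p t0.
have H1 : `|heat_prod kappa t p| <= \prod_i B i.
  rewrite normr_prod; apply: ler_prod => i _; rewrite normr_ge0 /=.
  by case: (BP i) => _ /(_ t p t0)[].
split => //.
have [t1|t1] := lerP t 1.
  by rewrite -[leRHS]mul1r ler_pM ?exprn_ge0 ?exprn_ile1.
apply: (@le_trans _ _ (\prod_i (t ^+ (2 * kappa i + 2) * `|heat i (kappa i) t p|))).
  rewrite big_split /= normr_prod ler_wpM2r ?prodr_ge0// prodrXr.
  rewrite ler_weXn2l ?(ltW t1)// big_split /= -big_distrr /= sum_nat_const card_ord.
  lia.
apply: ler_prod => i _; rewrite mulr_ge0 ?exprn_ge0//=.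
by case: (BP i) => _ /(_ t p t0)[].
Qed.

(** The prefactor grows like t^(2m+1). Multiplying by 1 + t^2 raises this to at most t^(2m+3), and m
    <= |kappa| keeps both powers below the exponent 2 |kappa| + 4 controlled by [heat_prod_bound].
    The bound is uniform in the phase point, so it also serves to differentiate under the
    integral. *)
Lemma potential_density_bound m kappa : (m <= \sum_i kappa i)%N ->
  exists2 C, 0 < C & forall t p, 0 <= t ->
    `|potential_density m kappa t p| <= C * (oneDsqr t)^-1.
Proof.
move=> mk; have [B B0 BP] := heat_prod_bound kappa.
exists (12 * 3 ^+ m * B); first by rewrite !mulr_gt0// exprn_gt0.
move=> t p t0; have [H1 H2] := BP t p t0.
rewrite ler_pdivlMr// /potential_density !normrM.
rewrite (ger0_norm t0) ger0_norm// normrX (ger0_norm (_ : 0 <= 3 * t ^+ 2)); last first.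
  by rewrite mulr_ge0// exprn_ge0.
rewrite exprMn -exprM.
have m3 : (0 : R) < 3 ^+ m by rewrite exprn_gt0.
suff : t ^+ (2 * m).+1 * `|heat_prod kappa t p| * oneDsqr t <= 2 * B.
  move=> /(ler_wpM2l (ltW (mulr_gt0 (ltr0n _ 6) m3))); rewrite exprS; lra.
rewrite /oneDsqr mulrDr mulr1 mulrAC -exprD mulr2n mulrDl !mul1r.
have H (n : nat) : (n <= 2 * \sum_i kappa i + 4)%N ->
    t ^+ n * `|heat_prod kappa t p| <= B.
  move=> nk; have [t1|t1] := lerP t 1.
    by rewrite -[leRHS]mul1r ler_pM ?exprn_ge0 ?exprn_ile1.
  by apply: le_trans H2; rewrite ler_wpM2r// ler_weXn2l// ltW.
by rewrite lerD// H//; lia.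
Qed.

Lemma is_derive_heat_dir i k t p h :
  is_derive p h (heat i k t)
    ((h.1 0 i - 3 * t ^+ 2 * h.2 0 i) * heat i k.+1 t p).
Proof.
have [M MP] := psiB i k; have [M' MP'] := psiB i k.+1.
pose da := h.1 0 i - 3 * t ^+ 2 * h.2 0 i.
pose a (s : R) := (p.1 0 i - 3 * t ^+ 2 * p.2 0 i) + da * s.
have E : (fun s : R => heat i k t (s *: h + p)) =
    (fun s => gauss_pairing (psi i k) 1 (a s) (cst (12 * t ^+ 3) s)).
  apply/funext => s; rewrite /heat /a /da /=; congr gauss_pairing.
  by rewrite !mxE; ring.
have dE : is_derive (0 : R) (1 : R) (fun s : R => heat i k t (s *: h + p))
    (da * heat i k.+1 t p).
  have Ha s : is_derive s (1 : R) a (cst da s) by exact: is_derive_affine.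
  have Hb s : is_derive s (1 : R) (cst (12 * t ^+ 3) : R -> R) (cst 0 s).
    exact: is_derive_cst.
  have cc (c : R) : continuous (cst c : R -> R) by move=> x; exact: cvg_cst.
  have := is_derive_gauss_pairing MP MP' (@psiC i k.+1) (psiD i k) 1 0 Ha Hb (cc _) (cc _).
  by rewrite E [cst 0 _ * _]mul0r addr0 {2}/a mulr0 addr0.
by have := (is_derive_line (heat i k t) p h 0 _).2 dE; rewrite scale0r add0r.
Qed.

(** The spread varies at rate 36 t^2 and multiplies an average weighted by y. By parts this average
    equals (12 t^3 / 8) times the one with one more derivative, and 36 t^2 * 12 t^3 / 8 = 6 t * 9
    t^4, which is s^2 ds/dt for s = 3 t^2. *)
Lemma is_derive_heat_time i k t p :
  is_derive t (1 : R) (fun s => heat i k s p)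
    (6 * t * (9 * t ^+ 4 * heat i k.+2 t p - p.2 0 i * heat i k.+1 t p)).
Proof.
have [M MP] := psiB i k; have [M' MP'] := psiB i k.+1; have [M2 MP2] := psiB i k.+2.
pose da (s : R) := - (6 * s * p.2 0 i); pose db (s : R) := 36 * s ^+ 2.
have ad s : is_derive s (1 : R) (fun s => p.1 0 i - 3 * s ^+ 2 * p.2 0 i) (da s).
  apply: is_derive_eq (is_deriveB (is_derive_cst (p.1 0 i) s (1 : R))
    (is_deriveM (is_deriveZ (3 : R) (is_deriveX 2 (is_derive_id s (1 : R))))
    (is_derive_cst (p.2 0 i) s (1 : R)))) _.
  by rewrite /da /GRing.scale /=; ring.
have bd s : is_derive s (1 : R) (fun s => 12 * s ^+ 3) (db s).
  apply: is_derive_eq (is_deriveZ (12 : R) (is_deriveX 3 (is_derive_id s (1 : R)))) _.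
  by rewrite /db /GRing.scale /=; ring.
apply: is_derive_eq (is_derive_gauss_pairing MP MP' (@psiC i k.+1)
    (psiD i k) 1 t ad bd _ _) _.
- rewrite (_ : da = *%R (- (6 * p.2 0 i))); first exact: mulrl_continuous.
  by apply/funext => s; rewrite /da; ring.
- apply: (@is_derive_continuous _ _ (fun s => 36 * (2 * s))) => s.
  apply: is_derive_eq (is_deriveZ (36 : R) (is_deriveX 2 (is_derive_id s (1 : R)))) _.
  by rewrite /GRing.scale /=; ring.
rewrite mulr1.
have := gauss_pairing_by_parts MP' MP2 (@psiC i k.+2) (psiD i k.+1) 1
  (p.1 0 i - 3 * t ^+ 2 * p.2 0 i) (12 * t ^+ 3).
rewrite derivC sub0r mulr1 -/(heat i k.+2 t p) -/(heat i k.+1 t p).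
rewrite -scaleNr (gauss_pairingZ _ _ _ _ (@psiC i k.+1) MP').
set J := gauss_pairing _ 'X _ _ => H.
have -> : J = 12 * t ^+ 3 / 8 * heat i k.+2 t p by lra.
by rewrite /da /db; field.
Qed.

Lemma heat_prod_bump kappa i t p : heat_prod (bump_index kappa i) t p =
  heat i (kappa i).+1 t p * \prod_(j | j != i) heat j (kappa j) t p.
Proof.
rewrite /heat_prod (bigD1 i)//= /bump_index eqxx addn1; congr (_ * _).
by apply: eq_bigr => j /negbTE ->; rewrite addn0.
Qed.

Lemma heat_prod_derivative_step kappa t p (c : 'I_d -> R) :
  \sum_i \prod_j (if j == i then c j * heat j (kappa j).+1 t p
    else heat j (kappa j) t p) =
  \sum_i c i * heat_prod (bump_index kappa i) t p.
Proof.
apply: eq_bigr => i _; rewrite heat_prod_bump (bigD1 i)//= eqxx -mulrA.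
by congr (_ * (_ * _)); apply: eq_bigr => j /negbTE ->.
Qed.

Lemma is_derive_heat_prod_dir kappa t p h :
  is_derive p h (heat_prod kappa t)
    (\sum_i (h.1 0 i - 3 * t ^+ 2 * h.2 0 i) * heat_prod (bump_index kappa i) t p).
Proof.
have dE : is_derive (0 : R) (1 : R) (fun s : R => heat_prod kappa t (s *: h + p))
    (\sum_i (h.1 0 i - 3 * t ^+ 2 * h.2 0 i) *
      heat_prod (bump_index kappa i) t (0 *: h + p)).
  rewrite -heat_prod_derivative_step.
  apply: (is_derive_prod (f := fun i (s : R) => heat i (kappa i) t (s *: h + p))
    (df := fun i (s : R) => (h.1 0 i - 3 * t ^+ 2 * h.2 0 i) *
       heat i (kappa i).+1 t (s *: h + p))) => i.
  apply: (is_derive_line (heat i (kappa i) t) p h 0 _).1.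
  exact: is_derive_heat_dir.
by have := (is_derive_line (heat_prod kappa t) p h 0 _).2 dE; rewrite scale0r add0r.
Qed.

Lemma is_derive_heat_prod_time kappa t p :
  is_derive t (1 : R) (fun s => heat_prod kappa s p)
    (\sum_i potential_density 2 (bump_index (bump_index kappa i) i) t p -
     \sum_i p.2 0 i * potential_density 0 (bump_index kappa i) t p).
Proof.
have H := @is_derive_prod R d (fun i s => heat i (kappa i) s p)
  (fun i s => 6 * s * (9 * s ^+ 4 * heat i (kappa i).+2 s p -
     p.2 0 i * heat i (kappa i).+1 s p)) t (fun i => is_derive_heat_time i (kappa i) t p).
apply: is_derive_eq H _; rewrite -sumrB; apply: eq_bigr => i _.
rewrite /potential_density !heat_prod_bump (bigD1 i)//= eqxx /bump_index eqxx addn1.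
rewrite (eq_bigr (fun j => heat j (kappa j) t p)); last by move=> j /negbTE ->.
rewrite [in RHS](eq_bigr (fun j => heat j (kappa j) t p)); last first.
  by move=> j /negbTE ->; rewrite addn0.
by rewrite expr0; ring.
Qed.

(** [inl] stands for a position derivative and [inr] for a velocity derivative, which also brings a
    factor s. The minus sign of the latter is carried by [coord_v], so that the recursion has the
    form required by [smooth_family]. *)
Definition next_index (mk : nat * ('I_d -> nat)) (j : 'I_d + 'I_d) :=
  match j with
  | inl i => (mk.1, bump_index mk.2 i)
  | inr i => (mk.1.+1, bump_index mk.2 i)
  end.

Let coord_x i h : R := h.1 0 i.
Let coord_v i h : R := - h.2 0 i.

Let coord_x_linear i : linear (coord_x i).
Proof. by move=> a h k; rewrite /coord_x !mxE. Qed.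

Let coord_v_linear i : linear (coord_v i).
Proof. by move=> a h k; rewrite /coord_v !mxE opprD -mulrN. Qed.

HB.instance Definition _ i := GRing.isLinear.Build R phase R _ (coord_x i) (coord_x_linear i).
HB.instance Definition _ i := GRing.isLinear.Build R phase R _ (coord_v i) (coord_v_linear i).

Definition coord_dir (j : 'I_d + 'I_d) : {linear phase -> R} :=
  match j with inl i => coord_x i | inr i => coord_v i end.

Lemma continuous_coord_dir (j : 'I_d + 'I_d) : continuous (coord_dir j).
Proof.
have c1 i : continuous (fun h : phase => h.1 0 i).
  move=> h; apply: (@continuous_comp _ _ _ fst (fun x : 'rV[R]_d => x 0 i)).
    exact: cvg_fst.
  exact: coord_continuous.
have c2 i : continuous (fun h : phase => h.2 0 i).
  move=> h; apply: (@continuous_comp _ _ _ snd (fun x : 'rV[R]_d => x 0 i)).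
    exact: cvg_snd.
  exact: coord_continuous.
case: j => i /=; first exact: c1.
by move=> h; apply: cvgN; exact: c2.
Qed.

Lemma is_derive_potential_density m kappa t p h :
  is_derive p h (potential_density m kappa t)
    (\sum_j coord_dir j h * potential_density (next_index (m, kappa) j).1
        (next_index (m, kappa) j).2 t p).
Proof.
apply: is_derive_eq (is_deriveZ (6 * t * (3 * t ^+ 2) ^+ m)
  (is_derive_heat_prod_dir kappa t p h)) _.
have Ex i : coord_dir (inl i) h = h.1 0 i by [].
have Ev i : coord_dir (inr i) h = - h.2 0 i by [].
have E (F : 'I_d + 'I_d -> R) : \sum_j F j = \sum_i (F (inl i) + F (inr i)).
  by rewrite big_sumType big_split.
rewrite E scaler_sumr.
apply: eq_bigr => i _; rewrite Ex Ev /GRing.scale /potential_density /= [_ ^+ m.+1]exprS.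
by ring.
Qed.

Lemma continuous_heat_prod_time kappa p : continuous (fun t => heat_prod kappa t p).
Proof. by apply: is_derive_continuous => t; exact: is_derive_heat_prod_time. Qed.

Lemma continuous_potential_density_time m kappa p :
  continuous (fun t => potential_density m kappa t p).
Proof.
have c : continuous (fun s : R => 6 * s * (3 * s ^+ 2) ^+ m).
  rewrite (_ : (fun s : R => _) = horner ((6 *: 'X) * (3 *: 'X^2) ^+ m)).
    exact: continuous_horner.
  by apply/funext => s; rewrite hornerM horner_exp !hornerZ hornerX hornerXn.
by move=> t; apply: cvgM; [exact: c|exact: continuous_heat_prod_time].
Qed.

Lemma measurable_potential_density m kappa p :
  measurable_fun half_line (fun t => potential_density m kappa t p).
Proof.
by apply: measurable_funTS; apply: continuous_measurable_fun;
  exact: continuous_potential_density_time.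
Qed.

Let half_line_ge0 t : half_line t -> 0 <= t.
Proof. by rewrite /= in_itv/= andbT. Qed.

Lemma integrable_potential_density m kappa p : (m <= \sum_i kappa i)%N ->
  mu.-integrable half_line (EFin \o (fun t => potential_density m kappa t p)).
Proof.
move=> /potential_density_bound[C _ CP].
apply: dominated_integrable (integrable_oneDsqrV C) => //.
  exact: measurable_potential_density.
by move=> t /half_line_ge0 t0; exact: CP.
Qed.

Lemma potential_bounded m kappa : (m <= \sum_i kappa i)%N ->
  exists B, forall p, `|potential m kappa p| <= B.
Proof.
move=> /potential_density_bound[C _ CP].
exists (\int[mu]_(t in half_line) (C * (oneDsqr t)^-1)) => p.
apply: dominated_Rintegral (integrable_oneDsqrV C) => //.
  exact: measurable_potential_density.
by move=> t /half_line_ge0 t0; exact: CP.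
Qed.

Lemma sum_bump_index kappa i :
  (\sum_j bump_index kappa i j = (\sum_j kappa j).+1)%N.
Proof.
rewrite big_split /= addnC -add1n; congr addn.
by rewrite (bigD1 i)//= eqxx big1 ?addn0// => j /negbTE ->.
Qed.

(** The range in which the densities are integrable. It is stable: every derivative raises the order
    of the multi-index by one and m by at most one. *)
Let admissible (mk : nat * ('I_d -> nat)) := (mk.1 <= \sum_i mk.2 i)%N.

Let admissible_next mk (j : 'I_d + 'I_d) : admissible mk -> admissible (next_index mk j).
Proof.
by case: j => i; rewrite /admissible /= sum_bump_index //; exact: leqW.
Qed.

Lemma is_derive_potential m kappa p h : (m <= \sum_i kappa i)%N ->
  is_derive p h (potential m kappa)
    (\sum_j coord_dir j h * potential (next_index (m, kappa) j).1
        (next_index (m, kappa) j).2 p).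
Proof.
move=> mk.
have mkn j : ((next_index (m, kappa) j).1 <= \sum_i (next_index (m, kappa) j).2 i)%N.
  exact: (@admissible_next (m, kappa)).
have /choice[C CP] : forall j, exists C, forall t q, 0 <= t ->
    `|potential_density (next_index (m, kappa) j).1
      (next_index (m, kappa) j).2 t q| <= C * (oneDsqr t)^-1.
  by move=> j; have [C _] := potential_density_bound (mkn j); exists C.
pose dens s t := \sum_j coord_dir j h * potential_density (next_index (m, kappa) j).1
        (next_index (m, kappa) j).2 t (s *: h + p).
have -> : \sum_j coord_dir j h * potential (next_index (m, kappa) j).1
        (next_index (m, kappa) j).2 p = \int[mu]_(t in half_line) dens 0 t.
  rewrite /dens scale0r add0r Rintegral_sum//; last first.
    by move=> j; apply: integrable_cmul => //; exact: integrable_potential_density.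
  apply: eq_bigr => j _; rewrite RintegralZl//.
  exact: integrable_potential_density.
have pE : p = 0 *: h + p by rewrite scale0r add0r.
rewrite {1}pE; apply: (is_derive_line (potential m kappa) p h 0 _).2.
have mhl : measurable half_line by exact: measurable_itv.
apply: (@is_derive_integral _ (measurableTypeR R) R mu half_line mhl
  (fun s t => potential_density m kappa t (s *: h + p)) dens _ 0 1 ltr01
  _ _ _ (integrable_oneDsqrV (\sum_j `|coord_dir j h| * C j))).
- by move=> s _; exact: integrable_potential_density.
- move=> s t _ _; apply: (is_derive_line (potential_density m kappa t) p h s _).1.
  exact: is_derive_potential_density.
- move=> s t _ /half_line_ge0 t0; rewrite mulr_suml.
  apply: (le_trans (ler_norm_sum _ _ _)); apply: ler_sum => j _.
  by rewrite normrM -mulrA ler_wpM2l// CP.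
Qed.

Lemma smooth_potential m kappa : (m <= \sum_i kappa i)%N ->
  smooth (potential m kappa).
Proof.
have /choice[B BP] : forall mk, exists B, forall p, admissible mk ->
    `|potential mk.1 mk.2 p| <= B.
  move=> [m' k']; have [mk|mk] := boolP (m' <= \sum_i k' i)%N.
    by have [B BP] := potential_bounded mk; exists B.
  by exists 0 => p; rewrite /admissible /= (negbTE mk).
move=> mk; apply: (@smooth_family _ _ _ _ admissible
  (fun mk p => potential mk.1 mk.2 p) next_index B coord_dir
  continuous_coord_dir _ _ _ (m, kappa)) => //.
by move=> [m' k'] u x; exact: is_derive_potential.
Qed.

Definition gauss_mass : R := \int[mu]_y gauss_weight 1 y.

Lemma gauss_mass_gt0 : 0 < gauss_mass.
Proof.
have w1 y : gauss_weight (1 : {poly R}) y = expR (- (4 * y ^+ 2)).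
  by rewrite /gauss_weight hornerC mul1r.
apply: (@Rintegral_gt0 R setT _ 0) => //.
- exact: filterT.
- exact: continuous_gauss_weight.
- by move=> t _; rewrite w1 expR_ge0.
- have [C C0 CP] := @gauss_weight_le R 1.
  apply: dominated_integrable (integrable_gaussZ C) => //.
  by apply: continuous_measurable_fun; exact: continuous_gauss_weight.
- by rewrite w1 expR_gt0.
Qed.

Lemma heat0 i k p : heat i k 0 p = psi i k (p.1 0 i) * gauss_mass.
Proof.
by rewrite /heat expr0n /= mulr0 mul0r subr0 expr0n mulr0 gauss_pairing0.
Qed.

Definition no_index : 'I_d -> nat := fun=> 0%N.

(** The value of [heat_prod] at t = 0 with no derivative taken. The powers of [gauss_mass] appear
    because the Gaussian averages are not normalised. *)
Definition profile (x : 'rV[R]_d) : R := \prod_i (psi i 0%N (x 0 i) * gauss_mass).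

(** The time derivative of [heat_prod] is a combination of densities. Integrated over the half line
    it leaves only the boundary term at 0, which is the profile, since [heat_prod] decays as t
    grows. *)
Lemma potential_equation p :
  \sum_i p.2 0 i * potential 0 (bump_index no_index i) p =
  \sum_i potential 2 (bump_index (bump_index no_index i) i) p + profile p.1.
Proof.
pose h t := \sum_i potential_density 2 (bump_index (bump_index no_index i) i) t p -
  \sum_i p.2 0 i * potential_density 0 (bump_index no_index i) t p.
have k1 i : (0 <= \sum_j bump_index no_index i j)%N by [].
have k2 i : (2 <= \sum_j bump_index (bump_index no_index i) i j)%N.
  by rewrite !sum_bump_index.
have /choice[C CP] : forall i, exists C, forall t q, 0 <= t ->
    `|potential_density 2 (bump_index (bump_index no_index i) i) t q| <=
    C * (oneDsqr t)^-1.
  by move=> i; have [C _] := potential_density_bound (k2 i); exists C.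
have /choice[D DP] : forall i, exists D, forall t q, 0 <= t ->
    `|potential_density 0 (bump_index no_index i) t q| <= D * (oneDsqr t)^-1.
  by move=> i; have [D _] := potential_density_bound (k1 i); exists D.
have ch : continuous h.
  move=> t; apply: cvgB; first by apply: continuous_sum => i;
    exact: continuous_potential_density_time.
  apply: continuous_sum => i s; apply: cvgM; first exact: cvg_cst.
  exact: continuous_potential_density_time.
have hb t : 0 <= t -> `|h t| <= (\sum_i C i + \sum_i `|p.2 0 i| * D i) * (oneDsqr t)^-1.
  move=> t0; rewrite mulrDl !mulr_suml; apply: (le_trans (ler_normB _ _)); apply: lerD.
    by apply: (le_trans (ler_norm_sum _ _ _)); apply: ler_sum => i _; exact: CP.
  apply: (le_trans (ler_norm_sum _ _ _)); apply: ler_sum => i _.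
  by rewrite normrM -mulrA ler_wpM2l// DP.
have H0 : heat_prod no_index t p @[t --> +oo] --> (0 : R).
  have [B B0 BP] := heat_prod_bound no_index; apply: (@cvg_infty_inv _ _ B) => t t1.
  have t0 : 0 < t by rewrite (lt_le_trans ltr01).
  have [_ H] := BP t p (ltW t0); rewrite ler_pdivlMr// mulrC; apply: le_trans H.
  rewrite ler_wpM2r// -[leLHS]expr1 ler_weXn2l//; lia.
have := integral_half_line_derivative
  (fun t => is_derive_heat_prod_time no_index t p) ch hb H0.
have -> : heat_prod no_index 0 p = profile p.1.
  by apply: eq_bigr => i _; rewrite heat0.
have i1 i : mu.-integrable half_line (EFin \o
    (fun t => potential_density 2 (bump_index (bump_index no_index i) i) t p)).
  exact: integrable_potential_density.
have i2 i : mu.-integrable half_line (EFin \o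
    (fun t => potential_density 0 (bump_index no_index i) t p)).
  exact: integrable_potential_density.
have i3 i : mu.-integrable half_line (EFin \o
    (fun t => p.2 0 i * potential_density 0 (bump_index no_index i) t p)).
  exact: integrable_cmul.
rewrite /h RintegralB//; last 2 first.
- exact: integrable_sum_fin.
- exact: integrable_sum_fin.
rewrite Rintegral_sum// Rintegral_sum//.
rewrite [X in _ - X = _](_ : _ =
    \sum_i p.2 0 i * potential 0 (bump_index no_index i) p); last first.
  by apply: eq_bigr => i _; rewrite RintegralZl.
rewrite -[X in X - _ = _]/(\sum_i potential 2 (bump_index (bump_index no_index i) i) p).
lra.
Qed.

Section positivity.
Variables (i0 i1 : 'I_d).
Hypotheses (i01 : i0 != i1) (psi01 : psi i0 = psi i1).
Hypothesis psi1_neq0 : psi i0 1%N 0 != 0.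
Hypothesis psi_ge0 : forall i x, i != i0 -> i != i1 -> 0 <= psi i 0%N x.
Hypothesis psi0_gt0 : forall i, i != i0 -> i != i1 -> 0 < psi i 0%N 0.

(** At the origin the factors of index [i0] and [i1] are the same average of the same function, so
    their product is a square; the other factors average nonnegative functions. The integrand is
    thus nonnegative, and it remains to find one time at which it is positive. *)
Lemma mixed_potential_gt0 :
  0 < potential 2 (bump_index (bump_index no_index i0) i1) 0.
Proof.
set kappa := bump_index _ _.
have hpE t : heat_prod kappa t 0 = heat i0 1 t 0 ^+ 2 *
    \prod_(i | (i != i0) && (i != i1)) heat i 0 t 0.
  rewrite /heat_prod (bigD1 i0)//= (bigD1 i1)//=; last by rewrite eq_sym.
  rewrite /kappa /bump_index /no_index !eqxx (negbTE i01) eq_sym (negbTE i01).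
  rewrite mulrA expr2; congr (_ * _ * _).
    by rewrite /heat psi01 !mxE.
  by apply: eq_bigr => i /andP[/negbTE -> /negbTE ->].
have h_ge0 i t : i != i0 -> i != i1 -> 0 <= heat i 0 t 0.
  move=> ii0 ii1; apply: Rintegral_ge0 => y _.
  by rewrite mulr_ge0 ?psi_ge0// /gauss_weight hornerC mul1r expR_ge0.
have hp_ge0 t : 0 <= heat_prod kappa t 0.
  rewrite hpE mulr_ge0 ?sqr_ge0// prodr_ge0// => i /andP[ii0 ii1].
  exact: h_ge0.
have hp0_gt0 : 0 < heat_prod kappa 0 0.
  rewrite hpE mulr_gt0//.
    rewrite lt_def sqr_ge0 sqrf_eq0 heat0 mxE mulf_eq0 negb_or psi1_neq0.
    by rewrite gt_eqF// gauss_mass_gt0.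
  apply: prodr_gt0 => i /andP[ii0 ii1].
  by rewrite heat0 mxE mulr_gt0 ?psi0_gt0 ?gauss_mass_gt0.
(* At t = 0 the density vanishes through its factor 6 t, so positivity of the product is carried by
   continuity to a positive time, interior to the half line. *)
have [t t0 tP] : exists2 t, 0 < t & 0 < heat_prod kappa t 0.
  have : \forall s \near (0 : R), 0 < heat_prod kappa s 0.
    exact: (cvgr_gt _ (@continuous_heat_prod_time kappa 0 0)).
  move=> /nbhs_ballP[e /= e0 eP]; exists (e / 2); first by rewrite divr_gt0.
  by apply: eP; rewrite /ball /= sub0r normrN gtr0_norm; lra.
apply: (@Rintegral_gt0 R half_line _ t) => //.
- by apply: filterS (lt_nbhsr t0) => s s0; rewrite /= in_itv/= andbT ltW.
- exact: continuous_potential_density_time.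
- move=> s /half_line_ge0 s0; rewrite /potential_density.
  by rewrite !mulr_ge0// exprn_ge0// mulr_ge0// exprn_ge0.
- by apply: integrable_potential_density; rewrite !sum_bump_index.
- by rewrite /potential_density !mulr_gt0// exprn_gt0// mulr_gt0// exprn_gt0.
Qed.

End positivity.
End kinetic_potentials.

(** * From the potentials to the cell *)

Section row_vector_norm.
Variables (R : realType) (n : nat).
Implicit Types x : 'rV[R]_n.

Lemma rV_norm_coord x i : `|x 0 i| <= `|x|.
Proof. by rewrite [leRHS]/Num.norm /= mx_normrE; apply/bigmax_geP; right => /=; exists (0, i). Qed.

Lemma rV_norm_le x M : 0 <= M -> (forall i, `|x 0 i| <= M) -> `|x| <= M.
Proof.
move=> M0 xM; rewrite [leLHS]/Num.norm /= mx_normrE; apply/bigmax_leP; split=> // -[i j] _.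
by rewrite (ord1 i).
Qed.

Lemma rV_norm_ge_coord x M : 0 < M -> M <= `|x| -> exists i, M <= `|x 0 i|.
Proof.
move=> M0 xM; apply: contrapT => H.
have [e e0 He] : exists2 e, 0 <= e < M & forall i, `|x 0 i| <= e.
  exists (\big[Order.max/0]_i `|x 0 i|).
    apply/andP; split; first exact: bigmax_ge_id.
    apply/bigmax_ltP; split=> // i _; rewrite ltNge; apply/negP => Mi.
    by apply: H; exists i.
  by move=> i; apply/bigmax_geP; right; exists i.
case/andP: e0 => e0; rewrite ltNge => /negP; apply.
by rewrite (le_trans xM)// rV_norm_le.
Qed.

End row_vector_norm.

Section potential_derivatives.
Variables (R : realType) (d : nat) (psi : 'I_d -> nat -> R -> R).
Hypothesis d_ge2 : (2 <= d)%N.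
Hypothesis psiD : forall i k x, is_derive x (1 : R) (psi i k) (psi i k.+1 x).
Hypothesis psiB : forall i k, exists M, forall x, `|psi i k x| <= M.
Hypothesis psi_supp : forall i x, 1 <= `|x| -> psi i 0%N x = 0.
Local Notation phase := ('rV[R]_d * 'rV[R]_d)%type.
Local Notation e_ i := (Defs.basis R i).

Lemma derive_potential_x m kappa i (p : phase) : (m <= \sum_i kappa i)%N ->
  'D_((e_ i, 0) : phase) (potential psi m kappa) p =
  potential psi m (bump_index kappa i) p.
Proof.
move=> mk; have H := is_derive_potential d_ge2 psiD psiB psi_supp p (e_ i, 0) mk.
have Ex j : coord_dir R (inl j) (e_ i, 0) = (j == i)%:R.
  by rewrite -[LHS]/(e_ i 0 j) mxE.
have Ev j : coord_dir R (inr j) (e_ i, 0) = 0.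
  by rewrite -[LHS]/(- (0 : 'rV[R]_d) 0 j) mxE oppr0.
rewrite derive_val big_sumType /= [X in _ + X]big1 ?addr0; last first.
  by move=> j _; have := Ev j; rewrite /= => ->; rewrite mul0r.
rewrite (bigD1 i)//=; have := Ex i; rewrite /= => ->; rewrite eqxx mul1r.
by rewrite big1 ?addr0// => j ji; have := Ex j; rewrite /= => ->;
  rewrite (negbTE ji) mul0r.
Qed.

Lemma derive_potential_v m kappa i (p : phase) : (m <= \sum_i kappa i)%N ->
  'D_((0, e_ i) : phase) (potential psi m kappa) p =
  - potential psi m.+1 (bump_index kappa i) p.
Proof.
move=> mk; have H := is_derive_potential d_ge2 psiD psiB psi_supp p (0, e_ i) mk.
have Ex j : coord_dir R (inl j) (0, e_ i) = 0.
  by rewrite -[LHS]/((0 : 'rV[R]_d) 0 j) mxE.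
have Ev j : coord_dir R (inr j) (0, e_ i) = - (j == i)%:R.
  by rewrite -[LHS]/(- e_ i 0 j) mxE.
rewrite derive_val big_sumType /= [X in X + _]big1 ?add0r; last first.
  by move=> j _; have := Ex j; rewrite /= => ->; rewrite mul0r.
rewrite (bigD1 i)//=; have := Ev i; rewrite /= => ->; rewrite eqxx mulN1r.
by rewrite big1 ?addr0// => j ji; have := Ev j; rewrite /= => ->;
  rewrite (negbTE ji) oppr0 mul0r.
Qed.

Lemma derive2_potential_v m kappa i j (p : phase) : (m <= \sum_i kappa i)%N ->
  'D_((0, e_ i) : phase) (fun q => 'D_((0, e_ j) : phase) (potential psi m kappa) q) p =
  potential psi m.+2 (bump_index (bump_index kappa j) i) p.
Proof.
move=> mk.
have -> : (fun q : phase => 'D_((0, e_ j) : phase) (potential psi m kappa) q) =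
    (fun q => -1 * potential psi m.+1 (bump_index kappa j) q).
  by apply/funext => q; rewrite derive_potential_v ?mulN1r//.
have mkj : (m.+1 <= \sum_i (bump_index kappa j) i)%N by rewrite sum_bump_index.
rewrite deriveZ_smooth; last exact: smooth_potential.
by rewrite derive_potential_v// mulN1r opprK.
Qed.

Lemma potential_lipschitz m kappa : (m <= \sum_i kappa i)%N ->
  exists2 C, 0 < C & forall h p : phase,
    `|potential psi m kappa (h + p) - potential psi m kappa p| <= C * `|h|.
Proof.
move=> mk.
have /choice[k kP] : forall j : 'I_d + 'I_d, exists k, 0 < k /\
    forall x, `|coord_dir R j x| <= k * `|x|.
  by move=> j; have [k k0 kP] := linear_lipschitz (@continuous_coord_dir R d j); exists k.
have /choice[B BP] : forall j, exists B, forall p,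
    `|potential psi (next_index (m, kappa) j).1 (next_index (m, kappa) j).2 p| <= B.
  move=> j; apply: potential_bounded => //.
  by case: j => i /=; rewrite sum_bump_index// ltnW.
exists (\sum_j k j * `|B j| + 1).
  by rewrite ltr_wpDl// sumr_ge0// => j _; rewrite mulr_ge0// ltW//; case: (kP j).
move=> h p.
have [t _ ->] := mvt_line p (fun y => is_derive_potential d_ge2 psiD psiB psi_supp y h mk).
rewrite mulrDl mul1r -[leLHS]addr0 lerD// mulr_suml.
apply: (le_trans (ler_norm_sum _ _ _)); apply: ler_sum => j _.
rewrite normrM mulrAC ler_pM//; first by case: (kP j).
by rewrite (le_trans (BP _ _))// ler_norm.
Qed.

End potential_derivatives.

Section iterated_derivatives.
Variable R : realType.

Definition nderiv (f : R -> R) (k : nat) : R -> R := iter k (fun (h : R -> R) (x : R) => 'D_(1 : R) h x) f.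

Lemma smooth_nderiv f k : smooth f -> smooth (nderiv f k).
Proof. by move=> sf; elim: k => [//|k IH] /=; exact: smooth_derive. Qed.

Lemma is_derive_nderiv f k x : smooth f -> is_derive x (1 : R) (nderiv f k) (nderiv f k.+1 x).
Proof. by move=> /(smooth_nderiv k) sf; exact: smooth_is_derive. Qed.

Lemma nderiv_bounded f k : smooth f -> (forall x, 1 <= `|x| -> f x = 0) ->
  exists M, forall x, `|nderiv f k x| <= M.
Proof.
move=> sf f0.
(* The inequality is strict because a derivative at x depends on a neighbourhood of x, and the set
   |y| > 1 is open. *)
have z x : 1 < `|x| -> nderiv f k x = 0.
  elim: k x => [|k IH] x x1; first by rewrite /nderiv /= f0// ltW.
  rewrite /= -(derive_cst (0 : R) x (1 : R)); apply: near_eq_derive.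
  have : \forall y \near x, 1 < `|y|.
    exact: (cvgr_gt `|x| (@norm_continuous _ R x)).
  by apply: filterS => y y1; rewrite IH.
have c : {within `[-1, 1], continuous (fun x => `|nderiv f k x|)}.
  apply: continuous_subspaceT => x; apply: cvg_norm.
  exact/smooth_continuous/smooth_nderiv.
have le11 : (-1 : R) <= 1 by lra.
have [m _ mP] := EVT_max le11 c.
exists `|nderiv f k m| => x; have [x1|x1] := lerP `|x| 1; last by rewrite z// normr0.
by apply: mP; rewrite in_itv/= -ler_norml.
Qed.

End iterated_derivatives.

(* The profile phi is odd in the two coordinates i0, i1: it vanishes at the origin
   while the mixed velocity derivative W of the solution F does not. *)
Lemma exists_cell (R : realType) (d : nat) (i0 i1 : 'I_d) : i0 != i1 ->
  exists (phi : 'rV[R]_d -> R) (F W : 'rV[R]_d * 'rV[R]_d -> R) (K B : R),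
  [/\ smooth phi /\ smooth F,
      0 < K /\ forall x, `|phi x| <= K * `|x|,
      forall x, 1 <= `|x| -> phi x = 0,
      0 < B /\ [/\ forall p, `|F p| <= B, forall p, `|W p - W 0| <= B * `|p| &
        0 < W 0] &
      [/\ forall p : 'rV[R]_d * 'rV[R]_d,
          \sum_i p.2 0 i * 'D_(Defs.basis R i, 0 : 'rV[R]_d) F p =
          \sum_i 'D_(0 : 'rV[R]_d, Defs.basis R i)
            (fun q => 'D_(0 : 'rV[R]_d, Defs.basis R i) F q) p + phi p.1 &
      forall p, 'D_(0 : 'rV[R]_d, Defs.basis R i0)
          (fun q => 'D_(0 : 'rV[R]_d, Defs.basis R i1) F q) p = W p]].
Proof.
move=> i01.
have d2 : (2 <= d)%N.
  move: i01; case: d i0 i1 => [[]//|[[? ?] [? ?]|//]].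
  by rewrite -val_eqE /=; lia.
have [eta [seta eta0 eta_supp eta_pos]] := exists_bump R.
(* Two properties are exploited: it vanishes at 0, which makes the profile Lipschitz at the origin,
   and its slope there is eta 0 > 0, which makes the mixed derivative positive. *)
pose odd_eta (x : R) := x * eta x.
have sodd : smooth odd_eta.
  apply: smoothM => //.
  exact: (@smooth_linear R R idfun (fun=> cvg_id)).
pose base i := if (i == i0) || (i == i1) then odd_eta else eta.
have sbase i : smooth (base i) by rewrite /base; case: ifP.
have base_supp i x : 1 <= `|x| -> base i x = 0.
  by move=> x1; rewrite /base /odd_eta; case: ifP => _; rewrite eta_supp// mulr0.
pose psi i := nderiv (base i).
have psiD i k x : is_derive x (1 : R) (psi i k) (psi i k.+1 x).
  exact: is_derive_nderiv.
have psiB i k : exists M, forall x, `|psi i k x| <= M.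
  exact/nderiv_bounded/base_supp.
pose k0 : 'I_d -> nat := @no_index d.
have sum0 : (\sum_i k0 i = 0)%N by rewrite big1.
have [B1 B1P] := potential_bounded d2 psiD psiB base_supp (leq0n (\sum_i k0 i)%N).
have W2 : (2 <= \sum_i bump_index (bump_index k0 i1) i0 i)%N.
  by rewrite !sum_bump_index sum0.
have [B2 B20 B2P] := potential_lipschitz d2 psiD psiB base_supp W2.
have /choice[M MP] : forall i, exists M, 0 < M /\ forall x, `|base i x| <= M.
  move=> i; have [M MP] := psiB i 0%N; exists (`|M| + 1); split => [|x].
    by rewrite ltr_wpDl.
  by rewrite (le_trans (MP x))// (le_trans (ler_norm M))// lerDl.
have [E [E0 EP]] : exists E, 0 < E /\ forall x, `|eta x| <= E.
  have [E EP] := nderiv_bounded 0 seta eta_supp.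
  exists (`|E| + 1); split => [|x]; first by rewrite ltr_wpDl.
  by rewrite (le_trans (EP x))// (le_trans (ler_norm E))// lerDl.
have Z0 := gauss_mass_gt0 R; set Z := gauss_mass R in Z0.
(* The linear bound on the profile comes from the coordinate [i0] alone, through |x_i0 eta(x_i0)| <=
   E |x|; the other factors are bounded by the constants [M i]. The last constant bounds F and is a
   Lipschitz constant for W at 0. *)
exists (profile psi), (potential psi 0 k0),
  (potential psi 2 (bump_index (bump_index k0 i1) i0)),
  (E * Z * \prod_(i | i != i0) (M i * Z)), (`|B1| + B2).
have K1 : 0 < \prod_(i | i != i0) (M i * Z).
  by apply: prodr_gt0 => i _; rewrite mulr_gt0//; case: (MP i).
split.
- split; last exact: smooth_potential.
  apply: smooth_prod => i; apply: smoothM; last exact: smooth_cst.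
  have lin : linear (fun x : 'rV[R]_d => x 0 i : R) by move=> a x y; rewrite !mxE.
  pose L0 := GRing.isLinear.Build _ _ _ _ _ lin.
  pose L : {linear 'rV[R]_d -> R} := HB.pack (fun x : 'rV[R]_d => x 0 i : R) L0.
  apply: (@smooth_comp_linear _ _ _ L (base i)) => // x.
  exact: coord_continuous.
- split; first by rewrite !mulr_gt0.
  move=> x; rewrite /profile (bigD1 i0)//= normrM -/Z.
  rewrite {1}/base eqxx /= /odd_eta !normrM (gtr0_norm Z0).
  rewrite [leRHS]mulrC mulrA ler_pM ?mulr_ge0 ?(ltW Z0)//.
    by rewrite mulrA ler_wpM2r ?(ltW Z0)// ler_pM// rV_norm_coord.
  rewrite normr_prod; apply: ler_prod => i _; rewrite normr_ge0 normrM (gtr0_norm Z0).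
  by rewrite ler_wpM2r ?(ltW Z0)//; case: (MP i).
- move=> x x1; have [i xi] := rV_norm_ge_coord ltr01 x1.
  by rewrite /profile (bigD1 i)//= base_supp// !mul0r.
- split; first by rewrite ltr_wpDl.
  split.
  + by move=> p; rewrite (le_trans (B1P p))// (le_trans (ler_norm B1))// lerDl ltW.
  + move=> p; have := B2P p 0; rewrite addr0 => /le_trans; apply.
    by rewrite ler_wpM2r// lerDr.
  (* The inner derivative is along [i1], hence the lemma is used with [i0] and [i1] exchanged. *)
  + apply: mixed_potential_gt0 => //.
    * by rewrite eq_sym.
    * by rewrite /psi /base !eqxx orbT.
    * rewrite /psi /nderiv /= /base eqxx orbT.
      rewrite deriveM_smooth//; last exact: (@smooth_linear R R idfun (fun=> cvg_id)).
      by rewrite mul0r add0r derive_id mul1r gt_eqF// eta_pos// normr0.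
    * by move=> i x ii1 ii0; rewrite /psi /nderiv /= /base (negbTE ii0) (negbTE ii1).
    * move=> i ii1 ii0; rewrite /psi /nderiv /= /base (negbTE ii0) (negbTE ii1).
      by rewrite eta_pos// normr0.
- split=> p; last by rewrite derive2_potential_v.
  under eq_bigr do rewrite derive_potential_x//.
  rewrite potential_equation//; congr (_ + _).
  by apply: eq_bigr => i _; rewrite derive2_potential_v.
Qed.

(** * Lebesgue measure on row vectors *)

(** Second countability by sets taken from [M]. With [M] the measurable sets it links the topology
    of row vectors and products to sigma-algebras generated by coordinates, so that continuous
    functions become measurable. *)
Definition countable_base (T : topologicalType) (M : set (set T)) :=
  exists (I : countType) (U : I -> set T), (forall i, M (U i)) /\
    forall x A, nbhs x A -> exists i, U i x /\ U i `<=` A.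

Lemma countable_base_setX (T1 T2 : topologicalType) M1 M2 (M : set (set (T1 * T2))) :
  (forall A B, M1 A -> M2 B -> M (A `*` B)) ->
  countable_base M1 -> countable_base M2 -> countable_base M.
Proof.
move=> MX [I [U [MU HU]]] [J [V [MV HV]]].
exists (I * J)%type, (fun ij => U ij.1 `*` V ij.2); split.
  by move=> ij; exact: MX.
move=> [x y] A [[P Q] /= [xP yQ] PQA].
have [i [Ux UP]] := HU _ _ xP; have [j [Vy VQ]] := HV _ _ yQ.
exists (i, j); split=> //= -[a b] [/= aU bV]; apply: PQA.
by split; [exact: UP|exact: VQ].
Qed.

(** An open set is the countable union of the basic sets it contains. The map [e] is the identity in
    all uses; it lets one carrier be seen as a topological space and as a measurable one. *)
Lemma countable_base_open_measurable d (T : measurableType d) (S : topologicalType)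
    (e : S -> T) :
  countable_base (fun A => measurable (e @` A)) ->
  forall A, open A -> measurable (e @` A).
Proof.
move=> [I [U [MU HU]]] A oA.
have -> : e @` A = \bigcup_(i in [set i | U i `<=` A]) e @` U i.
  apply/seteqP; split=> [_ [x Ax <-]|_ [i /= UA [x Ux <-]]].
    have [i [Ux UA]] := HU x A (open_nbhs_nbhs (conj oA Ax)).
    by exists i => //; exists x.
  by exists x => //; exact: UA.
rewrite bigcup_mkcond; apply: countable_bigcupT_measurable => // i.
by case: ifP.
Qed.

Lemma open_preimage_measurable d (T : measurableType d) (R : realType) (f : T -> R)
    (O : set (set T)) :
  (forall A, O A -> measurable A) -> (forall B : set R, open B -> O (f @^-1` B)) ->
  measurable_fun setT f.
Proof.
move=> OM fO; apply: (measurability _ (RGenOpens.measurableE R)).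
move=> _ [_ [a [b ->] <-]]; rewrite setTI; apply/OM/fO.
exact: interval_open.
Qed.

Section rV_base.
Variables (R : realType) (n : nat).

Lemma countable_base_R : @countable_base R (@measurable _ (measurableTypeR R)).
Proof.
exists (rat * rat)%type, (fun q => `]ratr q.1, ratr q.2[%classic); split.
  by move=> q; exact: measurable_itv.
move=> x A /nbhs_ballP[e /= e0 eA].
have /rat_in_itvoo[q1] : x - e < x by rewrite ltrBlDr ltrDl.
have /rat_in_itvoo[q2] : x < x + e by rewrite ltrDl.
rewrite !in_itv /= => /andP[q2x q2e] /andP[q1e q1x].
exists (q1, q2); split; first by rewrite /= in_itv/= q1x q2x.
move=> y; rewrite /= in_itv/= => /andP[y1 y2]; apply: eA; rewrite /ball /=.
by rewrite ltr_distlC (lt_trans q1e)//= (lt_trans y2).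
Qed.

Lemma countable_base_rV : @countable_base 'rV[R]_n (@measurable _ 'rV[R]_n).
Proof.
have mc i : measurable_fun setT (fun x : 'rV[R]_n => x 0 i : measurableTypeR R).
  have /measurable_fun_matrixP H := @measurable_id _ 'rV[R]_n setT.
  exact: H.
exists 'rV[rat * rat]_n,
  (fun q : 'rV[rat * rat]_n => \big[setI/setT]_i [set x : 'rV[R]_n | `]ratr (q 0 i).1, ratr (q 0 i).2[%classic (x 0 i)]).
have UE (q : 'rV[rat * rat]_n) (x : 'rV[R]_n) :
    (\big[setI/setT]_i [set x : 'rV[R]_n | `]ratr (q 0 i).1, ratr (q 0 i).2[%classic (x 0 i)]) x <->
    forall i, ratr (q 0 i).1 < x 0 i < ratr (q 0 i).2.
  rewrite -bigcap_seq/=; split.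
    by move=> H i; have := H i (mem_index_enum i); rewrite /= in_itv.
  by move=> H i _; rewrite /= in_itv/=; exact: H.
split.
  move=> q; apply: bigsetI_measurable => i _.
  by rewrite -[X in measurable X]setTI; apply: (mc i) => //; exact: measurable_itv.
move=> x A /nbhs_ballP[e /= e0 eA].
have /choice[q qP] : forall i, exists q : rat * rat,
    [/\ x 0 i - e < ratr q.1, ratr q.1 < x 0 i, x 0 i < ratr q.2 & ratr q.2 < x 0 i + e].
  move=> i.
  have /rat_in_itvoo[q1] : x 0 i - e < x 0 i by rewrite ltrBlDr ltrDl.
  have /rat_in_itvoo[q2] : x 0 i < x 0 i + e by rewrite ltrDl.
  rewrite !in_itv /= => /andP[q2x q2e] /andP[q1e q1x].
  by exists (q1, q2).
exists (\row_i q i); split.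
  by apply/UE => i; rewrite mxE; have [_ -> ->] := qP i.
move=> y /UE Hy; apply: eA; split => // i j; rewrite (ord1 i).
have := Hy j; rewrite mxE => /andP[y1 y2]; have [q1 _ _ q2] := qP j.
by rewrite /ball /= ltr_distlC (lt_trans q1)//= (lt_trans y2).
Qed.

End rV_base.

Section continuous_measurable.
Variables (R : realType) (n : nat).
Local Notation phase := ('rV[R]_n * 'rV[R]_n)%type.
Local Notation event := (R * phase)%type.

Lemma continuous_measurable_rV (f : 'rV[R]_n -> R) :
  continuous f -> measurable_fun setT f.
Proof.
move=> /continuousP cf; apply: (@open_preimage_measurable _ 'rV[R]_n _ _ (@open 'rV[R]_n)) => //.
move=> A /(@countable_base_open_measurable _ 'rV[R]_n _ id _ A); rewrite image_id; apply.
by have := countable_base_rV R n; under eq_fun do rewrite image_id.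
Qed.

Lemma countable_base_phase : @countable_base phase (@measurable _ phase).
Proof.
apply: countable_base_setX (countable_base_rV R n) (countable_base_rV R n).
by move=> A B; exact: measurableX.
Qed.

Lemma continuous_measurable_phase (f : phase -> R) :
  continuous f -> measurable_fun setT f.
Proof.
move=> /continuousP cf; apply: (@open_preimage_measurable _ phase _ _ (@open phase)) => //.
move=> A /(@countable_base_open_measurable _ phase _ id _ A); rewrite image_id; apply.
by have := countable_base_phase; under eq_fun do rewrite image_id.
Qed.

Lemma continuous_measurable_event (f : event -> R) :
  continuous f -> @measurable_fun _ _ (measurableTypeR R * phase)%type R setT f.
Proof.
move=> /continuousP cf.
apply: (@open_preimage_measurable _ (measurableTypeR R * phase)%type _ _ (@open event)) => //.
move=> A /(@countable_base_open_measurable _ (measurableTypeR R * phase)%type _ id _ A).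
rewrite image_id; apply.
have : @countable_base event (@measurable _ (measurableTypeR R * phase)%type).
  apply: countable_base_setX (countable_base_R R) countable_base_phase.
  by move=> A' B; exact: measurableX.
by under eq_fun do rewrite image_id.
Qed.

End continuous_measurable.

(** * Translation invariance *)

Section translation_invariance.
Variable R : realType.

Definition preserves d (T : measurableType d) (mu : set T -> \bar R) (tau : T -> T) :=
  measurable_fun setT tau /\ forall A, measurable A -> mu (tau @^-1` A) = mu A.

(** The pushforward agrees with the product measure on rectangles, and the product measure is
    determined by them. *)
Lemma preserves_prod d1 d2 (T1 : measurableType d1) (T2 : measurableType d2)
    (m1 : {sigma_finite_measure set T1 -> \bar R})
    (m2 : {sigma_finite_measure set T2 -> \bar R}) tau1 tau2 :
  preserves m1 tau1 -> preserves m2 tau2 ->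
  preserves (sigma_prod m1 m2) (fun p => (tau1 p.1, tau2 p.2)).
Proof.
move=> [mt1 p1] [mt2 p2].
have mt : measurable_fun setT (fun p : T1 * T2 => (tau1 p.1, tau2 p.2)).
  by apply: measurable_fun_pair; exact: measurableT_comp.
split=> // A mA.
pose nu := measure_function_pushforward__canonical__measure_function_Measure
  (sigma_prod m1 m2) mt.
rewrite -[LHS]/(nu A); symmetry; apply: product_measure_unique mA => A1 A2 mA1 mA2.
rewrite -[LHS]/(sigma_prod m1 m2 ((tau1 @^-1` A1) `*` (tau2 @^-1` A2))).
rewrite [LHS]product_measure1E.
- by congr (_ * _)%E; [exact: p1|exact: p2].
- by rewrite -[X in measurable X]setTI; exact: mt1.
- by rewrite -[X in measurable X]setTI; exact: mt2.
Qed.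

Lemma preserves_lebesgue (s : R) :
  preserves (@lebesgue_measure R) (fun y : measurableTypeR R => s + y).
Proof.
split; first exact: measurable_funD.
move=> A mA; rewrite -[RHS](lebesgue_measure_shift s mA).
by congr lebesgue_measure; apply/seteqP; split=> y /=; rewrite addrC.
Qed.

(** Under [cons_rV] a translation splits into one of the first coordinate and one of the remaining
    row, which allows induction on the dimension. *)
Lemma preserves_rV n (u : 'rV[R]_n) : preserves (lebesgue_rV R n) (fun y => u + y).
Proof.
elim: n u => [|n IH] u.
  have -> : (fun y => u + y) = id by apply/funext => y; apply/rowP; case.
  by split; first exact: measurable_id.
have mtau : measurable_fun setT (fun y : 'rV[R]_n.+1 => u + y).
  apply/measurable_fun_matrixP => i j.
  apply: (eq_measurable_fun (fun y : 'rV[R]_n.+1 => u i j + y i j)).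
    by move=> y _; rewrite mxE.
  apply: measurable_funD => //.
  have /measurable_fun_matrixP := @measurable_id _ 'rV[R]_n.+1 setT; exact.
split=> // A mA.
have [mt pt] := preserves_prod (preserves_lebesgue (u 0 0)) (IH (\row_j u 0 (lift ord0 j))).
rewrite -[LHS]/(sigma_prod (@lebesgue_measure R) (lebesgue_rV R n)
  (@cons_rV R n @^-1` ((fun y => u + y) @^-1` A))).
rewrite -[RHS]/(sigma_prod (@lebesgue_measure R) (lebesgue_rV R n) (@cons_rV R n @^-1` A)).
rewrite -[RHS]pt; last first.
  by rewrite -[X in measurable X]setTI; exact: measurable_cons_rV.
have E : (fun y => u + y) \o @cons_rV R n = @cons_rV R n \o
    (fun p => (u 0 0 + p.1, (\row_j u 0 (lift ord0 j)) + p.2)).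
  apply/funext => p; apply/rowP => j; rewrite /= mxE /cons_rV.
  have [k ->|k ->] := split_ordP (j : 'I_(1 + n)).
    rewrite !(@row_mxEl _ 1 1 n) !mxE (ord1 k) !eqxx; congr (u 0 _ + _).
    exact: val_inj.
  rewrite !(@row_mxEr _ 1 1 n) !mxE; congr (u 0 _ + _).
  exact: val_inj.
by congr (sigma_prod _ _ _); rewrite -[LHS]/(((fun y => u + y) \o @cons_rV R n) @^-1` A) E.
Qed.

End translation_invariance.

(** * Test functions *)

Section test_functions.
Variables (R : realType) (V : normedModType R).
Implicit Types (f phi : V -> R) (u : V).

Lemma test_function_smooth phi : test_function phi -> smooth phi.
Proof. by case. Qed.

Lemma test_function_sub phi f : test_function phi -> smooth f ->
  (forall x, f x != 0 -> closure [set x | phi x != 0] x) -> test_function f.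
Proof.
move=> [sphi cphi] sf sub; split=> //.
apply: (subclosed_compact (@closed_closure _ _) cphi).
rewrite closureE => x; apply; split; first exact: closed_closure.
by move=> y /= /sub.
Qed.

Lemma test_function_mull f phi : smooth f -> test_function phi ->
  test_function (fun x => f x * phi x).
Proof.
move=> sf tphi; apply: (test_function_sub tphi).
  by apply: smoothM => //; exact: test_function_smooth.
by move=> x; rewrite mulf_eq0 negb_or => /andP[_ px]; exact: subset_closure.
Qed.

Lemma derive_outside_closed (A : set V) phi u x : closed A ->
  (forall y, ~ A y -> phi y = 0) -> ~ A x -> 'D_u phi x = 0.
Proof.
move=> cA phi0 nAx; rewrite -[RHS](derive_cst (0 : R) x u).
apply: near_eq_derive; have : nbhs x (~` A).
  by apply: open_nbhs_nbhs; split => //; exact: closed_openC.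
by apply: filterS => y ny; rewrite phi0.
Qed.

Lemma test_function_derive phi u : test_function phi ->
  test_function (fun x => 'D_u phi x).
Proof.
move=> tphi; apply: (test_function_sub tphi).
  exact/smooth_derive/test_function_smooth.
move=> x Dx; apply: contrapT => nx; move/eqP: Dx; apply.
apply: (derive_outside_closed _ (@closed_closure _ _) _ nx) => y ny.
by apply: contrapT => /eqP py; apply: ny; exact: subset_closure.
Qed.

Lemma compact_support_sub (A : set V) f : compact A ->
  (forall y, ~ A y -> f y = 0) -> compact_support f.
Proof.
move=> cA f0.
have clA : closed A by apply: compact_closed cA; exact: norm_hausdorff.
apply: (subclosed_compact (@closed_closure _ _) cA).
rewrite closureE => x; apply; split => // y /= fy.
by apply: contrapT => /f0 fy0; rewrite fy0 eqxx in fy.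
Qed.

Lemma test_function_compact (A : set V) phi : smooth phi -> compact A ->
  (forall y, ~ A y -> phi y = 0) -> test_function phi.
Proof. by move=> sphi cA phi0; split=> //; exact: compact_support_sub phi0. Qed.

Lemma test_functionB f g : test_function f -> test_function g ->
  test_function (fun x => f x - g x).
Proof.
move=> [sf cf] [sg cg]; split; first exact: smoothB.
have c : compact (closure [set x | f x != 0] `|` closure [set x | g x != 0]).
  exact: compactU.
apply: (subclosed_compact (@closed_closure _ _) c).
rewrite closureE => x; apply; split.
  by apply: closedU; exact: closed_closure.
move=> y /= fg; have [fy|fy] := eqVneq (f y) 0; last by left; exact: subset_closure.
right; apply: subset_closure => /=; apply: contra_neq fg => gy.
by rewrite fy gy subrr.
Qed.

Lemma test_function_bounded phi : test_function phi ->
  exists2 B, 0 < B & forall x, `|phi x| <= B.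
Proof.
move=> [sphi]; rewrite /compact_support; set K := closure _ => cphi.
have [K0|K0] := pselect (K !=set0); last first.
  exists 1 => // x; have [->|px] := eqVneq (phi x) 0; first by rewrite normr0.
  by exfalso; apply: K0; exists x; exact: subset_closure.
have c : {within K, continuous (fun x => `|phi x|)}.
  apply: continuous_subspaceT => x; apply: cvg_norm.
  exact: smooth_continuous.
have [m _ mP] := compact_EVT_max K0 cphi c.
exists (`|phi m| + 1); first by rewrite ltr_wpDl.
move=> x; have [->|px] := eqVneq (phi x) 0; first by rewrite normr0 addr_ge0.
rewrite (le_trans (mP x _)) ?lerDl//.
by rewrite inE; exact: subset_closure.
Qed.

Lemma test_function_support phi : test_function phi ->
  exists M, forall x, M < `|x| -> phi x = 0.
Proof.
move=> [_ /compact_bounded[M [_ MP]]]; exists (M + 1) => x xM.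
apply: contrapT => /eqP px.
have cx : closure [set x | phi x != 0] x by exact: subset_closure.
have := MP (M + 1); rewrite ltrDl ltr01 => /(_ isT x cx).
by rewrite /= leNgt xM.
Qed.

End test_functions.

(** A common interface for phases and events, so that integration against test functions is treated
    once. In both instances [e] is the identity and [tau] the translation. *)
Record translation_measure (R : realType) (V : normedModType R) d
    (T : measurableType d) (mu : set T -> \bar R) (e : T -> V)
    (tau : V -> T -> T) : Prop := TranslationMeasure {
  continuous_is_measurable : forall f : V -> R, continuous f ->
    measurable_fun setT (f \o e);
  norm_ball_finite : forall M : R, (mu [set y | (`|e y| <= M)%R] < +oo)%E;
  translation_preserves : forall u, preserves mu (tau u);
  translationE : forall u y, e (tau u y) = u + e y;
  translation0 : forall y, tau 0 y = y }.

Section test_integrals.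
Variables (R : realType) (V : normedModType R) (d : measure_display).
Variables (T : measurableType d) (mu : {measure set T -> \bar R}).
Variables (e : T -> V) (tau : V -> T -> T).
Hypothesis tm : translation_measure mu e tau.
Implicit Types (phi f : V -> R) (u : V).

Lemma norm_ball_measurable (M : R) : measurable [set y | `|e y| <= M].
Proof.
have := continuous_is_measurable tm (@norm_continuous _ V) measurableT.
move=> /(_ `]-oo, M]%classic (measurable_itv _)); rewrite setTI.
by rewrite (_ : _ @^-1` _ = [set y | `|e y| <= M])//; apply/seteqP; split=> y /=;
  rewrite in_itv.
Qed.

Lemma integrable_norm_ball (C M : R) :
  mu.-integrable setT (EFin \o (fun y => C * \1_[set y | `|e y| <= M] y)).
Proof.
have mM := norm_ball_measurable M.
apply: integrable_cmul => //; apply/integrableP; split.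
  by apply/measurable_EFinP; exact: measurable_indic.
rewrite (eq_integral (fun y => (\1_[set y | `|e y| <= M] y)%:E)); last first.
  by move=> y _; rewrite /= ger0_norm.
by rewrite integral_indic// setIT; exact: (norm_ball_finite tm).
Qed.

Lemma bounded_mul_test_integrable (f : T -> R) (B : R) phi :
  measurable_fun setT f -> (forall y, `|f y| <= B) -> test_function phi ->
  mu.-integrable setT (EFin \o (fun y => f y * phi (e y))).
Proof.
move=> mf fB tphi.
have [C C0 CP] := test_function_bounded tphi; have [M MP] := test_function_support tphi.
apply: dominated_integrable (integrable_norm_ball (B * C) M) => //.
  apply: measurable_funM => //; apply: (continuous_is_measurable tm).
  exact/smooth_continuous/test_function_smooth.
move=> y _; rewrite indicE normrM; have [yM|yM] := boolP (y \in _).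
  by rewrite mulr1 ler_pM.
rewrite MP ?normr0 ?mulr0// ltNge; apply: contra yM => yM; exact: mem_set.
Qed.

Lemma test_integrable phi : test_function phi ->
  mu.-integrable setT (EFin \o (phi \o e)).
Proof.
move=> tphi.
have := bounded_mul_test_integrable (measurable_cst (1 : R)) (fun=> lexx `|1|) tphi.
by rewrite (_ : (fun y => _) = phi \o e)//; apply/funext => y; rewrite mul1r.
Qed.

(** Invariance under the flow of translations along [u] takes the place of the divergence theorem.
    For |s| < 1 the shifted function is supported in a ball enlarged by |u|, which supplies the
    dominating function. *)
Lemma integral_derive_test phi u : test_function phi ->
  \int[mu]_y 'D_u phi (e y) = 0.
Proof.
move=> tphi; have tD := test_function_derive u tphi.
have [C C0 CP] := test_function_bounded tD; have [M MP] := test_function_support tD.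
apply: (@integral_flow_derivative _ T R mu (fun s => tau (s *: u)) (phi \o e)
  (fun y => 'D_u phi (e y))
  (fun y => C * \1_[set y | `|e y| <= M + `|u|] y)).
- by move=> s; case: (translation_preserves tm (s *: u)).
- by move=> s A mA; case: (translation_preserves tm (s *: u)) => _; exact.
- by move=> y; rewrite scale0r (translation0 tm).
- exact: test_integrable.
- move=> y s; rewrite (translationE tm).
  rewrite (_ : (fun s => _) = fun s : R => phi (s *: u + e y)); last first.
    by apply/funext => t; rewrite /= (translationE tm).
  apply: (is_derive_line phi (e y) u s _).1.
  exact/smooth_is_derive/test_function_smooth.
- move=> y s s1; rewrite (translationE tm) indicE.
  have [yM|yM] := boolP (y \in _); first by rewrite mulr1.
  rewrite MP ?normr0 ?mulr0// ltNge; apply: contra yM => yM; apply: mem_set.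
  rewrite /= -[e y](addKr (s *: u)) addrC (le_trans (ler_normD _ _))// lerD//.
  by rewrite normrN normrZ ler_piMl// ltW.
- exact: integrable_norm_ball.
Qed.

End test_integrals.

Section cubes.
Variable R : realType.

Definition cube n (a : R) : set 'rV[R]_n := [set x | `|x| <= a].

Arguments cube : clear implicits.

Lemma measurable_cube n a : measurable (cube n a).
Proof.
have := continuous_measurable_rV (@norm_continuous _ 'rV[R]_n) measurableT.
move=> /(_ `]-oo, a]%classic (measurable_itv _)); rewrite setTI.
by rewrite (_ : _ @^-1` _ = cube n a)//; apply/seteqP; split=> y /=; rewrite in_itv.
Qed.

Lemma cube_cons n a : 0 <= a ->
  @cons_rV R n @^-1` (cube n.+1 a) = `[- a, a]%classic `*` cube n a.
Proof.
move=> a0; apply/seteqP; split=> -[t x] /=; rewrite /cube /= in_itv/= -ler_norml.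
  move=> tx; split.
    have := le_trans (rV_norm_coord _ 0) tx; rewrite /cons_rV.
    have -> : (0 : 'I_n.+1) = lshift n (0 : 'I_1) by exact: val_inj.
    by rewrite (@row_mxEl _ 1 1 n) mxE eqxx.
  apply: rV_norm_le => // i; have := le_trans (rV_norm_coord _ (rshift 1 i)) tx.
  by rewrite /cons_rV (@row_mxEr _ 1 1 n).
move=> [ta xa]; apply: rV_norm_le => // i; rewrite /cons_rV.
have [k ->|k ->] := split_ordP (i : 'I_(1 + n)).
  by rewrite (@row_mxEl _ 1 1 n) mxE (ord1 k) eqxx.
by rewrite (@row_mxEr _ 1 1 n) (le_trans (rV_norm_coord _ _)).
Qed.

Lemma lebesgue_cube n a : 0 <= a -> lebesgue_rV R n (cube n a) = ((2 * a) ^+ n)%:E.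
Proof.
move=> a0; elim: n => [|n IH].
  rewrite /= /dirac/= indicE mem_set// /cube /=.
  by apply: rV_norm_le => // -[].
rewrite -[LHS]/(sigma_prod (@lebesgue_measure R) (lebesgue_rV R n)
  (@cons_rV R n @^-1` (cube n.+1 a))) cube_cons//.
rewrite /sigma_prod product_measure1E; [|exact: measurable_itv|exact: measurable_cube].
pose I := `[- a, a]%classic : set R.
transitivity (lebesgue_measure I * lebesgue_rV R n (cube n a))%E; first by [].
rewrite /I IH lebesgue_measure_itv/= lte_fin exprS.
case: ifPn => [_|]; first by rewrite -EFinD -EFinM opprK; congr (_ * _)%:E; ring.
rewrite -leNgt => aa; have -> : a = 0 by lra.
by rewrite mulr0 mul0r mul0e.
Qed.

Definition box n (a b : R) : set ('rV[R]_n * 'rV[R]_n) := cube n a `*` cube n b.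

Arguments box : clear implicits.

Lemma measurable_box n a b : measurable (box n a b).
Proof. by apply: measurableX; exact: measurable_cube. Qed.

Lemma lebesgue_box n a b : 0 <= a -> 0 <= b ->
  lebesgue_xv R n (box n a b) = ((2 * a) ^+ n * (2 * b) ^+ n)%:E.
Proof.
move=> a0 b0; rewrite EFinM -!lebesgue_cube//.
by apply: product_measure1E; exact: measurable_cube.
Qed.

Lemma phase_translation_measure n :
  translation_measure (V := ('rV[R]_n * 'rV[R]_n)%type) (lebesgue_xv R n) id (fun u y => u + y).
Proof.
split.
- by move=> f; exact: continuous_measurable_phase.
- move=> M; apply: (@le_lt_trans _ _ (lebesgue_xv R n (box n `|M| `|M|))).
    apply: le_measure; rewrite ?inE.
    + have := continuous_measurable_phase (@norm_continuous R ('rV[R]_n * 'rV[R]_n)%type) measurableT.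
      move=> /(_ `]-oo, M]%classic (measurable_itv _)); rewrite setTI => H.
      suff -> : [set y : 'rV[R]_n * 'rV[R]_n | `|y| <= M] =
          Num.norm @^-1` `]-oo, M]%classic by [].
      by apply/seteqP; split=> y /=; rewrite in_itv.
    + exact: measurable_box.
    + move=> p /= pM; have pM' : `|p| <= `|M| by rewrite (le_trans pM) ?ler_norm.
      by move: pM'; rewrite prod_normE ge_max => /andP[].
  by rewrite lebesgue_box// ltry.
- move=> u; exact: (preserves_prod (preserves_rV u.1) (preserves_rV u.2)).
- by [].
- by move=> y; rewrite add0r.
Qed.

Lemma event_translation_measure n :
  translation_measure (V := (R * ('rV[R]_n * 'rV[R]_n))%type)
    (lebesgue_txv R n) id (fun u y => u + y).
Proof.
split.
- by move=> f; exact: continuous_measurable_event.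
- move=> M; apply: (@le_lt_trans _ _ (lebesgue_txv R n (`[- `|M|, `|M|]%classic `*` box n `|M| `|M|))).
    apply: le_measure; rewrite ?inE.
    + have := continuous_measurable_event
        (@norm_continuous R (R * ('rV[R]_n * 'rV[R]_n))%type) measurableT.
      move=> /(_ `]-oo, M]%classic (measurable_itv _)); rewrite setTI => H.
      suff -> : [set y : R * ('rV[R]_n * 'rV[R]_n) | `|y| <= M] =
          Num.norm @^-1` `]-oo, M]%classic by [].
      by apply/seteqP; split=> y /=; rewrite in_itv.
    + by apply: measurableX; [exact: measurable_itv|exact: measurable_box].
    + move=> p /= pM; have pM' : `|p| <= `|M| by rewrite (le_trans pM) ?ler_norm.
      move: pM'; rewrite prod_normE ge_max prod_normE ge_max => /and3P[? ? ?].
      by split => //=; rewrite in_itv/= -ler_norml.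
  rewrite [ltLHS]product_measure1E; [|exact: measurable_itv|exact: measurable_box].
  pose I := `[- `|M|, `|M|]%classic : set R.
  rewrite -[ltLHS]/(lebesgue_measure I * lebesgue_xv R n (box n `|M| `|M|))%E.
  rewrite lebesgue_box// /I lebesgue_measure_itv/=; case: ifP => _; last by rewrite mul0e ltry.
  by rewrite -EFinD -EFinM ltry.
- move=> u; exact: (preserves_prod (preserves_lebesgue u.1)
    (preserves_prod (preserves_rV u.2.1) (preserves_rV u.2.2))).
- by [].
- by move=> y; rewrite add0r.
Qed.

End cubes.

Arguments cube : clear implicits.
Arguments box : clear implicits.

(** * Superposition of dilations *)

Section uniform_limits.
Variables (R : realType) (T : Type) (h : nat -> T -> R) (eps : nat -> R).
Hypothesis heps : forall n m x, (n <= m)%N -> `|h m x - h n x| <= eps n.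

(** The witness is the pointwise supremum of h n - eps n. The Cauchy bound, read in both orders of
    the indices, places each of these below every h m + eps m. *)
Lemma exists_uniform_limit : exists H : T -> R, forall n x, `|H x - h n x| <= eps n.
Proof.
have eps0 n (x : T) : 0 <= eps n by apply: le_trans (normr_ge0 _) (heps x (leqnn n)).
have cross n m x : h n x - eps n <= h m x + eps m.
  have e1 := eps0 n x; have e2 := eps0 m x.
  have [nm|mn] := leqP n m.
    by have := heps x nm; rewrite ler_distl => /andP[]; lra.
  by have := heps x (ltnW mn); rewrite ler_distl => /andP[]; lra.
exists (fun x => sup (range (fun n => h n x - eps n))) => n x.
have ub m : ubound (range (fun n => h n x - eps n)) (h m x + eps m).
  by move=> _ [k _ <-]; exact: cross.
rewrite ler_distl; apply/andP; split.
  by apply: sup_upper_bound; [split; [exists (h 0%N x - eps 0%N); exists 0%N|exists (h 0%N x + eps 0%N)]|exists n].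
by apply: sup_le_ub; [exists (h 0%N x - eps 0%N); exists 0%N|exact: ub].
Qed.

End uniform_limits.

Lemma uniform_limit_continuous (R : realType) (T : topologicalType)
    (h : nat -> T -> R) (H : T -> R) (eps : nat -> R) :
  (forall n x, `|H x - h n x| <= eps n) -> (forall n, continuous (h n)) ->
  (forall e, 0 < e -> exists n, eps n < e) -> continuous H.
Proof.
move=> Hh ch eps0 x; apply/cvgrPdist_lt => e e0.
have [n ne] := eps0 (e / 3) (divr_gt0 e0 (ltr0n _ 3)).
have /cvgrPdist_lt/(_ (e / 3) (divr_gt0 e0 (ltr0n _ 3))) := ch n x.
apply: filterS => y hxy.
have H1 := Hh n x; have H2 := Hh n y.
rewrite (_ : H x - H y = (H x - h n x) + (h n x - h n y) - (H y - h n y)); last by ring.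
apply: (le_lt_trans (ler_normB _ _)).
have := ler_normD (H x - h n x) (h n x - h n y); lra.
Qed.

Section dyadic_sums.
Variable R : realType.
Implicit Types s : R.

(** The terms stop at the last k with 8^k s < 1. Shifting the index replaces s by 8 s, and the
    right-hand side is shaped to survive this: s + (2 - 8 s) <= 2 - s, while s <= 2 - s when 8 s >=
    1. *)
Lemma capped_geometric_sum (n : nat) s : 0 <= s ->
  \sum_(0 <= k < n) (if 8 ^+ k * s < 1 then 8 ^+ k * s else 0) <=
  (if s < 1 then 2 - s else 0).
Proof.
elim: n s => [|n IH] s s0; first by rewrite big_nil; case: ifP => // ?; lra.
rewrite big_nat_recl// expr0 mul1r.
under eq_bigr do rewrite exprSr -mulrA.
have := IH (8 * s) (mulr_ge0 (ler0n _ 8) s0).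
by case: ifP => [?|/negbT]; case: ifP => [?|/negbT]; rewrite -?leNgt; lra.
Qed.

Lemma sum_harmonic_unbounded (A : R) :
  exists n, A <= \sum_(0 <= k < n) k.+1%:R^-1.
Proof.
apply: contrapT => H; apply: (@dvg_harmonic R); apply: nondecreasing_is_cvgn.
  by apply: nondecreasing_series => n _ _; exact: harmonic_ge0.
exists A => _ [n _ <-]; rewrite leNgt; apply/negP => An; apply: H.
by exists n; exact: ltW.
Qed.

Lemma sum_pow2_le (n : nat) :
  \sum_(0 <= k < n) (2 ^+ k / 2 ^+ n : R) <= 1.
Proof.
elim: n => [|n IH]; first by rewrite big_nil ler01.
rewrite big_nat_recr//= exprS invfM.
have -> : \sum_(0 <= k < n) (2 ^+ k * (2^-1 / 2 ^+ n)) =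
    2^-1 * \sum_(0 <= k < n) (2 ^+ k / 2 ^+ n : R).
  by rewrite mulr_sumr; apply: eq_bigr => k _; rewrite mulrCA.
rewrite mulrCA divff ?expf_neq0// mulr1; lra.
Qed.

Lemma sum_inv4_le (n m : nat) :
  \sum_(n <= k < m) (4^-1 ^+ k : R) <= 2 * 4^-1 ^+ n.
Proof.
have p4 k : (0 : R) <= 4^-1 ^+ k by rewrite exprn_ge0.
have [nm|mn] := leqP n m; last by rewrite big_geq ?mulr_ge0// ltnW.
suff : \sum_(n <= k < m) (4^-1 ^+ k : R) <= 2 * 4^-1 ^+ n - 2 * 4^-1 ^+ m.
  by have := p4 m; lra.
elim: m nm => [|m IH] nm.
  have -> : n = 0%N by lia.
  by rewrite big_nil; lra.
have [->|nm'] := eqVneq n m.+1; first by rewrite big_geq//; lra.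
have {}nm : (n <= m)%N by lia.
rewrite big_nat_recr//=; have := IH nm; rewrite exprS; have := p4 m.
lra.
Qed.

End dyadic_sums.

Section dilations.
Variables (R : realType) (d : nat) (a b : R).
Local Notation phase := ('rV[R]_d * 'rV[R]_d)%type.

Definition dilation (p : phase) : phase := (a *: p.1, b *: p.2).

Lemma dilation_is_linear : linear dilation.
Proof.
by move=> c p q; apply: injective_projections; rewrite /= scalerDr !scalerA mulrC.
Qed.

HB.instance Definition _ := GRing.isLinear.Build R phase phase _ dilation dilation_is_linear.

Lemma continuous_dilation : continuous dilation.
Proof.
move=> p; apply: (@cvg_pair _ _ _ _ (nbhs (a *: p.1)) (nbhs (b *: p.2))).
  by apply: cvgZl_tmp; exact: cvg_fst.
by apply: cvgZl_tmp; exact: cvg_snd.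
Qed.

Lemma derive_dilation_x (f : phase -> R) (u : 'rV[R]_d) p : smooth f ->
  'D_(u, 0 : 'rV[R]_d) (f \o dilation) p = a * 'D_(u, 0 : 'rV[R]_d) f (dilation p).
Proof.
move=> sf; transitivity ('D_(a *: (u, 0 : 'rV[R]_d) + 0) f (dilation p)).
  rewrite derive_comp_linear; congr (derive _ _ _).
  by apply: injective_projections; rewrite /= addr0 ?scaler0.
rewrite derive_lin_dir; last exact: smooth_differentiable.
by rewrite derive0 addr0.
Qed.

Lemma derive_dilation_v (f : phase -> R) (u : 'rV[R]_d) p : smooth f ->
  'D_(0 : 'rV[R]_d, u) (f \o dilation) p = b * 'D_(0 : 'rV[R]_d, u) f (dilation p).
Proof.
move=> sf; transitivity ('D_(b *: (0 : 'rV[R]_d, u) + 0) f (dilation p)).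
  rewrite derive_comp_linear; congr (derive _ _ _).
  by apply: injective_projections; rewrite /= addr0 ?scaler0.
rewrite derive_lin_dir; last exact: smooth_differentiable.
by rewrite derive0 addr0.
Qed.

Lemma smooth_dilation (f : phase -> R) : smooth f -> smooth (f \o dilation).
Proof. by move=> sf; apply: smooth_comp_linear => //; exact: continuous_dilation. Qed.

End dilations.

Section superposition.
Variables (R : realType) (d : nat) (i0 i1 : 'I_d).
Local Notation phase := ('rV[R]_d * 'rV[R]_d)%type.
Local Notation e_ i := (Defs.basis R i).
Local Notation "'D_x i f" := (fun p : phase => 'D_(e_ i, 0 : 'rV[R]_d) f p)
  (at level 10, i, f at next level).
Local Notation "'D_v i f" := (fun p : phase => 'D_(0 : 'rV[R]_d, e_ i) f p)
  (at level 10, i, f at next level).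

Implicit Types (p : phase) (x : 'rV[R]_d).

Variables (phi : 'rV[R]_d -> R) (F W : phase -> R) (K B : R).
Hypotheses (sphi : smooth phi) (sF : smooth F).
Hypotheses (K0 : 0 < K) (phiK : forall x, `|phi x| <= K * `|x|).
Hypothesis phi_supp : forall x, 1 <= `|x| -> phi x = 0.
Hypotheses (B0 : 0 < B) (FB : forall p, `|F p| <= B).
Hypothesis WB : forall p, `|W p - W 0| <= B * `|p|.
Hypothesis cellE : forall p : phase, \sum_i p.2 0 i * ('D_x i F) p =
  \sum_i ('D_v i ('D_v i F)) p + phi p.1.
Hypothesis cellW : forall p, ('D_v i0 ('D_v i1 F)) p = W p.

Definition forcing_sum (n : nat) (x : 'rV[R]_d) : R :=
  \sum_(0 <= k < n) k.+1%:R^-1 * phi (8 ^+ k *: x).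

Definition solution_sum (n : nat) (p : phase) : R :=
  \sum_(0 <= k < n) (k.+1%:R^-1 * 4^-1 ^+ k) * (F \o dilation (8 ^+ k) (2 ^+ k)) p.

Let dil k := @dilation R d (8 ^+ k) (2 ^+ k).

Let sFk k : smooth (F \o dil k).
Proof. exact: smooth_dilation. Qed.

Lemma smooth_solution_sum n : smooth (solution_sum n).
Proof. by apply: smooth_sum => k; apply: smoothZ; exact: sFk. Qed.

Lemma smooth_forcing_sum n : smooth (forcing_sum n).
Proof.
apply: smooth_sum => k; apply: smoothZ.
apply: (@smooth_comp_linear _ _ _ ( *:%R (8 ^+ k) : {linear 'rV[R]_d -> 'rV[R]_d})) => //.
by move=> x; exact: scaler_continuous.
Qed.

Lemma derive_x_solution_sum n i p : ('D_x i (solution_sum n)) p =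
  \sum_(0 <= k < n) (k.+1%:R^-1 * 4^-1 ^+ k) * (8 ^+ k * ('D_x i F) (dil k p)).
Proof.
rewrite /= /solution_sum derive_sum_smooth; last by move=> k; apply: smoothZ; exact: sFk.
by apply: eq_bigr => k _; rewrite deriveZ_smooth; [rewrite derive_dilation_x|exact: sFk].
Qed.

(** Two velocity derivatives produce (2^k)^2, which cancels the weight 4^-k: only the harmonic
    weights survive, and their sum diverges. *)
Lemma derive2_v_solution_sum n i j p : ('D_v i ('D_v j (solution_sum n))) p =
  \sum_(0 <= k < n) k.+1%:R^-1 * ('D_v i ('D_v j F)) (dil k p).
Proof.
have sj : smooth ('D_v j F) by exact: smooth_derive.
have Ej : 'D_v j (solution_sum n) = fun q =>
    \sum_(0 <= k < n) (k.+1%:R^-1 * 4^-1 ^+ k * 2 ^+ k) * (('D_v j F) \o dil k) q.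
  apply/funext => q; rewrite /solution_sum derive_sum_smooth; last by move=> k; apply: smoothZ; exact: sFk.
  apply: eq_bigr => k _; rewrite deriveZ_smooth; last exact: sFk.
  by rewrite derive_dilation_v// mulrA.
rewrite Ej derive_sum_smooth; last by move=> k; apply: smoothZ; exact: smooth_dilation.
apply: eq_bigr => k _; rewrite deriveZ_smooth; last exact: smooth_dilation.
rewrite derive_dilation_v// mulrA; congr (_ * _).
have h : (4^-1 : R) ^+ k * 2 ^+ k * 2 ^+ k = 1.
  by rewrite -!exprMn (_ : 4^-1 * 2 * 2 = 1) ?expr1n//; lra.
by rewrite -[RHS]mulr1 -[X in _ = _ * X]h !mulrA.
Qed.

Lemma solution_sum_equation n p : \sum_i p.2 0 i * ('D_x i (solution_sum n)) p =
  \sum_i ('D_v i ('D_v i (solution_sum n))) p + forcing_sum n p.1.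
Proof.
under eq_bigr do rewrite derive_x_solution_sum mulr_sumr.
under [X in _ = X + _]eq_bigr do rewrite derive2_v_solution_sum.
rewrite exchange_big [X in _ = X + _]exchange_big -big_split /=.
apply: eq_bigr => k _.
rewrite -mulr_sumr -mulrDr -[8 ^+ k *: p.1]/((dil k p).1) -cellE mulr_sumr.
apply: eq_bigr => i _; rewrite [(dil k p).2 0 i]mxE.
(* The position derivative yields 8^k while v is 2^-k times the dilated velocity; the remaining 4^k
   cancels the weight. *)
have -> : (8 : R) ^+ k = 4 ^+ k * 2 ^+ k by rewrite -exprMn; congr (_ ^+ _); ring.
by rewrite exprVn; field; rewrite expf_neq0// nat1r pnatr_eq0.
Qed.

Lemma mixed_derivative_solution_sum n p :
  ('D_v i0 ('D_v i1 (solution_sum n))) p = \sum_(0 <= k < n) k.+1%:R^-1 * W (dil k p).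
Proof.
apply: (etrans (derive2_v_solution_sum n i0 i1 p)).
by apply: eq_bigr => k _; rewrite cellW.
Qed.

Let ik k : (0 : R) < k.+1%:R^-1. Proof. by rewrite invr_gt0. Qed.

Lemma solution_sum_cauchy n m p : (n <= m)%N ->
  `|solution_sum m p - solution_sum n p| <= 2 * B * 4^-1 ^+ n.
Proof.
move=> nm; rewrite /solution_sum (big_cat_nat (leq0n n) nm)//= addrAC subrr add0r.
apply: (le_trans (ler_norm_sum _ _ _)).
apply: (@le_trans _ _ (\sum_(n <= k < m) B * 4^-1 ^+ k)).
  apply: ler_sum => k _; rewrite normrM mulrC ler_pM//.
  rewrite normrM -[leRHS]mul1r ler_pM//.
    by rewrite gtr0_norm// invf_le1// ler1n.
  by rewrite ger0_norm// exprn_ge0.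
rewrite -mulr_sumr -mulrA mulrCA ler_wpM2l// ?(ltW B0)// sum_inv4_le//.
Qed.

Lemma solution_sum_bounded n p : `|solution_sum n p| <= 2 * B.
Proof.
have := solution_sum_cauchy p (leq0n n).
by rewrite [solution_sum 0 _]big_nil subr0 expr0 mulr1.
Qed.

(** From index n on the harmonic weights are at most 1/(n+1). What is left is bounded uniformly in
    x: the terms with 8^k |x| >= 1 vanish and the others form a geometric sum of linear bounds, so
    at each x only scales coarser than |x| contribute. *)
Lemma forcing_sum_cauchy n m x : (n <= m)%N ->
  `|forcing_sum m x - forcing_sum n x| <= 2 * K * n.+1%:R^-1.
Proof.
move=> nm; rewrite /forcing_sum (big_cat_nat (leq0n n) nm)//= addrAC subrr add0r.
apply: (le_trans (ler_norm_sum _ _ _)).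
pose b k := if 8 ^+ k * `|x| < 1 then 8 ^+ k * `|x| else 0.
have b0 k : 0 <= b k by rewrite /b; case: ifP => // _; rewrite mulr_ge0// exprn_ge0.
apply: (@le_trans _ _ (\sum_(n <= k < m) n.+1%:R^-1 * (K * b k))).
  rewrite big_nat_cond [leRHS]big_nat_cond; apply: ler_sum => k /andP[/andP[nk _] _].
  rewrite normrM ler_pM//.
    by rewrite gtr0_norm// lef_pV2 ?posrE// ler_nat ltnS.
  have e8 : `|8 ^+ k *: x| = 8 ^+ k * `|x| by rewrite normrZ ger0_norm// exprn_ge0.
  rewrite /b; case: ifPn => [_|]; first by rewrite -e8.
  by rewrite -leNgt -e8 => /phi_supp ->; rewrite normr0 mulr0.
rewrite -mulr_sumr -mulr_sumr mulrC ler_wpM2r ?(ltW (ik n))//.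
rewrite mulrC ler_wpM2r ?(ltW K0)//.
have := capped_geometric_sum m (normr_ge0 x).
rewrite -/(b _) (big_cat_nat (leq0n n) nm)//= => H.
have S0 : 0 <= \sum_(0 <= k < n) b k by apply: sumr_ge0 => k _.
have := normr_ge0 x.
move: H; rewrite -[\sum_(n <= i < m) _]/(\sum_(n <= k < m) b k).
rewrite -[\sum_(0 <= i < n) _]/(\sum_(0 <= k < n) b k).
by case: ifP; lra.
Qed.

Lemma forcing_sum_bounded n x : `|forcing_sum n x| <= 2 * K.
Proof.
have := forcing_sum_cauchy x (leq0n n).
by rewrite [forcing_sum 0 _]big_nil subr0 invr1 mulr1.
Qed.

Lemma forcing_sum_support n x : 1 <= `|x| -> forcing_sum n x = 0.
Proof.
move=> x1; rewrite /forcing_sum big1// => k _; rewrite phi_supp ?mulr0//.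
rewrite normrZ ger0_norm ?exprn_ge0// -[leLHS]mul1r ler_pM//.
by rewrite exprn_ege1// ler1n.
Qed.

(** On this box the k-th dilated point has norm at most 2^(k-n), so the Lipschitz errors of W form a
    geometric series of total at most B, whatever n. *)
Lemma mixed_derivative_lower_bound n (p : phase) :
  `|p.1| <= 8^-1 ^+ n -> `|p.2| <= 2^-1 ^+ n ->
  W 0 * (\sum_(0 <= k < n) k.+1%:R^-1) - B <= ('D_v i0 ('D_v i1 (solution_sum n))) p.
Proof.
move=> p1 p2; rewrite [leRHS]mixed_derivative_solution_sum mulr_sumr.
suff : `|\sum_(0 <= k < n) (k.+1%:R^-1 * W (dil k p)) -
        \sum_(0 <= k < n) (W 0 * k.+1%:R^-1)| <= B.
  by rewrite ler_distl => /andP[].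
rewrite -sumrB; apply: (le_trans (ler_norm_sum _ _ _)).
apply: (@le_trans _ _ (\sum_(0 <= k < n) B * (2 ^+ k / 2 ^+ n))); last first.
  by rewrite -mulr_sumr -[leRHS]mulr1 ler_wpM2l ?(ltW B0)// sum_pow2_le.
rewrite big_nat_cond [leRHS]big_nat_cond; apply: ler_sum => k /andP[/andP[_ kn] _].
rewrite [W 0 * _]mulrC -mulrBr normrM -[leRHS]mul1r ler_pM//.
  by rewrite gtr0_norm// invf_le1// ler1n.
apply: (le_trans (WB _)); rewrite ler_wpM2l ?(ltW B0)//.
rewrite prod_normE ge_max !normrZ !(ger0_norm (exprn_ge0 _ _))//.
have le21 : (2 : R) ^+ k / 2 ^+ n <= 1.
  by rewrite ler_pdivrMr ?exprn_gt0// mul1r ler_weXn2l// ?ler1n// ltnW.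
apply/andP; split.
  apply: (@le_trans _ _ (8 ^+ k * 8^-1 ^+ n)).
    by rewrite ler_wpM2l// exprn_ge0.
  (* The position component scales as the cube of 2^(k-n), which is at most 2^(k-n) because k <
     n. *)
  have -> : (8 : R) ^+ k * 8^-1 ^+ n = (2 ^+ k / 2 ^+ n) ^+ 3.
    rewrite expr_div_n -!exprM mulnC [(n * 3)%N]mulnC !exprM exprVn.
    by congr (_ ^+ _ / _ ^+ _); ring.
  rewrite exprS -[leRHS]mulr1 ler_wpM2l ?divr_ge0 ?exprn_ge0//.
  by rewrite exprn_ile1// divr_ge0 ?exprn_ge0.
by rewrite -exprVn ler_wpM2l// exprn_ge0.
Qed.

End superposition.

(** * Weak solutions *)

Section stationary_solutions.
Variables (R : realType) (d : nat).
Local Notation phase := ('rV[R]_d * 'rV[R]_d)%type.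
Local Notation event := (R * phase)%type.
Local Notation e_ i := (Defs.basis R i).
Implicit Types (z : event) (p : phase) (f : phase -> R) (g : 'rV[R]_d -> R).

Definition stationary_equation f g := forall p,
  \sum_i p.2 0 i * 'D_(e_ i, 0 : 'rV[R]_d) f p =
  \sum_i 'D_(0 : 'rV[R]_d, e_ i) (fun q => 'D_(0 : 'rV[R]_d, e_ i) f q) p + g p.1.

Definition event_phase z : phase := z.2.

Lemma event_phase_linear : linear event_phase. Proof. by []. Qed.

HB.instance Definition _ := GRing.isLinear.Build R event phase _ event_phase event_phase_linear.

Lemma continuous_event_phase : continuous event_phase.
Proof. by move=> z; exact: cvg_snd. Qed.

Definition event_velocity i z : R := z.2.2 0 i.

Lemma event_velocity_linear i : linear (event_velocity i).
Proof. by move=> a z1 z2; rewrite /event_velocity !mxE. Qed.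

HB.instance Definition _ i :=
  GRing.isLinear.Build R event R _ (event_velocity i) (event_velocity_linear i).

Lemma smooth_event_velocity i : smooth (event_velocity i).
Proof.
apply: smooth_linear => z.
apply: (@continuous_comp _ _ _ (fun z : event => z.2.2) (fun v : 'rV[R]_d => v 0 i)).
  apply: (@continuous_comp _ _ _ (fun z : event => z.2) snd).
    exact: cvg_snd.
  exact: cvg_snd.
exact: coord_continuous.
Qed.

Lemma derive_event_velocity i j z :
  'D_((0 : R, (e_ j, 0 : 'rV[R]_d))) (event_velocity i) z = 0.
Proof.
rewrite deriveE ?diff_lin//; last exact: smooth_differentiable (smooth_event_velocity i).
  by rewrite -[LHS]/((0 : 'rV[R]_d) 0 i) mxE.
move=> w; exact: smooth_continuous (smooth_event_velocity i) w.
Qed.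

Lemma smooth_event f : smooth f -> smooth (fun z : event => f z.2).
Proof.
move=> sf; apply: (@smooth_comp_linear _ _ _ (event_phase : {linear event -> phase}) f) => //.
exact: continuous_event_phase.
Qed.

Lemma derive_event f (u : event) z :
  'D_u (fun z : event => f z.2) z = 'D_(u.2) f z.2.
Proof. exact: (@derive_comp_linear _ _ _ (event_phase : {linear event -> phase}) f u z). Qed.

Lemma stationary_classical f g : stationary_equation f g ->
  classical_solution (fun z => f z.2) (fun z => g z.2.1).
Proof.
move=> fg z; rewrite /kinetic_transport /laplacian_v /d_t /d_x /d_v.
rewrite derive_event -[(_, _).2]/(0 : phase) derive0 add0r.
under eq_bigr do rewrite derive_event.
by rewrite [LHS]fg.
Qed.

End stationary_solutions.

Section test_linear.
Variables (R : realType) (V : normedModType R).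
Implicit Types f g : V -> R.

Lemma test_function0 : test_function (fun _ : V => 0 : R).
Proof.
split; first exact: smooth_cst.
rewrite /compact_support (_ : [set x | _] = set0); first by rewrite closure0; exact: compact0.
by apply/seteqP; split=> x //=; rewrite eqxx.
Qed.

Lemma test_functionN f : test_function f -> test_function (fun x => - f x).
Proof.
move=> tf; have := test_functionB test_function0 tf.
by rewrite (_ : (fun x => 0 - f x) = fun x => - f x)//; apply/funext => x; rewrite sub0r.
Qed.

Lemma test_functionD f g : test_function f -> test_function g ->
  test_function (fun x => f x + g x).
Proof.
move=> tf tg; have := test_functionB tf (test_functionN tg).
by rewrite (_ : (fun x => f x - - g x) = fun x => f x + g x)//;
  apply/funext => x; rewrite opprK.
Qed.

Lemma test_function_sum (I : Type) (s : seq I) (F : I -> V -> R) :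
  (forall i, test_function (F i)) -> test_function (fun x => \sum_(i <- s) F i x).
Proof.
move=> tF; elim: s => [|i s IH].
  by under eq_fun do rewrite big_nil; exact: test_function0.
by under eq_fun do rewrite big_cons; exact: test_functionD.
Qed.

End test_linear.

Section distributional.
Variables (R : realType) (d : nat).
Local Notation phase := ('rV[R]_d * 'rV[R]_d)%type.
Local Notation event := (R * phase)%type.
Local Notation e_ i := (Defs.basis R i).
Local Notation mu := (lebesgue_txv R d).
Implicit Types (psi phi : event -> R) (f : phase -> R) (g : 'rV[R]_d -> R).

Let tm := event_translation_measure R d.

Let itest psi : test_function psi -> mu.-integrable setT (EFin \o psi).
Proof. exact: (@test_integrable _ _ _ _ mu id _ tm). Qed.

Let ider psi u : test_function psi -> \int[mu]_z 'D_u psi z = 0.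
Proof. exact: (@integral_derive_test _ _ _ _ mu id _ tm). Qed.

Lemma test_transport phi : test_function phi -> test_function (kinetic_transport phi).
Proof.
move=> tphi; apply: test_functionD; first exact: test_function_derive.
apply: test_function_sum => i; apply: test_function_mull.
  exact: smooth_event_velocity.
exact: test_function_derive.
Qed.

Lemma test_laplacian phi : test_function phi -> test_function (laplacian_v phi).
Proof.
move=> tphi; apply: test_function_sum => i.
by apply: test_function_derive; exact: test_function_derive.
Qed.

(** Here T, X, Y stand for the time, position and second velocity derivatives of the test function,
    the primed letters for those of the solution; the forcing has been replaced by means of the
    equation. *)
Lemma divergence_identity (F phi T T' : R) (v X X' Y Y' : 'I_d -> R) :
  F * - (T + \sum_i v i * X i) -
    (F * \sum_i Y i + ((T' + \sum_i v i * X' i) - \sum_i Y' i) * phi) =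
  - ((F * T + T' * phi) +
     \sum_i (v i * (F * X i + X' i * phi) + (F * Y i - Y' i * phi))).
Proof.
have -> : \sum_i (v i * (F * X i + X' i * phi) + (F * Y i - Y' i * phi)) =
    F * (\sum_i v i * X i) + phi * (\sum_i v i * X' i) + F * (\sum_i Y i) -
    phi * (\sum_i Y' i).
  rewrite !mulr_sumr -!big_split -sumrB; apply: eq_bigr => i _ /=; ring.
ring.
Qed.

(* The weak formulation integrates to zero the divergence of the fluxes
   [F phi], [v_i F phi] and [F d_v phi - phi d_v F]. *)
Lemma classical_distributional f g : smooth f -> smooth g ->
  stationary_equation f g ->
  distributional_solution (fun z => f z.2) (fun z => g z.2.1).
Proof.
move=> sf sg fg phi tphi; pose ff (z : event) := f z.2; pose gg (z : event) := g z.2.1.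
have sff : smooth ff by exact: smooth_event.
have sgg : smooth gg.
  have : smooth (fun p : phase => g p.1).
    have lin : linear (fst : phase -> 'rV[R]_d) by [].
    pose L0 := GRing.isLinear.Build _ _ _ _ _ lin.
    pose L : {linear phase -> 'rV[R]_d} := HB.pack (fst : phase -> 'rV[R]_d) L0.
    by apply: (@smooth_comp_linear _ _ _ L g) => // p; exact: cvg_fst.
  by move=> /smooth_event.
have sphi := test_function_smooth tphi.
have t1 : test_function (fun z => ff z * - kinetic_transport phi z).
  by apply: test_function_mull => //; exact/test_functionN/test_transport.
have t2 : test_function (fun z => ff z * laplacian_v phi z + gg z * phi z).
  by apply: test_functionD; apply: test_function_mull => //; exact: test_laplacian.
apply/eqP; rewrite -subr_eq0 -RintegralB//; [|exact: itest|exact: itest].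
have cl : forall z, kinetic_transport ff z = laplacian_v ff z + gg z.
  exact: stationary_classical.
pose ut : event := (1, (0, 0)).
pose ux i : event := (0, (e_ i, 0)).
pose uv i : event := (0, (0, e_ i)).
pose At z := 'D_ut (fun z => ff z * phi z) z.
pose Ax i z := 'D_(ux i) (fun z => (event_velocity i z * ff z) * phi z) z.
pose Av i z := 'D_(uv i) (fun z => ff z * 'D_(uv i) phi z - 'D_(uv i) ff z * phi z) z.
have tAt : test_function (fun z => ff z * phi z) by exact: test_function_mull.
have tAx i : test_function (fun z => (event_velocity i z * ff z) * phi z).
  by apply: test_function_mull => //; apply: smoothM => //; exact: smooth_event_velocity.
have tAv i : test_function (fun z => ff z * 'D_(uv i) phi z - 'D_(uv i) ff z * phi z).
  apply: test_functionB; apply: test_function_mull => //.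
    exact: test_function_derive.
  exact: smooth_derive.
have E z : ff z * - kinetic_transport phi z - (ff z * laplacian_v phi z + gg z * phi z) =
    - (At z + \sum_i (Ax i z + Av i z)).
  have -> : At z = ff z * d_t phi z + d_t ff z * phi z by rewrite /At deriveM_smooth.
  have AxE i : Ax i z = event_velocity i z * (ff z * d_x i phi z + d_x i ff z * phi z).
    rewrite /Ax deriveM_smooth//; last by apply: smoothM => //; exact: smooth_event_velocity.
    rewrite deriveM_smooth//; last exact: smooth_event_velocity.
    rewrite [X in _ + (_ + X * _) * _](_ : _ = 0); last exact: derive_event_velocity.
    by rewrite /d_x -/(ux i); ring.
  have AvE i : Av i z = ff z * d_v i (d_v i phi) z - d_v i (d_v i ff) z * phi z.
    have s1 : smooth (fun z => 'D_(uv i) phi z) by exact: smooth_derive.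
    have s2 : smooth (fun z => 'D_(uv i) ff z) by exact: smooth_derive.
    have s3 : smooth (fun z => ff z * 'D_(uv i) phi z) by exact: smoothM.
    have s4 : smooth (fun z => - 1 * ('D_(uv i) ff z * phi z)).
      by apply: smoothZ; exact: smoothM.
    rewrite /Av.
    rewrite (_ : (fun z => _ - _) = fun z => ff z * 'D_(uv i) phi z +
      - 1 * ('D_(uv i) ff z * phi z)); last by apply/funext => w; rewrite mulN1r.
    rewrite deriveD_smooth// deriveM_smooth// deriveZ_smooth; last exact: smoothM.
    rewrite deriveM_smooth//.
    have aux (a b c e' h k : R) : a * b + c * e' + -1 * (c * e' + h * k) = a * b - h * k.
      by ring.
    exact: aux.
  under eq_bigr do rewrite AxE AvE.
  have -> : gg z = kinetic_transport ff z - laplacian_v ff z by rewrite cl addrC addKr.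
  exact: (divergence_identity (ff z) (phi z) (d_t phi z) (d_t ff z)
    (fun i => z.2.2 0 i) (fun i => d_x i phi z) (fun i => d_x i ff z)
    (fun i => d_v i (d_v i phi) z) (fun i => d_v i (d_v i ff) z)).
under eq_Rintegral do rewrite E -mulN1r.
have iA : mu.-integrable setT (EFin \o At) by apply: itest; exact: test_function_derive.
have iAxv i : mu.-integrable setT (EFin \o (fun z => Ax i z + Av i z)).
  by apply: itest; apply: test_functionD; exact: test_function_derive.
rewrite RintegralZl//; last first.
  apply: itest; apply: test_functionD; first exact: test_function_derive.
  by apply: test_function_sum => i; apply: test_functionD; exact: test_function_derive.
rewrite RintegralD//; last exact: integrable_sum_fin.
rewrite Rintegral_sum// ider// big1 ?addr0 ?mulr0// => i _.
rewrite RintegralD//; [|by apply: itest; exact: test_function_derive..].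
by rewrite !ider// addr0.
Qed.

End distributional.

Section limit_distributional.
Variables (R : realType) (d : nat).
Local Notation phase := ('rV[R]_d * 'rV[R]_d)%type.
Local Notation event := (R * phase)%type.
Local Notation mu := (lebesgue_txv R d).

Let tm := event_translation_measure R d.

Let itest (psi : event -> R) : test_function psi -> mu.-integrable setT (EFin \o psi).
Proof. exact: (@test_integrable _ _ _ _ mu id _ tm). Qed.

Let imul (F psi : event -> R) (B : R) : continuous F -> (forall z, `|F z| <= B) ->
  test_function psi -> mu.-integrable setT (EFin \o (fun z => F z * psi z)).
Proof.
move=> cF FB; apply: (@bounded_mul_test_integrable _ _ _ _ mu id _ tm _ B) => //.
exact: continuous_measurable_event.
Qed.

Let approx (F h psi : event -> R) (B B' eps : R) : continuous F -> continuous h ->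
  (forall z, `|F z| <= B) -> (forall z, `|h z| <= B') ->
  (forall z, `|F z - h z| <= eps) -> test_function psi ->
  `|\int[mu]_z (F z * psi z) - \int[mu]_z (h z * psi z)| <= eps * \int[mu]_z `|psi z|.
Proof.
move=> cF ch FB hB Fh tpsi; have i1 := imul cF FB tpsi; have i2 := imul ch hB tpsi.
have ipsi : mu.-integrable setT (EFin \o (fun z => `|psi z|)).
  exact: integrable_norm (itest tpsi).
rewrite -RintegralB// -RintegralZl//; apply: dominated_Rintegral => //.
- have mpsi : measurable_fun setT psi.
    apply: continuous_measurable_event; apply: smooth_continuous.
    exact: test_function_smooth.
  by apply: measurable_funB; apply: measurable_funM => //; exact: continuous_measurable_event.
- by move=> z _; rewrite -mulrBl normrM ler_wpM2r.
- exact: integrable_cmul.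
Qed.

(** In the weak formulation all derivatives fall on the test function, so each integral moves by at
    most the uniform error times an L^1 norm that does not depend on n. *)
Lemma limit_distributional (f : phase -> R) (g : 'rV[R]_d -> R)
    (fn : nat -> phase -> R) (gn : nat -> 'rV[R]_d -> R) (ef eg : nat -> R) (Bf Bg : R) :
  (forall n, smooth (fn n)) -> (forall n, smooth (gn n)) ->
  (forall n, stationary_equation (fn n) (gn n)) ->
  (forall n p, `|fn n p| <= Bf) -> (forall n x, `|gn n x| <= Bg) ->
  continuous f -> continuous g -> (forall p, `|f p| <= Bf) -> (forall x, `|g x| <= Bg) ->
  (forall n p, `|f p - fn n p| <= ef n) -> (forall n x, `|g x - gn n x| <= eg n) ->
  (forall e, 0 < e -> exists n, ef n < e /\ eg n < e) ->
  distributional_solution (fun z => f z.2) (fun z => g z.2.1).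
Proof.
move=> sfn sgn eqn fnB gnB cf cg fB gB ffn ggn lim phi tphi.
have tA : test_function (fun z => - kinetic_transport phi z).
  exact/test_functionN/test_transport.
have tL : test_function (laplacian_v phi) by exact: test_laplacian.
have c2 (h : phase -> R) : continuous h -> continuous (fun z : event => h z.2).
  move=> ch z; apply: (@continuous_comp _ _ _ (fun z : event => z.2) h); last exact: ch.
  exact: cvg_snd.
have c1 (h : 'rV[R]_d -> R) : continuous h -> continuous (fun z : event => h z.2.1).
  move=> ch; apply: (c2 (fun p => h p.1)) => p.
  by apply: (@continuous_comp _ _ _ fst h); [exact: cvg_fst|exact: ch].
pose I (psi : event -> R) : R := \int[mu]_z `|psi z|.
have I0 psi : 0 <= I psi by apply: Rintegral_ge0.
have split_int (h : phase -> R) (k : 'rV[R]_d -> R) : continuous h -> continuous k ->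
    (forall p, `|h p| <= Bf) -> (forall x, `|k x| <= Bg) ->
    \int[mu]_z (h z.2 * laplacian_v phi z + k z.2.1 * phi z) =
    \int[mu]_z (h z.2 * laplacian_v phi z) + \int[mu]_z (k z.2.1 * phi z).
  move=> ch ck hB kB; rewrite RintegralD//.
    by apply: imul (c2 _ ch) _ tL => z; exact: hB.
  by apply: imul (c1 _ ck) _ tphi => z; exact: kB.
rewrite split_int//.
set X := LHS; set Y := \int[mu]_z _; set Z := \int[mu]_z _.
have bound n : `|X - (Y + Z)| <=
    ef n * (I (fun z => - kinetic_transport phi z) + I (laplacian_v phi)) + eg n * I phi.
  have cfn := smooth_continuous (sfn n); have cgn := smooth_continuous (sgn n).
  have := classical_distributional (sfn n) (sgn n) (eqn n) tphi.
  rewrite split_int//; set Xn := LHS; set Yn := \int[mu]_z _; set Zn := \int[mu]_z _ => E.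
  have HX : `|X - Xn| <= ef n * I (fun z => - kinetic_transport phi z).
    by apply: approx (c2 _ cf) (c2 _ cfn) _ _ _ tA => z; [exact: fB|exact: fnB|exact: ffn].
  have HY : `|Y - Yn| <= ef n * I (laplacian_v phi).
    by apply: approx (c2 _ cf) (c2 _ cfn) _ _ _ tL => z; [exact: fB|exact: fnB|exact: ffn].
  have HZ : `|Z - Zn| <= eg n * I phi.
    by apply: approx (c1 _ cg) (c1 _ cgn) _ _ _ tphi => z; [exact: gB|exact: gnB|exact: ggn].
  have -> : X - (Y + Z) = (X - Xn) - ((Y - Yn) + (Z - Zn)) by rewrite E; ring.
  rewrite mulrDr -[leRHS]addrA; apply: (le_trans (ler_normB _ _)); apply: lerD => //.
  by apply: (le_trans (ler_normD _ _)); exact: lerD.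
apply/eqP; rewrite -subr_eq0; apply: contraT => X0.
pose c := I (fun z => - kinetic_transport phi z) + I (laplacian_v phi) + I phi.
have c0 : 0 <= c by rewrite !addr_ge0.
have XX : 0 < `|X - (Y + Z)| by rewrite normr_gt0.
(* With both errors below this threshold, the defect would be strictly smaller than itself. *)
have [n [efn egn]] := lim (`|X - (Y + Z)| / (c + 1)) (divr_gt0 XX (ltr_wpDl c0 ltr01)).
suff : `|X - (Y + Z)| < `|X - (Y + Z)| by rewrite ltxx.
apply: (le_lt_trans (bound n)).
apply: (@le_lt_trans _ _ (`|X - (Y + Z)| / (c + 1) * c)).
  rewrite /c [leRHS]mulrDr; apply: lerD; rewrite ler_wpM2r ?addr_ge0// ltW//.
by rewrite -mulrA gtr_pMr// mulrC ltr_pdivrMr ?mul1r ?ltrDl// ltr_wpDl.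
Qed.

End limit_distributional.

Section ae_bounds.
Context d (T : measurableType d) (R : realType) (mu : {measure set T -> \bar R}).

Lemma ae_dominated_Rintegral (h g : T -> R) : measurable_fun setT h ->
  (forall y, 0 <= g y) -> {ae mu, forall y, `|h y| <= g y} ->
  mu.-integrable setT (EFin \o g) ->
  `|\int[mu]_y h y| <= \int[mu]_y g y.
Proof.
move=> mh g0 hg ig.
have mh' : measurable_fun setT (EFin \o h) by exact/measurable_EFinP.
have mg' : measurable_fun setT (EFin \o g) by case/integrableP : ig.
have le1 : (`|\int[mu]_y (h y)%:E| <= \int[mu]_y (g y)%:E)%E.
  apply: (le_trans (le_abse_integral _ measurableT mh')).
  apply: ae_ge0_le_integral => //.
  - exact: measurableT_comp.
  - by move=> y _; rewrite lee_fin.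
  - by apply: filterS hg => y hgy _; rewrite /= lee_fin.
have gfin : (\int[mu]_y (g y)%:E)%E \is a fin_num by exact: integrable_fin_num.
rewrite -lee_fin /Rintegral fineK//; apply: le_trans le1.
(* [fine] sends infinite values to 0, so taking it cannot increase the modulus. *)
by case: (\int[mu]_y (h y)%:E)%E => [r||] /=; rewrite ?leey.
Qed.

End ae_bounds.

Section boxes.
Variables (R : realType) (d : nat).
Local Notation phase := ('rV[R]_d * 'rV[R]_d)%type.
Local Notation mu := (lebesgue_xv R d).

Lemma compact_cube (a : R) : compact (cube R d a).
Proof.
apply: bounded_closed_compact.
  by exists a; split; [exact: num_real|move=> M aM x /= xa; rewrite (le_trans xa)// ltW].
apply: (@closed_comp _ _ (Num.norm : 'rV[R]_d -> R) [set y | y <= a]).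
  by move=> x _; exact: norm_continuous.
exact: closed_le.
Qed.

Lemma compact_box (a b : R) : compact (box R d a b).
Proof. by apply: compact_setX; exact: compact_cube. Qed.

Lemma Rintegral_box (c a b : R) : 0 <= a -> 0 <= b ->
  mu.-integrable setT (EFin \o (fun p => c * \1_(box R d a b) p)) /\
  \int[mu]_p (c * \1_(box R d a b) p) = c * ((2 * a) ^+ d * (2 * b) ^+ d).
Proof.
move=> a0 b0; have mb := measurable_box (R := R) (n := d) a b.
have i1 : mu.-integrable setT (EFin \o (\1_(box R d a b) : phase -> R)).
  apply/integrableP; split.
    by apply/measurable_EFinP; exact: measurable_indic.
  rewrite (eq_integral (fun y => (\1_(box R d a b) y)%:E)); last first.
    by move=> y _; rewrite /= ger0_norm.
  by rewrite integral_indic// setIT [ltLHS]lebesgue_box// ltry.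
split; first exact: integrable_cmul.
by rewrite RintegralZl// /Rintegral integral_indic// setIT [X in fine X]lebesgue_box.
Qed.

End boxes.

(** * Unbounded Hessians *)

(** A product of one-dimensional bumps over all 2 d coordinates. The lower bound m on the half-size
    box is what turns a pointwise lower bound on the Hessian into one on its integral. *)
Lemma exists_phase_bump (R : realType) (d : nat) :
  exists (rho : 'rV[R]_d * 'rV[R]_d -> R) (E m : R),
  [/\ smooth rho, forall p, 0 <= rho p <= E,
      forall p, ~ box R d 1 1 p -> rho p = 0, 0 < m &
      forall p, box R d 2^-1 2^-1 p -> m <= rho p].
Proof.
have [eta [seta eta0 eta_supp eta_pos]] := exists_bump R.
pose rho (p : 'rV[R]_d * 'rV[R]_d) := \prod_(j : 'I_d + 'I_d) eta (coord_dir R j p).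
have coordE (j : 'I_d + 'I_d) (p : 'rV[R]_d * 'rV[R]_d) :
    `|coord_dir R j p| = match j with inl i => `|p.1 0 i| | inr i => `|p.2 0 i| end.
  case: j => i; first by [].
  by rewrite -[LHS]/(`|- p.2 0 i|) normrN.
have srho : smooth rho.
  apply: smooth_prod => j.
  by apply: (@smooth_comp_linear _ _ _ (coord_dir R j) eta) => //; exact: continuous_coord_dir.
have rho_supp p : ~ box R d 1 1 p -> rho p = 0.
  move=> np; suff [j pj] : exists j, 1 <= `|coord_dir R j p|.
    by rewrite /rho (bigD1 j)//= eta_supp// mul0r.
  have [p1|p1] := lerP `|p.1| 1; last first.
    have [i pi] := rV_norm_ge_coord ltr01 (ltW p1).
    by exists (inl i); rewrite coordE.
  have [p2|p2] := lerP `|p.2| 1; first by exfalso; apply: np; split.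
  have [i pi] := rV_norm_ge_coord ltr01 (ltW p2).
  by exists (inr i); rewrite coordE.
have [E E0 EP] := test_function_bounded
  (test_function_compact srho (@compact_box R d 1 1) rho_supp).
have c : {within `[- 2^-1, 2^-1], continuous eta}.
  by apply: continuous_subspaceT => x; exact: smooth_continuous.
have le2 : (- 2^-1 : R) <= 2^-1 by lra.
have [x0 x0P mP] := EVT_min le2 c.
have m0 : 0 < eta x0.
  apply: eta_pos; move: x0P; rewrite in_itv/= -ler_norml => /le_lt_trans; apply; lra.
exists rho, E, (\prod_(j : 'I_d + 'I_d) eta x0); split=> //.
- move=> p; apply/andP; split; first by apply: prodr_ge0 => j _.
  by rewrite (le_trans _ (EP p))// ler_norm.
- exact: prodr_gt0.
- move=> p [p1 p2]; apply: ler_prod => j _; rewrite ltW//=.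
  apply: mP; rewrite in_itv/= -ler_norml coordE.
  by case: j => i; rewrite (le_trans (rV_norm_coord _ _)).
Qed.

(** The two integrands differ by D_u (f D_w rho) - D_w (D_u f rho), and both terms integrate to
    zero. The directions come out in reverse order, so symmetry of second derivatives is never
    invoked. *)
Lemma integral_by_parts2 (R : realType) (V : normedModType R) d
    (T : measurableType d) (mu : {measure set T -> \bar R}) (e : T -> V)
    (tau : V -> T -> T) (f rho : V -> R) (u w : V) :
  translation_measure mu e tau -> smooth f -> test_function rho ->
  \int[mu]_y (f (e y) * 'D_u (fun x => 'D_w rho x) (e y)) =
  \int[mu]_y ('D_w (fun x => 'D_u f x) (e y) * rho (e y)).
Proof.
move=> tm sf trho; have srho := test_function_smooth trho.
have tDw : test_function (fun x => 'D_w rho x) by exact: test_function_derive.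
have sDu : smooth (fun x => 'D_u f x) by exact: smooth_derive.
have t1 : test_function (fun x => f x * 'D_w rho x) by exact: test_function_mull.
have t2 : test_function (fun x => 'D_u f x * rho x) by exact: test_function_mull.
have i1 : mu.-integrable setT
    (EFin \o (fun y => f (e y) * 'D_u (fun x => 'D_w rho x) (e y))).
  apply: (test_integrable tm (phi := fun x => f x * 'D_u (fun x => 'D_w rho x) x)).
  by apply: test_function_mull => //; exact: test_function_derive.
have i2 : mu.-integrable setT
    (EFin \o (fun y => 'D_w (fun x => 'D_u f x) (e y) * rho (e y))).
  apply: (test_integrable tm (phi := fun x => 'D_w (fun x => 'D_u f x) x * rho x)).
  by apply: test_function_mull => //; exact: smooth_derive.
apply/eqP; rewrite -subr_eq0 -RintegralB//.
rewrite (_ : \int[mu]_y _ = \int[mu]_y ('D_u (fun x => f x * 'D_w rho x) (e y) -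
    'D_w (fun x => 'D_u f x * rho x) (e y))); last first.
  apply: eq_Rintegral => y _.
  rewrite (deriveM_smooth _ _ sf (test_function_smooth tDw)) (deriveM_smooth _ _ sDu srho).
  by rewrite opprD addrA addrK.
have j1 : mu.-integrable setT (EFin \o (fun y => 'D_u (fun x => f x * 'D_w rho x) (e y))).
  exact: (test_integrable tm (test_function_derive u t1)).
have j2 : mu.-integrable setT (EFin \o (fun y => 'D_w (fun x => 'D_u f x * rho x) (e y))).
  exact: (test_integrable tm (test_function_derive w t2)).
by rewrite RintegralB// (integral_derive_test tm u t1) (integral_derive_test tm w t2) subrr.
Qed.

Section hessian_entries.
Variables (R : realType) (d : nat).
Local Notation phase := ('rV[R]_d * 'rV[R]_d)%type.
Local Notation mu := (lebesgue_xv R d).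

Lemma frobenius_entry (i j : 'I_d) (A : 'M[R]_d) : `|A i j| <= frobenius A.
Proof.
rewrite /frobenius -sqrtr_sqr ler_sqrt; last first.
  by apply: sumr_ge0 => k _; apply: sumr_ge0 => l _; exact: sqr_ge0.
rewrite (bigD1 i)//= (bigD1 j)//= -real_normK ?num_real// -addrA lerDl addr_ge0//.
  by apply: sumr_ge0 => l _; exact: sqr_ge0.
by apply: sumr_ge0 => k _; apply: sumr_ge0 => l _; exact: sqr_ge0.
Qed.

Lemma Linfty_loc_entry (i j : 'I_d) (H : phase -> 'M[R]_d) (K : set phase) :
  Linfty_loc H -> compact K ->
  exists2 M, 0 <= M & {ae mu, forall p, K p -> `|H p i j| <= M}.
Proof.
move=> [_ HK] /HK.
(* The norm of exponent +oo unfolds to the essential supremum only when the total mass is positive;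
   otherwise its value is 0. *)
have mu0 : (0 < mu setT)%E.
  apply: (@lt_le_trans _ _ (mu (box R d 1 1))).
    by rewrite lebesgue_box// lte_fin mulr_gt0// exprn_gt0.
  by apply: le_measure; rewrite ?inE//; exact: measurable_box.
rewrite unlock /= mu0.
set s := ess_sup _ _ => s_fin.
have sP : {ae mu, forall p, (`|((@frobenius R d \o H) \_ K p)%:E| <= s)%E} by exact: ess_sup_ge.
have [M [M0 sM]] : exists M : R, 0 <= M /\ (s <= M%:E)%E.
  move: s_fin; case: s {sP} => [r _||_] //.
    by exists `|r|; split=> //; rewrite lee_fin ler_norm.
  by exists 0; split=> //; exact: leNye.
exists M => //; apply: filterS sP => p sp Kp.
have := le_trans sp sM; rewrite /= lee_fin patchE mem_set//; apply: le_trans.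
exact: le_trans (frobenius_entry i j _) (ler_norm _).
Qed.

End hessian_entries.

Section unbounded_hessian.
Variables (R : realType) (d : nat) (i j : 'I_d).
Local Notation phase := ('rV[R]_d * 'rV[R]_d)%type.
Local Notation mu := (lebesgue_xv R d).
Local Notation e_ i := (Defs.basis R i).
Local Notation "'D_v i f" := (fun p : phase => 'D_(0 : 'rV[R]_d, e_ i) f p)
  (at level 10, i, f at next level).

(** With the bump [rho] rescaled to [Q], of volume proportional to [vol], three quantities are
    proportional to [vol]: the pairing with [H] is at most M E; the pairing of f - f_n with the
    second derivative is at most C 4^-n times 4^n E2; the pairing with the Hessian of f_n is at
    least m L n. Dividing by [vol] bounds [L n] independently of n. *)
Lemma not_hessian_Linfty_loc (f : phase -> R) (fn : nat -> phase -> R)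
    (L : nat -> R) (Bf C : R) :
  (forall n, smooth (fn n)) -> continuous f -> (forall p, `|f p| <= Bf) ->
  (forall n p, `|f p - fn n p| <= C * 4^-1 ^+ n) ->
  (forall n p, `|p.1| <= 8^-1 ^+ n -> `|p.2| <= 2^-1 ^+ n ->
     L n <= ('D_v i ('D_v j (fn n))) p) ->
  (forall A, exists n, A <= L n) ->
  ~ hessian_v_Linfty_loc f.
Proof.
move=> sfn cf fB ffn lower unb [H [LH dH]].
have [rho [E [m [srho rhoE rho_supp m0 rho_m]]]] := exists_phase_bump R d.
have trho := test_function_compact srho (@compact_box R d 1 1) rho_supp.
have E0 : 0 <= E by have /andP[] := rhoE 0; exact: le_trans.
pose D (h : phase -> R) := 'D_v j ('D_v i h).
have tD : test_function (D rho) by do 2 apply: test_function_derive.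
have [E2 E20 E2P] := test_function_bounded tD.
have D_supp p : ~ box R d 1 1 p -> D rho p = 0.
  have cb : closed (box R d 1 1).
    by apply: compact_closed (@compact_box R d 1 1); exact: norm_hausdorff.
  move=> np; apply: (derive_outside_closed _ cb _ np) => q nq.
  exact: (derive_outside_closed _ cb rho_supp nq).
have [M M0 MP] := Linfty_loc_entry j i LH (@compact_box R d 1 1).
have tm := phase_translation_measure R d.
(* The quotient is the bound that the three estimates impose on [L n]; the added 1 makes the
   contradiction strict. *)
have [n Ln] := unb (`|(M * E + C * E2) * (2 ^+ d * 2 ^+ d) / m| + 1).
have Ln0 : 0 <= L n by apply: le_trans Ln; rewrite addr_ge0.
pose S := dilation (d := d) (8 ^+ n : R) (2 ^+ n).
pose Q := box R d (8^-1 ^+ n) (2^-1 ^+ n).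
have q8 : (0 : R) < 8^-1 ^+ n by rewrite exprn_gt0// invr_gt0.
have q2 : (0 : R) < 2^-1 ^+ n by rewrite exprn_gt0// invr_gt0.
have SQ p a b : box R d a b (S p) <-> box R d (a * 8^-1 ^+ n) (b * 2^-1 ^+ n) p.
  rewrite /box /cube /S /dilation /= !normrZ !gtr0_norm//.
  by rewrite !exprVn !ler_pdivlMr// ![`|_| * _]mulrC.
have QS p : ~ Q p -> ~ box R d 1 1 (S p) by rewrite SQ !mul1r.
pose rn := rho \o S.
have srn : smooth rn by exact: smooth_dilation.
have rn_supp p : ~ Q p -> rn p = 0 by move=> /QS /rho_supp.
have trn : test_function rn by apply: test_function_compact srn (@compact_box R d _ _) rn_supp.
have DrnE p : D rn p = 4 ^+ n * D rho (S p).
  rewrite /D.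
  rewrite (_ : 'D_v i rn = fun q => 2 ^+ n * (('D_v i rho) \o S) q); last first.
    by apply/funext => q; rewrite derive_dilation_v.
  have sDi : smooth ('D_v i rho) by exact: smooth_derive.
  rewrite deriveZ_smooth; last exact: smooth_dilation.
  rewrite derive_dilation_v// mulrA -exprMn; congr (_ ^+ _ * _); ring.
have Drn_supp p : ~ Q p -> D rn p = 0 by move=> /QS /D_supp; rewrite DrnE => ->; rewrite mulr0.
have tDn : test_function (D rn) by do 2 apply: test_function_derive.
have hessE p : hessian_v rn p j i = D rn p by rewrite mxE.
pose vol : R := (8^-1 ^+ n) ^+ d * (2^-1 ^+ n) ^+ d.
have vol0 : 0 < vol by rewrite mulr_gt0// exprn_gt0.
have volQ c : mu.-integrable setT (EFin \o (fun p => c * \1_Q p)) /\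
    \int[mu]_p (c * \1_Q p) = c * (2 ^+ d * 2 ^+ d) * vol.
  have [iQ ->] := @Rintegral_box R d c _ _ (ltW q8) (ltW q2); split=> //.
  by rewrite -!mulrA; congr (_ * _); rewrite !exprMn /vol; ring.
have indQ p c : (Q p -> 0 <= c) -> 0 <= c * \1_Q p.
  by move=> cQ; rewrite indicE; case: (boolP (p \in Q)) => [/set_mem/cQ|_];
    rewrite ?mulr1 ?mulr0.
have mHij : measurable_fun setT (fun p => H p j i).
  by have /measurable_fun_matrixP mH := LH.1; exact: mH.
have mrn : measurable_fun setT rn.
  by apply: continuous_measurable_phase; exact: smooth_continuous.
have H1 : `|\int[mu]_p (H p j i * rn p)| <= M * E * (2 ^+ d * 2 ^+ d) * vol.
  have [iQ <-] := volQ (M * E); apply: ae_dominated_Rintegral iQ.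
  - exact: measurable_funM.
  - by move=> p; apply: indQ => _; rewrite mulr_ge0.
  - apply: filterS MP => p Mp; rewrite indicE normrM.
    case: (boolP (p \in Q)) => [/set_mem pQ|/negP pQ]; last first.
      by rewrite rn_supp ?normr0 ?mulr0// => pQ'; apply: pQ; exact: mem_set.
    rewrite mulr1 ler_pM//; last first.
      by have /andP[r0 rE] := rhoE (S p); rewrite ger0_norm.
    apply: Mp; have [p1 p2'] := pQ; split; apply: le_trans.
    + exact: p1.
    + by rewrite exprn_ile1// ?invr_ge0// invf_le1// ler1n.
    + exact: p2'.
    + by rewrite exprn_ile1// ?invr_ge0// invf_le1// ler1n.
have H2 : `|\int[mu]_p ((f p - fn n p) * D rn p)| <= C * E2 * (2 ^+ d * 2 ^+ d) * vol.
  have [iQ <-] := volQ (C * E2); apply: (dominated_Rintegral measurableT _ _ iQ).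
    apply: continuous_measurable_phase => p; apply: cvgM.
      by apply: cvgB; [exact: cf|exact: (smooth_continuous (sfn n))].
    exact: (smooth_continuous (test_function_smooth tDn)).
  move=> p _; rewrite indicE normrM.
  case: (boolP (p \in Q)) => [/set_mem pQ|/negP pQ]; last first.
    by rewrite Drn_supp ?normr0 ?mulr0// => pQ'; apply: pQ; exact: mem_set.
  rewrite mulr1 DrnE normrM (gtr0_norm (exprn_gt0 _ _))// mulrA ler_pM ?mulr_ge0 ?exprn_ge0//.
  rewrite -ler_pdivlMr ?exprn_gt0//; apply: le_trans (ffn n p) _.
  by rewrite exprVn.
(* Only the half-size box contributes the bound m; on the rest of [Q] the integrand is nonnegative
   because [L n] and [rho] are. *)
have H3 : L n * m * vol <= \int[mu]_p (('D_v i ('D_v j (fn n))) p * rn p).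
  have hh8 : 0 <= 2^-1 * 8^-1 ^+ n :> R by rewrite mulr_ge0// ltW.
  have hh2 : 0 <= 2^-1 * 2^-1 ^+ n :> R by rewrite mulr_ge0// ltW.
  have [iH IH] := @Rintegral_box R d (L n * m) _ _ hh8 hh2.
  rewrite !mulrA !divff ?pnatr_eq0// !mul1r in IH.
  rewrite /vol mulrA -IH; apply: le_Rintegral => //.
    apply: (test_integrable tm (phi := fun p => ('D_v i ('D_v j (fn n))) p * rn p)).
    apply: test_function_mull trn; do 2 apply: smooth_derive; exact: sfn.
  move=> p _; rewrite indicE.
  have [pQ|pQ] := pselect (Q p); last first.
    rewrite (rn_supp p pQ) mulr0; case: (boolP (p \in _)) => [/set_mem [/= p1 p2']|_]; last by rewrite mulr0.
    exfalso; apply: pQ; split; rewrite /cube /=; [apply: le_trans p1 _|apply: le_trans p2' _].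
      by rewrite ler_piMl ?(ltW q8)// invf_le1// ler1n.
    by rewrite ler_piMl ?(ltW q2)// invf_le1// ler1n.
  have [p1 p2'] := pQ; have lp := lower n p p1 p2'.
  have /andP[r0 _] := rhoE (S p).
  case: (boolP (p \in _)) => [/set_mem pH|_].
    rewrite mulr1 ler_pM// ?(ltW m0)//; apply: rho_m; exact/SQ.
  by rewrite mulr0 mulr_ge0//; exact: le_trans lp.
have E1 : \int[mu]_p (f p * D rn p) = \int[mu]_p (H p j i * rn p).
  by rewrite -(dH rn trn j i); apply: eq_Rintegral => p _; rewrite hessE.
have E3 : \int[mu]_p (fn n p * D rn p) = \int[mu]_p (('D_v i ('D_v j (fn n))) p * rn p).
  exact: (integral_by_parts2 (0, e_ j) (0, e_ i) tm (sfn n) trn).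
have E4 : \int[mu]_p ((f p - fn n p) * D rn p) =
    \int[mu]_p (f p * D rn p) - \int[mu]_p (fn n p * D rn p).
  rewrite -RintegralB//; first by apply: eq_Rintegral => p _; rewrite mulrBl.
    apply: (bounded_mul_test_integrable tm _ fB tDn).
    exact: continuous_measurable_phase.
  apply: (test_integrable tm (phi := fun p => fn n p * D rn p)).
  exact: test_function_mull.
have : L n * m * vol <= (M * E + C * E2) * (2 ^+ d * 2 ^+ d) * vol.
  rewrite -E3 in H3; rewrite E4 in H2; rewrite -E1 in H1.
  move: H1 H2 H3; rewrite !ler_norml => /andP[_ h1] /andP[h2 _] h3.
  rewrite 2!mulrDl; lra.
rewrite ler_pM2r// -ler_pdivlMr// => h.
have := le_trans Ln h; have := ler_norm ((M * E + C * E2) * (2 ^+ d * 2 ^+ d) / m).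
lra.
Qed.

End unbounded_hessian.

(** * Essential suprema and conclusion *)

Section essential_supremum.
Context d (T : measurableType d) (R : realType) (mu : {measure set T -> \bar R}).

Lemma Lnormy_le (f : T -> R) (C : R) : 0 <= C -> (forall y, `|f y| <= C) ->
  ('N[mu]_+oo[EFin \o f] <= C%:E)%E.
Proof.
move=> C0 fC; rewrite unlock /=; case: ifP => _; last by rewrite lee_fin.
by apply/ess_supP; apply: nearW => y; rewrite /= lee_fin.
Qed.

End essential_supremum.

(** A value at one point is invisible to the essential supremum; continuity spreads it over a box of
    positive measure. Passing to a minorant [w] lets a single Hessian entry stand in for the
    Frobenius norm. *)
Lemma Lnormy_ge_value (R : realType) (d : nat) (w h : 'rV[R]_d * 'rV[R]_d -> R) :
  continuous w -> (forall p, w p <= `|h p|) ->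
  ((w 0)%:E <= 'N[lebesgue_xv R d]_+oo[EFin \o h])%E.
Proof.
move=> cw wh; have box0 (e : R) : 0 < e -> (0 < lebesgue_xv R d (box R d e e))%E.
  move=> e0; rewrite [ltRHS]lebesgue_box ?(ltW e0)// lte_fin.
  by rewrite mulr_gt0// exprn_gt0// mulr_gt0.
have mu0 : (0 < lebesgue_xv R d setT)%E.
  apply: (lt_le_trans (box0 1 ltr01)).
  by apply: le_measure; rewrite ?inE//; exact: measurable_box.
rewrite unlock /= mu0 leNgt; apply/negP; set s := ess_sup _ _ => sw.
have [y [sy yw]] : exists y, (s <= y%:E)%E /\ y < w 0.
  move: sw; case: s => [r|//|] sw.
    by exists r; split=> //; rewrite -lte_fin.
  by exists (w 0 - 1); split; [exact: leNye|rewrite ltrBlDr ltrDl].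
have : \forall p \near (0 : 'rV[R]_d * 'rV[R]_d), y < w p.
  exact: (cvgr_gt _ (cw 0)).
move=> /nbhs_ballP[e /= e0 eP].
have [N [mN N0 NP]] : {ae lebesgue_xv R d, forall p, (`|(h p)%:E| <= s)%E}.
  exact: ess_sup_ge.
have e2 : 0 < e / 2 by rewrite divr_gt0.
have boxN : box R d (e / 2) (e / 2) `<=` N.
  move=> p [p1 p2]; apply: NP => /= hs.
  have yp : y < w p.
    apply: eP; rewrite -ball_normE /= sub0r normrN prod_normE gt_max.
    by rewrite !(le_lt_trans p1, le_lt_trans p2)//; lra.
  have := le_trans hs sy; rewrite lee_fin => hy.
  by have := lt_le_trans yp (le_trans (wh p) hy); rewrite ltxx.
have : (lebesgue_xv R d (box R d (e / 2) (e / 2)) <= 0)%E.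
  rewrite -[leRHS]N0; apply: le_measure; rewrite ?inE//; exact: measurable_box.
by rewrite leNgt (box0 _ e2).
Qed.

Lemma bounded_fun_le (R : realType) (T : Type) (f : T -> R) (M : R) :
  (forall x, `|f x| <= M) -> bounded_fun f.
Proof.
move=> fM; exists M; split; first exact: num_real.
by move=> y My x _; rewrite /= (le_trans (fM x))// ltW.
Qed.

Lemma exists_small_tails (R : realType) (a b e : R) : 0 < a -> 0 < b -> 0 < e ->
  exists n, a * 4^-1 ^+ n < e /\ b * n.+1%:R^-1 < e.
Proof.
move=> a0 b0 e0; exists (Num.truncn ((a + b) / e)).
set n := Num.truncn _; have n1 : (a + b) / e < n.+1%:R by exact: truncnS_gt.
rewrite ltr_pdivrMr// in n1.
have n4 : (n.+1%:R : R) <= 4 ^+ n.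
  by rewrite -natrX ler_nat; elim: (n) => // k IH; rewrite expnS; lia.
have ea : a < n.+1%:R * e by lra.
have eb : b < n.+1%:R * e by lra.
split; last by rewrite ltr_pdivrMr// mulrC.
rewrite exprVn ltr_pdivrMr ?exprn_gt0//; apply: (lt_le_trans ea).
by rewrite mulrC ler_wpM2l// ltW.
Qed.

Theorem theorem4p3 (R : realType) (d : nat) (d_ge2 : (2 <= d)%N) :
  (exists (g : 'rV[R]_d -> R) (f : 'rV[R]_d * 'rV[R]_d -> R),
    [/\ continuous g /\ compact_support g,
        measurable_fun setT f /\ bounded_fun f,
        distributional_solution (fun z => f z.2) (fun z => g z.2.1)
      & ~ hessian_v_Linfty_loc f]) /\
  (exists C c : R, [/\ 0 < C, 0 < c &
    \forall eps \near 0^'+,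
      exists (g : 'rV[R]_d -> R) (f : 'rV[R]_d * 'rV[R]_d -> R),
      [/\ [/\ smooth g, compact_support g
            & ('N[lebesgue_rV R d]_+oo[EFin \o g] <= C%:E)%E],
          smooth f /\ bounded_fun f,
          classical_solution (fun z => f z.2) (fun z => g z.2.1),
          ('N[lebesgue_xv R d]_+oo[EFin \o f] <= C%:E)%E
        & ((c * Num.sqrt (ln (1 / eps)))%:E <=
            'N[lebesgue_xv R d]_+oo[(fun p => (frobenius (hessian_v f p))%:E)])%E]]).
Proof.
pose i0 : 'I_d := Ordinal (ltnW d_ge2); pose i1 : 'I_d := Ordinal d_ge2.
have [phi [F [W [K [B [[sphi sF] [K0 phiK] phi_supp [B0 [FB WB W0]] [cellE cellW]]]]]]] :=
  @exists_cell R d i0 i1 isT.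
pose fn := solution_sum F; pose gn := forcing_sum phi.
have sfn n : smooth (fn n) by exact: smooth_solution_sum.
have sgn n : smooth (gn n) by exact: smooth_forcing_sum.
have eqn n : stationary_equation (fn n) (gn n) by exact: solution_sum_equation.
have fnB n p : `|fn n p| <= 2 * B by exact: solution_sum_bounded.
have gnB n x : `|gn n x| <= 2 * K by exact: forcing_sum_bounded.
have gn_supp n x : ~ cube R d 1 x -> gn n x = 0.
  move=> nx; apply: (forcing_sum_support phi_supp).
  by rewrite leNgt; apply/negP => x1; apply: nx; exact: ltW.
have mixedE n p : 'D_(0 : 'rV[R]_d, Defs.basis R i0)
    (fun q => 'D_(0 : 'rV[R]_d, Defs.basis R i1) (fn n) q) p =
    hessian_v (fn n) p i0 i1 by rewrite mxE.
have BB : 0 < 2 * B by rewrite mulr_gt0.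
have KK : 0 < 2 * K by rewrite mulr_gt0.
split.
- have [f ffn] := exists_uniform_limit (fun n m p => @solution_sum_cauchy R d F B B0 FB n m p).
  have [g ggn] := exists_uniform_limit
    (fun n m x => @forcing_sum_cauchy R d phi K K0 phiK phi_supp n m x).
  have lim e : 0 < e -> exists n, 2 * B * 4^-1 ^+ n < e /\ 2 * K * n.+1%:R^-1 < e.
    exact: exists_small_tails.
  have cf : continuous f.
    apply: (uniform_limit_continuous ffn) => [n|e /lim[n [ne _]]]; last by exists n.
    exact: smooth_continuous.
  have cg : continuous g.
    apply: (uniform_limit_continuous ggn) => [n|e /lim[n [_ ne]]]; last by exists n.
    exact: smooth_continuous.
  have fB p : `|f p| <= 2 * B.
    by have := ffn 0%N p; rewrite /solution_sum big_nil subr0 expr0 mulr1.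
  have gB x : `|g x| <= 2 * K.
    by have := ggn 0%N x; rewrite /forcing_sum big_nil subr0 invr1 mulr1.
  exists g, f; split.
  + split=> //; apply: (compact_support_sub (@compact_cube R d 1)) => x nx.
    apply: contrapT => /eqP; rewrite -normr_gt0 => /lim[n [_ ne]].
    have := ggn n x; rewrite [forcing_sum phi n x]gn_supp// subr0 => gn0.
    by have := le_lt_trans gn0 ne; rewrite ltxx.
  + by split; [exact: continuous_measurable_phase|exact: bounded_fun_le fB].
  + exact: (limit_distributional sfn sgn eqn fnB gnB cf cg fB gB ffn ggn lim).
  + apply: (@not_hessian_Linfty_loc R d i0 i1 f fn
      (fun n => W 0 * (\sum_(0 <= k < n) k.+1%:R^-1) - B) (2 * B) (2 * B)) => //.
      by move=> n p p1 p2; exact: (mixed_derivative_lower_bound sF B0 WB cellW).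
    (* The harmonic sum has to exceed (A + B) / W 0 in order to beat the bounded error B. *)
    move=> A; have [n nA] := sum_harmonic_unbounded ((A + B) / W 0).
    by exists n; rewrite lerBrDr mulrC -ler_pdivrMr.
- exists (2 * B + 2 * K), (W 0); split => //; first by rewrite addr_gt0.
  near=> eps.
  (* The number of scales is chosen after eps, just so that the harmonic sum exceeds the required
     rate; the bounds 2 B and 2 K do not depend on it. *)
  have [n nA] := sum_harmonic_unbounded (Num.sqrt (ln (1 / eps))).
  exists (gn n), (fn n); split.
  + split=> //; first exact: compact_support_sub (@compact_cube R d 1) (gn_supp n).
    apply: Lnormy_le => [|x]; first by rewrite addr_ge0// ltW.
    by rewrite (le_trans (gnB n x))// lerDr ltW.
  + by split=> //; exact: bounded_fun_le (fnB n).
  + exact: stationary_classical.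
  + apply: Lnormy_le => [|p]; first by rewrite addr_ge0// ltW.
    by rewrite (le_trans (fnB n p))// lerDl ltW.
  + pose w p := 'D_(0 : 'rV[R]_d, Defs.basis R i0)
      (fun q => 'D_(0 : 'rV[R]_d, Defs.basis R i1) (fn n) q) p.
    have cw : continuous w.
      by apply: smooth_continuous; apply: smooth_derive; exact: smooth_derive.
    have wh p : w p <= `|frobenius (hessian_v (fn n) p)|.
      rewrite /w mixedE (le_trans (ler_norm _))// (le_trans (frobenius_entry i0 i1 _))//.
      exact: ler_norm.
    apply: le_trans (Lnormy_ge_value cw wh).
    rewrite lee_fin /w (mixed_derivative_solution_sum sF cellW).
    (* All dilations fix the origin, so there the mixed derivative equals W 0 times the harmonic sum
       exactly, which gives c = W 0. *)
    have W0k k : W (dilation (8 ^+ k) (2 ^+ k) 0) = W 0.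
      by congr W; apply: injective_projections; rewrite /= scaler0.
    under eq_bigr do rewrite W0k.
    by rewrite -mulr_suml mulrC ler_wpM2r// ltW.
Unshelve. all: by end_near. Qed.
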